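(* Let $f:2^N\to\mathbb{R}_{\ge 0}$ be a normalized monotone submodular function with $|N|=n$ and multilinear extension $F$ (extended to $\mathbb{R}_{\ge0}^N$ by $F(x)=F(x\wedge\mathbf{1})$), let $a:N\to[0,1]$ be a positive cost vector, $\|a\|_\infty=\max_j a_j$, let $\varepsilon>0$, and let $\mathrm{opt}=\max\{F(x): x\in[0,1]^N,\ \langle a,x\rangle\le 1\}$. For any constant $c>0$, there is a deterministic algorithm (parallel-greedy-knapsack) with oracle access to $F$ and to coordinates of $\nabla F$ that computes a vector $x$ with the following properties: (a) $\langle a,x\rangle\le 1$; (b) $F(x)\ge(1-O(\varepsilon))\left(1-e^{-(1-\|a\|_\infty)}\right)\mathrm{opt}$; (c) if $F(x)<(1-O(\varepsilon))(1-e^{-1})\mathrm{opt}$, then there is an item $j\in N$ such that $F(x+e_j)\ge(1-O(\varepsilon))(1-e^{-1})\mathrm{opt}$; (d) if $a_j\ge \frac{c\varepsilon^2}{\log n}$, then $x_j\in\{0,1\}$. The algorithm has depth (adaptivity) $O\!\left(\frac{\log n}{\varepsilon^2}\right)$, uses $O\!\left(\frac{n\log n}{\varepsilon^2}\right)$ oracle calls to $F$ and to coordinates of $\nabla F$, and does total work $\tilde O\!\left(\frac{n}{\varepsilon^2}\right)$.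
   Context: Submodular: $f(A)+f(B)\ge f(A\cup B)+f(A\cap B)$; monotone: $S\subseteq T\Rightarrow f(S)\le f(T)$; normalized: $f(\emptyset)=0$. Multilinear extension: $F(x)=\sum_{S\subseteq N}f(S)\prod_{i\in S}x_i\prod_{i\notin S}(1-x_i)$ for $x\in[0,1]^N$; $x\wedge\mathbf{1}$ is the coordinatewise minimum with the all-ones vector; $e_j$ is the $j$-th coordinate vector. Depth/adaptivity is the number of sequential rounds of oracle queries, where queries in a round depend only on answers from earlier rounds. $\tilde O$ suppresses polylogarithmic factors. *)

(* Defs.v *)
From HB Require Import structures.
From mathcomp Require Import all_boot all_order all_algebra.
From mathcomp Require Import all_classical all_reals all_analysis.
Set Implicit Arguments.
Unset Strict Implicit.
Unset Printing Implicit Defensive.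
Import Order.TTheory GRing.Theory Num.Theory.
Import numFieldNormedType.Exports.
Local Open Scope ring_scope.

(* The ground set is N = 'I_n, and R^N is 'rV[R]_n. *)

Definition normalized_setfun (R : realType) n (f : {set 'I_n} -> R) : Prop :=
  f finset.set0 = 0.

Definition monotone_setfun (R : realType) n (f : {set 'I_n} -> R) : Prop :=
  forall S T : {set 'I_n}, S \subset T -> f S <= f T.

Definition submodular_setfun (R : realType) n (f : {set 'I_n} -> R) : Prop :=
  forall A B : {set 'I_n}, f (A :|: B) + f (A :&: B) <= f A + f B.

(* The defining polynomial of the multilinear extension, on all of R^N. *)
Definition multilinear (R : realType) n (f : {set 'I_n} -> R)
    (x : 'rV[R]_n) : R :=
  \sum_(S : {set 'I_n})
    f S * ((\prod_(i in S) x 0 i) * \prod_(i in ~: S) (1 - x 0 i)).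

Definition nonneg_vec (R : realType) n (x : 'rV[R]_n) : Prop :=
  forall j, 0 <= x 0 j.

Definition unit_cube (R : realType) n (x : 'rV[R]_n) : Prop :=
  forall j, 0 <= x 0 j <= 1.

(* F on the nonnegative orthant: F(x) = F(x /\ 1). *)
Definition mlext (R : realType) n (f : {set 'I_n} -> R) (x : 'rV[R]_n) : R :=
  multilinear f (map_mx (Num.min 1) x).

(* The j-th coordinate of the gradient at a point of [0,1]^N.  The polynomial,
   rather than [mlext], is differentiated so that the (two-sided) derivative
   also exists on the boundary of the cube. *)
Definition mlgrad (R : realType) n (f : {set 'I_n} -> R) (x : 'rV[R]_n)
    (j : 'I_n) : R :=
  'D_(delta_mx 0 j) (multilinear f) x.

Definition dotv (R : realType) n (a x : 'rV[R]_n) : R :=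
  \sum_(j < n) a 0 j * x 0 j.

Definition sup_norm (R : realType) n (a : 'rV[R]_n) : R :=
  \big[Num.max/0]_(j < n) `|a 0 j|.

(* The feasible region is compact and nonempty and the polynomial is
   continuous, so this supremum is a maximum. *)
Definition knapsack_opt (R : realType) n (f : {set 'I_n} -> R)
    (a : 'rV[R]_n) : R :=
  sup [set mlext f x | x in [set x | unit_cube x /\ dotv a x <= 1]]%classic.

(* Model of computation: a real RAM with an oracle.  Programs are first-order
   syntax, so a program is one uniform algorithm: it does not depend on n, on
   eps, on the costs or on f.  The memory consists of integer variables and of
   real arrays indexed by integers, all named by numbers.  There are no real
   constants except integer ones, no rounding of reals and no transcendental
   functions.  As a program is fixed while its input grows, its expressions have
   bounded size, and every executed command or test is charged one unit of
   work. *)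
Inductive nexp : Type :=
| NConst of nat
| NVar of nat
| NAdd of nexp & nexp
| NSub of nexp & nexp.

Inductive rexp : Type :=
| RNat of nexp
| RCell of nat & nexp
| RAdd of rexp & rexp
| RSub of rexp & rexp
| RMul of rexp & rexp
| RDiv of rexp & rexp.

Inductive bexp : Type :=
| BNatLe of nexp & nexp
| BRealLe of rexp & rexp
| BNot of bexp
| BAnd of bexp & bexp.

Inductive cmd : Type :=
| CSkip
| CSetNat of nat & nexp             (* variable, value *)
| CSetCell of nat & nexp & rexp     (* array, index, value *)
| CSeq of cmd & cmd
| CIf of bexp & cmd & cmd
| CWhile of bexp & cmd
| CQueryF of nat & nat & nexp           (* point; answer array, index *)
| CQueryGrad of nat & nexp & nat & nexp (* point, coordinate; answer *)
| CRound.

(* [pending] holds the queries of the current round as triples (array, index,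
   answer).  The answers reach the memory only at the [CRound] that closes the
   round, so a query depends only on answers from earlier rounds. *)
Record state (R : Type) : Type := State {
  nmem : nat -> nat;
  rmem : nat -> nat -> R;
  pending : seq (nat * nat * R);
  rounds : nat;
  queries : nat;
  work : nat }.

Fixpoint neval (m : nat -> nat) (e : nexp) : nat :=
  match e with
  | NConst k => k
  | NVar x => m x
  | NAdd e1 e2 => (neval m e1 + neval m e2)%N
  | NSub e1 e2 => (neval m e1 - neval m e2)%N
  end.

Fixpoint reval (R : realType) (s : state R) (e : rexp) : R :=
  match e with
  | RNat k => (neval (nmem s) k)%:R
  | RCell A i => rmem s A (neval (nmem s) i)
  | RAdd e1 e2 => reval s e1 + reval s e2
  | RSub e1 e2 => reval s e1 - reval s e2
  | RMul e1 e2 => reval s e1 * reval s e2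
  | RDiv e1 e2 => reval s e1 / reval s e2
  end.

Fixpoint beval (R : realType) (s : state R) (b : bexp) : bool :=
  match b with
  | BNatLe e1 e2 => (neval (nmem s) e1 <= neval (nmem s) e2)%N
  | BRealLe e1 e2 => reval s e1 <= reval s e2
  | BNot b1 => ~~ beval s b1
  | BAnd b1 b2 => beval s b1 && beval s b2
  end.

Definition upd (T : Type) (m : nat -> T) (i : nat) (v : T) : nat -> T :=
  fun k => if k == i then v else m k.

Definition upd_cell (R : Type) (m : nat -> nat -> R) (A i : nat) (v : R) :
    nat -> nat -> R :=
  upd m A (upd (m A) i v).

Definition tick (R : Type) (s : state R) : state R :=
  State (nmem s) (rmem s) (pending s) (rounds s) (queries s) (work s).+1.

Definition set_nat (R : Type) (s : state R) (x v : nat) : state R :=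
  State (upd (nmem s) x v) (rmem s) (pending s) (rounds s) (queries s)
    (work s).

Definition set_cell (R : Type) (s : state R) (A i : nat) (v : R) : state R :=
  State (nmem s) (upd_cell (rmem s) A i v) (pending s) (rounds s) (queries s)
    (work s).

Definition ask (R : Type) (s : state R) (B i : nat) (v : R) : state R :=
  State (nmem s) (rmem s) (rcons (pending s) (B, i, v)) (rounds s)
    (queries s).+1 (work s).

Definition close_round (R : Type) (s : state R) : state R :=
  State (nmem s)
    (foldl (fun m q => upd_cell m q.1.1 q.1.2 q.2) (rmem s) (pending s))
    [::] (rounds s).+1 (queries s) (work s).

Definition vec_of (R : realType) n (s : state R) (A : nat) : 'rV[R]_n :=
  \row_(j < n) rmem s A j.

(* Big-step semantics.  A query passes its point by reference, as the first n
   cells of an array; F may be queried on the nonnegative orthant and the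
   coordinates of its gradient on the unit cube, and a program that queries any
   other point has no execution. *)
Inductive exec (R : realType) n (f : {set 'I_n} -> R) :
    cmd -> state R -> state R -> Prop :=
| ExSkip s : exec f CSkip s (tick s)
| ExSetNat x e s :
    exec f (CSetNat x e) s (tick (set_nat s x (neval (nmem s) e)))
| ExSetCell A i e s :
    exec f (CSetCell A i e) s
      (tick (set_cell s A (neval (nmem s) i) (reval s e)))
| ExSeq c1 c2 s1 s2 s3 :
    exec f c1 s1 s2 -> exec f c2 s2 s3 -> exec f (CSeq c1 c2) s1 s3
| ExIf b c1 c2 s s' :
    exec f (if beval s b then c1 else c2) (tick s) s' ->
    exec f (CIf b c1 c2) s s'
| ExWhileDone b c s :
    ~~ beval s b -> exec f (CWhile b c) s (tick s)
| ExWhileStep b c s1 s2 s3 :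
    beval s1 b -> exec f c (tick s1) s2 -> exec f (CWhile b c) s2 s3 ->
    exec f (CWhile b c) s1 s3
| ExQueryF A B i s :
    nonneg_vec (vec_of n s A) ->
    exec f (CQueryF A B i) s
      (tick (ask s B (neval (nmem s) i) (mlext f (vec_of n s A))))
| ExQueryGrad A e B i s (j : 'I_n) :
    nat_of_ord j = neval (nmem s) e -> unit_cube (vec_of n s A) ->
    exec f (CQueryGrad A e B i) s
      (tick (ask s B (neval (nmem s) i) (mlgrad f (vec_of n s A) j)))
| ExRound s : exec f CRound s (tick (close_round s)).

Lemma exec_deterministic (R : realType) n (f : {set 'I_n} -> R) c s s1 s2 :
  exec f c s s1 -> exec f c s s2 -> s1 = s2.
Proof.
move=> h; elim: h s2 => {c s s1}
  [s|x e s|A i e s|c1 c2 s s1 s3 _ IH1 _ IH2|b c1 c2 s s' _ IH|b c s nb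
  |b c s s1 s3 hb _ IH1 _ IH2|A B i s _|A e B i s j ej _|s] s2 h;
  inversion h; subst; try reflexivity.
- match goal with H : exec f c1 s _ |- _ =>
    by apply: IH2; rewrite (IH1 _ H) end.
- exact: IH.
- match goal with H : is_true (beval _ _) |- _ => by rewrite H in nb end.
- match goal with H : is_true (~~ _) |- _ => by rewrite hb in H end.
- match goal with H : exec f c (tick s) _ |- _ =>
    by apply: IH2; rewrite (IH1 _ H) end.
- match goal with H : nat_of_ord ?k = _ |- _ =>
    have -> : j = k by apply: val_inj; rewrite /= ej H end.
  reflexivity.
Qed.

(* Integer variable 0 holds n, cell 0 of array 0 holds eps, and array 1 holds
   the costs; the rest of the memory is zero.  The output is read in array 2. *)
Definition init_state (R : realType) n (a : 'rV[R]_n) (eps : R) : state R :=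
  State
    (fun x => if x == 0%N then n else 0%N)
    (fun A i =>
       if A == 0%N then (if i == 0%N then eps else 0)
       else if A == 1%N then
         (if insub i is Some j then a 0 (j : 'I_n) else 0)
       else 0)
    [::] 0 0 0.

Definition output (R : realType) n (s : state R) : 'rV[R]_n := vec_of n s 2.

(* Main.v *)
Require Import Defs.
From HB Require Import structures.
From mathcomp Require Import all_boot all_order all_algebra.
From mathcomp Require Import all_classical all_reals all_analysis.
From mathcomp Require Import zify ring lra.
Import Order.TTheory GRing.Theory Num.Theory.
Import numFieldNormedType.Exports.
Local Open Scope ring_scope.
Set Implicit Arguments.
Unset Strict Implicit.
Unset Printing Implicit Defensive.

(* The algorithm is the continuous greedy method for a knapsack budget, run with
   density thresholds: an item j is active at x for the threshold lam if
   x_j < 1 and lam * a_j <= F'_j(x).  One step spends a fixed amount eta of the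
   budget, split evenly over the active items.  By concavity along nonnegative
   directions the step gains at least lam * eta * s' / s, where s and s' count
   the active items before and after it; since 1 - s' / s <= ln s - ln s', the
   losses at a fixed threshold telescope to lam * eta * (1 + ln n), and no line
   search is needed.  When no item is active, opt <= F(x) + lam and lam is
   multiplied by 1 - eps; the losses then form a geometric series.  With
   eta of order eps^2 / log n the number of rounds is at most 1 / eta.  Items of
   cost at least eta are taken integrally, and the run stops at the first such
   item that does not fit.

   Starting the thresholds within a constant factor of opt takes O(log n)
   rounds.  N steps of size 1 / N at a fixed threshold lam show that
   opt >= lam * n^(-1/N) or that opt <= F(x) + lam, so a bisection of the
   exponent r of the current ratio 2^r between the bounds costs O(log n / r)
   rounds per test; this sum is dominated by its last terms.

   If the largest cost is close to 1, the right-hand side of (b) is tiny and an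
   additive error is not affordable.  If the run stops at an item j after
   spending at most 1/16, then either F(x) >= opt / 8, or e_j alone has value at
   least 3/4 opt; comparing F'_j(x) with 6 F(x) decides which one to output. *)

(** * The multilinear extension *)

(** The initial range of the bisection comes from singletons: if [M] is the largest [F(e_j)], then
    [M <= opt <= n M]. The machine has no logarithm, so the least [L] with [n <= 2^L] stands for
    [log n] throughout, and the candidate thresholds are [M 2^i]. The constant [c] enters only
    through an integer [m > 1/c]: with [eta = eps^2 / (m L)] and [L >= ln n], every item in the
    range of (d) costs at least [eta]. A spread step may push a coordinate beyond 1. This is
    harmless because [F] is evaluated at the capped point while the full cost is charged, so no step
    has to be cut short. When [b] has been spent, the gap [opt - F(x)] is at most
    [opt e^(-(1-eps) b) + 10 eps opt]. The factor [1 - e^(-b)] absorbs the additive term only for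
    [b] bounded below; [b > 1/16] makes that factor at least 1/32, which is the origin of the final
    constant 512. *)

Section Multilinear.
Context {R : realType} {n : nat}.
Implicit Types (x y w z : 'rV[R]_n) (i j k : 'I_n) (v t : R).
Implicit Types (S T : {set 'I_n}) (H : 'rV[R]_n -> R).

Definition set_coord x k v : 'rV[R]_n := \row_i (if i == k then v else x 0 i).

Definition indicator_vec S : 'rV[R]_n := \row_i (i \in S)%:R.

Definition multiaffine H := forall x k,
  H x = x 0 k * H (set_coord x k 1) + (1 - x 0 k) * H (set_coord x k 0).

Lemma set_coordE x k v : set_coord x k v 0 k = v.
Proof. by rewrite mxE eqxx. Qed.

Lemma set_coord_neq x k v i : i != k -> set_coord x k v 0 i = x 0 i.
Proof. by move=> /negPf h; rewrite mxE h. Qed.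

Lemma set_coordK x k v t : set_coord (set_coord x k v) k t = set_coord x k t.
Proof. by apply/rowP => i; rewrite !mxE; case: eqP. Qed.

Lemma set_coordC x i j v t : i != j ->
  set_coord (set_coord x i v) j t = set_coord (set_coord x j t) i v.
Proof.
move=> ij; apply/rowP => k; rewrite !mxE.
by case: (eqVneq k j) => [->|//]; rewrite eq_sym (negPf ij).
Qed.

Lemma unit_cube_set_coord x k v :
  unit_cube x -> 0 <= v <= 1 -> unit_cube (set_coord x k v).
Proof. by move=> hx hv i; rewrite mxE; case: eqP. Qed.

Lemma multiaffine_set_coord H x k v : multiaffine H ->
  H (set_coord x k v) =
  v * H (set_coord x k 1) + (1 - v) * H (set_coord x k 0).
Proof. by move=> hH; rewrite (hH (set_coord x k v) k) set_coordE !set_coordK. Qed.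

Lemma multiaffine_comp_set_coord H k v :
  multiaffine H -> multiaffine (fun x => H (set_coord x k v)).
Proof.
move=> hH x i; have [->|ik] := eqVneq i k; first by rewrite !set_coordK; ring.
rewrite [LHS](hH _ i) set_coord_neq //.
by rewrite !(set_coordC _ _ _ (_ : k != i)) // eq_sym.
Qed.

Lemma multiaffineB H1 H2 : multiaffine H1 -> multiaffine H2 ->
  multiaffine (fun x => H1 x - H2 x).
Proof. by move=> h1 h2 x k; rewrite (h1 x k) (h2 x k); ring. Qed.

(* A multiaffine function is a convex combination of its values at the
   vertices; the coordinates are rounded one at a time. *)
Lemma multiaffine_ge0 H : multiaffine H ->
  (forall S, 0 <= H (indicator_vec S)) -> forall x, unit_cube x -> 0 <= H x.
Proof.
move=> hH hv.
suff rounding (s : seq 'I_n) x : unit_cube x ->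
    (forall i, i \notin s -> x 0 i = 0 \/ x 0 i = 1) -> 0 <= H x.
  by move=> x hx; apply: (rounding (enum 'I_n)) => // i; rewrite mem_enum.
elim: s x => [|k s IH] x hx hs.
  suff -> : x = indicator_vec [set i | x 0 i == 1] by [].
  apply/rowP => i; rewrite mxE inE; case: (hs i) => // ->; last by rewrite eqxx.
  by rewrite eq_sym oner_eq0.
rewrite (hH x k); have /andP[x0 x1] := hx k.
have hc v : v = 0 \/ v = 1 -> 0 <= H (set_coord x k v).
  move=> v01; apply: IH.
    by apply: unit_cube_set_coord => //; case: v01 => ->; rewrite lexx ler01.
  move=> i si; have [->|ik] := eqVneq i k; first by rewrite set_coordE.
  by rewrite set_coord_neq //; apply: hs; rewrite inE negb_or ik.
by rewrite addr_ge0 // mulr_ge0 ?subr_ge0 ?hc //; [right|left].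
Qed.

(** Hybrids that pass from [w] to [z] one coordinate at a time. The functions are affine in each
    coordinate, so telescoping over the hybrids replaces integration along a segment. *)
Definition mix w z (m : nat) : 'rV[R]_n :=
  \row_i (if (i < m)%N then z 0 i else w 0 i).

Lemma mix0 w z : mix w z 0 = w.
Proof. by apply/rowP => i; rewrite mxE. Qed.

Lemma mixn w z : mix w z n = z.
Proof. by apply/rowP => i; rewrite mxE ltn_ord. Qed.

Lemma mixS w z k : mix w z k.+1 = set_coord (mix w z k) k (z 0 k).
Proof.
apply/rowP => i; rewrite !mxE ltnS leq_eqVlt.
by case: (eqVneq i k) => [->|ik]; rewrite ?eqxx //= (negPf (ik : i != k :> nat)).
Qed.

Lemma mix_at w z k : mix w z k 0 k = w 0 k.
Proof. by rewrite mxE ltnn. Qed.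

Lemma mix_sum H w z : H z - H w = \sum_(k < n) (H (mix w z k.+1) - H (mix w z k)).
Proof.
rewrite -{1}(mixn w z) -{2}(mix0 w z).
by rewrite -(big_mkord predT (fun m => H (mix w z m.+1) - H (mix w z m)))
           telescope_sumr.
Qed.

Lemma mix_between w z m i : w 0 i <= z 0 i -> w 0 i <= mix w z m 0 i <= z 0 i.
Proof. by move=> h; rewrite mxE; case: ifP; rewrite h lexx. Qed.

Lemma unit_cube_mix w z m : unit_cube w -> unit_cube z -> unit_cube (mix w z m).
Proof. by move=> hw hz i; rewrite mxE; case: ifP. Qed.

Variable f : {set 'I_n} -> R.

Lemma multilinearE x :
  multilinear f x = \sum_S f S * \prod_i (if i \in S then x 0 i else 1 - x 0 i).
Proof.
apply: eq_bigr => S _; congr (_ * _).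
rewrite [RHS](bigID (mem S)) /=; congr (_ * _); apply: eq_big => i //.
- by move=> ->.
- by rewrite inE.
- by rewrite inE => /negPf ->.
Qed.

Lemma multilinear_multiaffine : multiaffine (multilinear f).
Proof.
move=> x k; rewrite !multilinearE !mulr_sumr -big_split /=.
apply: eq_bigr => S _.
have rest v : \prod_(i | i != k)
    (if i \in S then set_coord x k v 0 i else 1 - set_coord x k v 0 i) =
    \prod_(i | i != k) (if i \in S then x 0 i else 1 - x 0 i).
  by apply: eq_bigr => i ik; rewrite set_coord_neq.
rewrite (bigD1 k) //= [in X in _ = X + _](bigD1 k) //=.
rewrite [in X in _ = _ + X](bigD1 k) //= !rest !set_coordE.
by case: ifP => _; ring.
Qed.

Lemma multilinear_indicator S : multilinear f (indicator_vec S) = f S.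
Proof.
rewrite multilinearE (bigD1 S) //= [X in _ * X]big1 => [|i _]; last first.
  by rewrite mxE; case: (i \in S); rewrite ?subr0.
rewrite mulr1 big1 ?addr0 // => T TS.
have /existsP[i iTS] : [exists i, (i \in T) != (i \in S)].
  apply: contraR TS; rewrite negb_exists => /forallP h.
  by apply/eqP/setP => i; have := h i; rewrite negbK => /eqP.
rewrite (bigD1 i) //= mxE; move: iTS.
by case: (i \in T); case: (i \in S) => //= _; rewrite ?subrr mul0r mulr0.
Qed.

Definition pdiff x j := multilinear f (set_coord x j 1) - multilinear f (set_coord x j 0).

Lemma pdiff_multiaffine j : multiaffine (pdiff ^~ j).
Proof.
by apply: multiaffineB; apply: multiaffine_comp_set_coord;
  exact: multilinear_multiaffine.
Qed.

Lemma multilinear_set_coord x k v :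
  multilinear f (set_coord x k v) = multilinear f x + (v - x 0 k) * pdiff x k.
Proof.
rewrite (multilinear_multiaffine x k) /pdiff.
by rewrite (multiaffine_set_coord x k v multilinear_multiaffine); ring.
Qed.

(** The polynomial is affine along [e_j], so the difference quotient equals [pdiff] for every
    nonzero increment. *)
Lemma mlgradE x j : mlgrad f x j = pdiff x j.
Proof.
rewrite /mlgrad /derive; apply: cvg_lim => //.
apply: cvg_near_cst; near=> h.
have h0 : h != 0 by near: h; exact: nbhs_dnbhs_neq.
have -> : (multilinear f \o shift x) (h *: delta_mx 0 j) =
    multilinear f (set_coord x j (x 0 j + h)).
  rewrite /=; congr (multilinear f _); apply/rowP => i; rewrite !mxE eqxx /=.
  by case: eqP => [->|_] /=; rewrite ?mulr1 ?mulr0 ?add0r // addrC.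
rewrite multilinear_set_coord addrC addKr addrC addKr.
by rewrite /GRing.scale /= mulrA mulVf // mul1r.
Unshelve. all: by end_near. Qed.

Hypothesis mono : monotone_setfun f.
Hypothesis subm : submodular_setfun f.

Lemma set_coord_indicator S k v : v = 0 \/ v = 1 ->
  set_coord (indicator_vec S) k v =
  indicator_vec (if v == 1 then k |: S else S :\ k).
Proof.
move=> v01; apply/rowP => i; rewrite !mxE.
case: v01 => ->; rewrite ?eqxx ?[0 == 1]eq_sym ?oner_eq0 !inE.
  by case: eqP => //= ->.
by case: eqP.
Qed.

Lemma pdiff_ge0 x j : unit_cube x -> 0 <= pdiff x j.
Proof.
apply: (multiaffine_ge0 (pdiff_multiaffine j)) => S.
rewrite /pdiff subr_ge0 !set_coord_indicator; try by [left|right].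
rewrite eqxx [0 == 1]eq_sym oner_eq0 !multilinear_indicator.
by apply: mono; apply/fintype.subsetP => i; rewrite !inE => /andP[_ ->]; rewrite orbT.
Qed.

(** The mixed second difference is again multiaffine, so its sign need only be checked at vertices;
    there it is submodularity for [S - k + j] and [S + k - j]. *)
Lemma pdiff_cross_le x j k : unit_cube x -> j != k ->
  pdiff (set_coord x k 1) j <= pdiff (set_coord x k 0) j.
Proof.
move=> hx jk; rewrite -subr_ge0.
pose H x := pdiff (set_coord x k 0) j - pdiff (set_coord x k 1) j.
apply: (@multiaffine_ge0 H) hx => [|S].
  by apply: multiaffineB;
    apply: (@multiaffine_comp_set_coord (pdiff ^~ j)); exact: pdiff_multiaffine.
rewrite /H; have e01 : (0 == 1 :> R) = false by rewrite eq_sym oner_eq0.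
rewrite /pdiff !set_coord_indicator ?(eqxx, e01); try by [left|right].
rewrite !multilinear_indicator.
have := subm (j |: (S :\ k)) ((k |: S) :\ j).
have -> : (j |: (S :\ k)) :|: ((k |: S) :\ j) = j |: (k |: S).
  by apply/setP => i; rewrite !inE; case: (i == j); case: (i == k); case: (i \in S).
have -> : (j |: (S :\ k)) :&: ((k |: S) :\ j) = (S :\ k) :\ j.
  apply/setP => i; rewrite !inE.
  case: (eqVneq i j) => [->|]; first by rewrite /= ?andbF.
  by case: (i == k); case: (i \in S).
by move=> h; lra.
Qed.

Lemma pdiff_set_coord_id x j v : pdiff (set_coord x j v) j = pdiff x j.
Proof. by rewrite /pdiff !set_coordK. Qed.

(** Along the hybrids, raising a coordinate [k != j] can only lower the derivative, by
    [pdiff_cross_le], and the derivative does not depend on coordinate [j]. *)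
Lemma pdiff_anti w z j : unit_cube w -> unit_cube z ->
  (forall i, w 0 i <= z 0 i) -> pdiff z j <= pdiff w j.
Proof.
move=> hw hz wz; rewrite -subr_le0 (mix_sum (pdiff^~ j)).
apply: sumr_le0 => k _; rewrite mixS subr_le0.
have [<-|jk] := eqVneq j k; first by rewrite pdiff_set_coord_id.
rewrite (multiaffine_set_coord _ _ _ (pdiff_multiaffine j)).
rewrite [leRHS](pdiff_multiaffine j _ k) mix_at.
have := @pdiff_cross_le (mix w z k) _ _ (unit_cube_mix k hw hz) jk.
by have := wz k; nra.
Qed.

Lemma multilinear_diff w z : multilinear f z - multilinear f w =
  \sum_(k < n) (z 0 k - w 0 k) * pdiff (mix w z k) k.
Proof.
rewrite mix_sum; apply: eq_bigr => k _.
by rewrite mixS multilinear_set_coord mix_at; ring.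
Qed.

(** Concavity in nonnegative directions, with the gradient taken at the end point: a step can then
    be credited with the items still active after it. *)
Lemma multilinear_diff_ge w z : unit_cube w -> unit_cube z ->
  (forall i, w 0 i <= z 0 i) ->
  \sum_k (z 0 k - w 0 k) * pdiff z k <= multilinear f z - multilinear f w.
Proof.
move=> hw hz wz; rewrite multilinear_diff; apply: ler_sum => k _.
apply: ler_wpM2l; first by rewrite subr_ge0.
apply: pdiff_anti => // [|i]; first exact: unit_cube_mix.
by have /andP[] := mix_between k (wz i).
Qed.

Lemma multilinear_diff_le w z : unit_cube w -> unit_cube z ->
  (forall i, w 0 i <= z 0 i) ->
  multilinear f z - multilinear f w <= \sum_k (z 0 k - w 0 k) * pdiff w k.
Proof.
move=> hw hz wz; rewrite multilinear_diff; apply: ler_sum => k _.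
apply: ler_wpM2l; first by rewrite subr_ge0.
apply: pdiff_anti => // [|i]; first exact: unit_cube_mix.
by have /andP[] := mix_between k (wz i).
Qed.

Lemma multilinear_le w z : unit_cube w -> unit_cube z ->
  (forall i, w 0 i <= z 0 i) -> multilinear f w <= multilinear f z.
Proof.
move=> hw hz wz; rewrite -subr_ge0 multilinear_diff.
apply: sumr_ge0 => k _; apply: mulr_ge0; first by rewrite subr_ge0.
by apply: pdiff_ge0; exact: unit_cube_mix.
Qed.

End Multilinear.

(** * Gradient bounds for the capped extension and the optimum *)

Section CappedExtension.
Context {R : realType} {n : nat}.
Variables (f : {set 'I_n} -> R) (a : 'rV[R]_n).
Hypothesis fnorm : normalized_setfun f.
Hypothesis mono : monotone_setfun f.
Hypothesis subm : submodular_setfun f.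
Hypothesis cost : forall j, 0 < a 0 j <= 1.
Implicit Types (x y : 'rV[R]_n) (i j : 'I_n) (lam eta : R).

Definition cap x : 'rV[R]_n := map_mx (Num.min 1) x.

(** Taken at the capped point because gradient queries are legal only on the cube, which the iterate
    may leave. *)
Definition slope x j : R := pdiff f (cap x) j.

Definition active lam x : {set 'I_n} :=
  [set j | (x 0 j < 1) && (lam * a 0 j <= slope x j)].

Lemma cap_le1 x j : x 0 j <= 1 -> cap x 0 j = x 0 j.
Proof. by move=> h; rewrite mxE min_r. Qed.

Lemma unit_cube_cap x : nonneg_vec x -> unit_cube (cap x).
Proof. by move=> hx j; rewrite mxE le_min ler01 hx ge_min lexx. Qed.

Lemma cap_id x : unit_cube x -> cap x = x.
Proof. by move=> hx; apply/rowP => j; rewrite cap_le1 //; case/andP: (hx j). Qed.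

Lemma unit_cube_nonneg x : unit_cube x -> nonneg_vec x.
Proof. by move=> hx j; case/andP: (hx j). Qed.

Lemma cap_mono x y : (forall i, x 0 i <= y 0 i) -> forall i, cap x 0 i <= cap y 0 i.
Proof. by move=> h i; rewrite !mxE le_min ge_min lexx /= ge_min h orbT. Qed.

Lemma nonneg_le x y : nonneg_vec x -> (forall i, x 0 i <= y 0 i) -> nonneg_vec y.
Proof. by move=> hx xy i; apply: le_trans (hx i) (xy i). Qed.

Lemma mlext_le x y : nonneg_vec x -> (forall i, x 0 i <= y 0 i) ->
  mlext f x <= mlext f y.
Proof.
move=> hx xy; have hy := nonneg_le hx xy.
by apply: (multilinear_le mono); [exact: unit_cube_cap..|exact: cap_mono].
Qed.

Lemma slope_anti x y j : nonneg_vec x -> (forall i, x 0 i <= y 0 i) ->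
  slope y j <= slope x j.
Proof.
move=> hx xy; have hy := nonneg_le hx xy.
by apply: (pdiff_anti subm); [exact: unit_cube_cap..|exact: cap_mono].
Qed.

Lemma slope_ge0 x j : nonneg_vec x -> 0 <= slope x j.
Proof. by move=> hx; apply: (pdiff_ge0 mono); exact: unit_cube_cap. Qed.

Lemma active_anti lam x y : nonneg_vec x -> (forall i, x 0 i <= y 0 i) ->
  active lam y \subset active lam x.
Proof.
move=> hx xy; apply/fintype.subsetP => j; rewrite !inE => /andP[y1 hy].
by rewrite (le_lt_trans (xy j) y1) (le_trans hy) ?slope_anti.
Qed.

Lemma nonneg0 : nonneg_vec (0 : 'rV[R]_n).
Proof. by move=> j; rewrite mxE. Qed.

Lemma unit_cube0 : unit_cube (0 : 'rV[R]_n).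
Proof. by move=> j; rewrite mxE lexx ler01. Qed.

Lemma dotv0 : dotv a 0 = 0.
Proof. by rewrite /dotv big1 // => j _; rewrite mxE mulr0. Qed.

Lemma mlext0 : mlext f 0 = 0.
Proof.
rewrite /mlext -/(cap 0) cap_id; last exact: unit_cube0.
have -> : (0 : 'rV[R]_n) = indicator_vec finset.set0.
  by apply/rowP => j; rewrite !mxE inE.
by rewrite multilinear_indicator.
Qed.

Lemma mlext_ge0 x : nonneg_vec x -> 0 <= mlext f x.
Proof. by move=> hx; rewrite -mlext0 mlext_le // => [|j]; rewrite ?mxE //; exact: nonneg0. Qed.

Lemma dotv_cap_le x : nonneg_vec x -> dotv a (cap x) <= dotv a x.
Proof.
move=> hx; apply: ler_sum => j _; apply: ler_wpM2l.
  by case/andP: (cost j) => /ltW.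
by rewrite mxE ge_min lexx orbT.
Qed.

Lemma mlext_cap x : nonneg_vec x -> mlext f (cap x) = mlext f x.
Proof. by move=> hx; rewrite /mlext -!/(cap _) [cap (cap x)]cap_id //; exact: unit_cube_cap. Qed.

(** Capping keeps the value and does not raise the cost, so a feasible point outside the cube is no
    better than one inside. The value at the all-ones vector bounds the supremum. *)
Lemma mlext_le_opt x : nonneg_vec x -> dotv a x <= 1 ->
  mlext f x <= knapsack_opt f a.
Proof.
move=> hx dx; apply: ub_le_sup.
  exists (multilinear f (const_mx 1)) => _ [y [hy _] <-].
  rewrite /mlext -/(cap y) cap_id //; apply: (multilinear_le mono) => // j.
    by rewrite mxE ler01 lexx.
  by rewrite mxE; case/andP: (hy j).
exists (cap x); last exact: mlext_cap.
split; first exact: unit_cube_cap.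
exact: le_trans (dotv_cap_le hx) dx.
Qed.

Lemma opt_le_ub (B : R) :
  (forall x, unit_cube x -> dotv a x <= 1 -> mlext f x <= B) ->
  knapsack_opt f a <= B.
Proof.
move=> h; apply: ge_sup; last by move=> _ [x [hx dx] <-]; exact: h.
exists (mlext f 0), 0 => //; split; first exact: unit_cube0.
by rewrite dotv0 ler01.
Qed.

Lemma opt_ge0 : 0 <= knapsack_opt f a.
Proof. by rewrite -mlext0 mlext_le_opt ?dotv0 ?ler01 //; exact: nonneg0. Qed.

(** Pass through the join [z] of [cap x] and [y]: monotonicity gives [F(y) <= F(z)], and concavity
    bounds [F(z) - F(x)] by the gradient at [x]. Unsaturated coordinates rise by at most [y_j],
    saturated ones do not move. *)
Lemma mlext_le_slope x y : nonneg_vec x -> unit_cube y ->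
  mlext f y <= mlext f x + \sum_(j | x 0 j < 1) y 0 j * slope x j.
Proof.
move=> hx hy; pose z : 'rV[R]_n := \row_j Num.max (cap x 0 j) (y 0 j).
have hc := unit_cube_cap hx.
have hz : unit_cube z.
  move=> j; rewrite mxE le_max ge_max.
  by case/andP: (hc j) => -> ->; case/andP: (hy j) => _ ->.
rewrite -lerBlDl; apply: (@le_trans _ _ (multilinear f z - multilinear f (cap x))).
  rewrite lerB // {1}/mlext -/(cap y) (cap_id hy).
  by apply: (multilinear_le mono) => // j; rewrite mxE le_max lexx orbT.
apply: le_trans (multilinear_diff_le subm _ _ _) _ => // [j|].
  by rewrite [leRHS]mxE le_max lexx.
rewrite [leRHS]big_mkcond; apply: ler_sum => j _.
have y0 : 0 <= y 0 j by case/andP: (hy j).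
case: ifP => [x1|/negbT]; last first.
  rewrite -leNgt => x1; have -> : z 0 j = 1; last first.
    by rewrite [cap x 0 j]mxE min_l // subrr mul0r.
  by rewrite !mxE min_l // max_l //; case/andP: (hy j).
apply: ler_wpM2r; first exact: slope_ge0.
rewrite mxE lerBlDr; case: (leP (cap x 0 j) (y 0 j)) => _; rewrite ?lerDl ?lerDr //.
by case/andP: (hc j).
Qed.

Lemma opt_le x lam : nonneg_vec x -> 0 <= lam ->
  (forall j, x 0 j < 1 -> slope x j <= lam * a 0 j) ->
  knapsack_opt f a <= mlext f x + lam.
Proof.
move=> hx lam0 h; apply: opt_le_ub => y hy dy.
apply: le_trans (mlext_le_slope hx hy) _; rewrite lerD2l.
apply: (@le_trans _ _ (lam * dotv a y)); last by rewrite ler_piMr.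
rewrite mulr_sumr [leLHS]big_mkcond; apply: ler_sum => j _.
have y0 : 0 <= y 0 j by case/andP: (hy j).
case: ifP => [x1|_]; last first.
  by rewrite !mulr_ge0 //; case/andP: (cost j) => /ltW.
by rewrite mulrA [leRHS]mulrC ler_wpM2l ?h.
Qed.

Lemma active0_opt_le x lam : nonneg_vec x -> 0 <= lam ->
  active lam x = finset.set0 -> knapsack_opt f a <= mlext f x + lam.
Proof.
move=> hx lam0 h; apply: opt_le => // j x1.
by move/setP/(_ j): h; rewrite !inE x1 => /negbT; rewrite -ltNge => /ltW.
Qed.

(** Below the cap the whole increment counts; coordinates that end at or above 1 contribute a
    nonnegative amount, which is dropped. *)
Lemma mlext_gain x y : nonneg_vec x -> (forall i, x 0 i <= y 0 i) ->
  \sum_(j | y 0 j < 1) (y 0 j - x 0 j) * slope y j <= mlext f y - mlext f x.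
Proof.
move=> hx xy; have hy := nonneg_le hx xy.
apply: le_trans (multilinear_diff_ge subm _ _ _);
  [|exact: unit_cube_cap..|exact: cap_mono].
rewrite [leLHS]big_mkcond; apply: ler_sum => j _.
case: ifP => [y1|_].
  by rewrite !cap_le1 // ltW //; apply: le_lt_trans (xy j) y1.
apply: mulr_ge0; last exact: slope_ge0.
by rewrite subr_ge0; exact: cap_mono.
Qed.

Lemma mlext_add_unit x j : nonneg_vec x -> x 0 j = 0 ->
  mlext f (x + delta_mx 0 j) = mlext f x + slope x j.
Proof.
move=> hx xj; rewrite /mlext -!/(cap _).
have -> : cap (x + delta_mx 0 j) = set_coord (cap x) j 1.
  apply/rowP => i; rewrite !mxE eqxx /=.
  by case: eqP => [->|_]; rewrite ?xj ?add0r ?minxx ?addr0.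
rewrite multilinear_set_coord cap_le1 ?xj ?ler01 //.
by rewrite subr0 mul1r.
Qed.

Lemma mlext_unit j : mlext f (delta_mx 0 j) = slope 0 j.
Proof.
by rewrite -[delta_mx 0 j]add0r mlext_add_unit ?mlext0 ?add0r ?mxE //; exact: nonneg0.
Qed.

Lemma nonneg_unit j : nonneg_vec (delta_mx 0 j : 'rV[R]_n).
Proof. by move=> i; rewrite mxE ler0n. Qed.

Lemma dotv_unit j : dotv a (delta_mx 0 j) = a 0 j.
Proof.
rewrite /dotv (bigD1 j) //= mxE !eqxx mulr1 big1 ?addr0 // => i ij.
by rewrite mxE (negPf ij) andbF mulr0.
Qed.

Lemma dotvD x y : dotv a (x + y) = dotv a x + dotv a y.
Proof. by rewrite /dotv -big_split; apply: eq_bigr => j _; rewrite mxE mulrDr. Qed.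

Lemma slope0_le_opt j : slope 0 j <= knapsack_opt f a.
Proof.
rewrite -mlext_unit mlext_le_opt ?dotv_unit //; first exact: nonneg_unit.
by case/andP: (cost j).
Qed.

Lemma opt_le_sum_slope0 : knapsack_opt f a <= \sum_j slope 0 j.
Proof.
apply: opt_le_ub => y hy _; apply: le_trans (mlext_le_slope nonneg0 hy) _.
rewrite mlext0 add0r big_mkcond; apply: ler_sum => j _.
have s0 := slope_ge0 j nonneg0; have /andP[y0 y1] := hy j.
by case: ifP => // _; rewrite ler_piMl.
Qed.

(** Equal shares of the cost, not of the coordinates, so that every active item earns the same
    guaranteed amount. *)
Definition spread eta (S : {set 'I_n}) x : 'rV[R]_n :=
  \row_j (x 0 j + if j \in S then eta / (a 0 j * #|S|%:R) else 0).

Lemma spread_ge eta S x i : 0 <= eta -> x 0 i <= spread eta S x 0 i.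
Proof.
move=> h; rewrite mxE lerDl; case: ifP => // _.
by rewrite divr_ge0 ?mulr_ge0 //; case/andP: (cost i) => /ltW.
Qed.

Lemma dotv_spread eta (S : {set 'I_n}) x : (0 < #|S|)%N ->
  dotv a (spread eta S x) = dotv a x + eta.
Proof.
move=> S0; rewrite /dotv.
under eq_bigr do rewrite mxE mulrDr.
rewrite big_split /=; congr (_ + _).
rewrite (eq_bigr (fun j => if j \in S then eta / #|S|%:R else 0)) => [|j _].
  by rewrite -big_mkcond /= sumr_const -[_ *+ _]mulr_natr divfK // pnatr_eq0 -lt0n.
case: ifP => _; last by rewrite mulr0.
have /andP[/lt0r_neq0 aj _] := cost j.
have k0 : #|S|%:R != 0 :> R by rewrite pnatr_eq0 -lt0n.
by field; rewrite aj k0.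
Qed.

(** An item of [S] still active after the step has its cost share [eta / #|S|] invested at density
    at least [lam]; all other contributions are nonnegative. *)
Lemma spread_gain eta lam (S : {set 'I_n}) x : nonneg_vec x -> 0 <= eta ->
  (0 < #|S|)%N ->
  lam * eta * (#|S :&: active lam (spread eta S x)|%:R / #|S|%:R)
    <= mlext f (spread eta S x) - mlext f x.
Proof.
move=> hx eta0 S0; set y := spread eta S x.
have xy i : x 0 i <= y 0 i by exact: spread_ge.
have hy := nonneg_le hx xy.
apply: le_trans (mlext_gain hx xy).
rewrite mulrA [lam * eta * _]mulrC -mulrA mulr_natl -sumr_const.
rewrite big_mkcond [leRHS]big_mkcond; apply: ler_sum => j _.
rewrite !inE; case y1: (y 0 j < 1); rewrite ?andbF //=.
rewrite [y 0 j]mxE [x 0 j + _]addrC addrK.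
case: (j \in S) => /=; last by rewrite mul0r.
have /andP[aj _] := cost j.
case: ifP => [h|_]; last first.
  by rewrite mulr_ge0 ?slope_ge0 // divr_ge0 // mulr_ge0 // ltW.
have -> : lam * eta / #|S|%:R = eta / (a 0 j * #|S|%:R) * (lam * a 0 j).
  have k0 : #|S|%:R != 0 :> R by rewrite pnatr_eq0 -lt0n.
  by field; rewrite (lt0r_neq0 aj) k0.
by rewrite ler_wpM2l // divr_ge0 // mulr_ge0 // ltW.
Qed.

End CappedExtension.

(** * Verification of programs *)

Notation nv_n := 0%N (only parsing).
Notation nv_j := 1%N (only parsing).
Notation nv_log := 2%N (only parsing).
Notation nv_count := 3%N (only parsing).
Notation nv_big := 4%N (only parsing).
Notation nv_lo := 5%N (only parsing).
Notation nv_hi := 6%N (only parsing).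
Notation nv_q := 7%N (only parsing).
Notation nv_steps := 8%N (only parsing).
Notation nv_t := 9%N (only parsing).
Notation nv_done := 10%N (only parsing).
Notation nv_pow := 11%N (only parsing).
Notation ar_eps := 0%N (only parsing).
Notation ar_cost := 1%N (only parsing).
Notation ar_x := 2%N (only parsing).
Notation ar_cap := 3%N (only parsing).
Notation ar_grad := 4%N (only parsing).
Notation ar_pow := 5%N (only parsing).
Notation ar_lam := 6%N (only parsing).
Notation ar_eta := 7%N (only parsing).
Notation ar_spent := 8%N (only parsing).
Notation ar_val := 9%N (only parsing).
Notation ar_top := 10%N (only parsing).
Notation ar_thr := 11%N (only parsing).

Definition CFor (body : cmd) : cmd :=
  CSeq (CSetNat nv_j (NConst 0))
    (CWhile (BNot (BNatLe (NVar nv_n) (NVar nv_j)))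
      (CSeq body (CSetNat nv_j (NAdd (NVar nv_j) (NConst 1))))).

Definition cell0 (A : nat) : rexp := RCell A (NConst 0).
Definition at_j (A : nat) : rexp := RCell A (NVar nv_j).
Definition rconst (m : nat) : rexp := RNat (NConst m).

Definition cap_cmd : cmd :=
  CFor (CIf (BRealLe (rconst 1) (at_j ar_x))
         (CSetCell ar_cap (NVar nv_j) (rconst 1))
         (CSetCell ar_cap (NVar nv_j) (at_j ar_x))).

Definition grad_cmd : cmd :=
  CSeq cap_cmd
    (CSeq (CFor (CQueryGrad ar_cap (NVar nv_j) ar_grad (NVar nv_j))) CRound).

Definition is_active : bexp :=
  BAnd (BNot (BRealLe (rconst 1) (at_j ar_x)))
    (BRealLe (RMul (cell0 ar_lam) (at_j ar_cost)) (at_j ar_grad)).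

Definition is_large : bexp := BRealLe (cell0 ar_thr) (at_j ar_cost).

Definition scan_cmd : cmd :=
  CSeq (CSetNat nv_count (NConst 0))
    (CSeq (CSetNat nv_big (NVar nv_n))
      (CFor (CIf is_active
        (CIf is_large (CSetNat nv_big (NVar nv_j))
          (CSetNat nv_count (NAdd (NVar nv_count) (NConst 1))))
        CSkip))).

Definition spread_cmd : cmd :=
  CFor (CIf (BAnd is_active (BNot is_large))
    (CSetCell ar_x (NVar nv_j)
      (RAdd (at_j ar_x)
        (RDiv (cell0 ar_eta) (RMul (at_j ar_cost) (RNat (NVar nv_count))))))
    CSkip).

Definition zero_cmd : cmd := CFor (CSetCell ar_x (NVar nv_j) (rconst 0)).

(** * Weakest preconditions with resource accounting *)

Section Hoare.
Context {R : realType} {n : nat}.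
Variable f : {set 'I_n} -> R.
Implicit Types (s : state R) (c : cmd) (Q : state R -> Prop).

(** Existence of an execution makes this total correctness; by [exec_deterministic] that execution
    is the only one. *)
Definition wp c Q s := exists s', exec f c s s' /\ Q s'.

Lemma wp_mono c Q Q' s : (forall s', Q s' -> Q' s') -> wp c Q s -> wp c Q' s.
Proof. by move=> h [s' [e q]]; exists s'; split => //; exact: h. Qed.

Lemma wp_skip Q s : Q (tick s) -> wp CSkip Q s.
Proof. by exists (tick s); split => //; constructor. Qed.

Lemma wp_set_nat x e Q s :
  Q (tick (set_nat s x (neval (nmem s) e))) -> wp (CSetNat x e) Q s.
Proof. by move=> h; eexists; split; [constructor|]. Qed.

Lemma wp_set_cell A i e Q s :
  Q (tick (set_cell s A (neval (nmem s) i) (reval s e))) ->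
  wp (CSetCell A i e) Q s.
Proof. by move=> h; eexists; split; [constructor|]. Qed.

Lemma wp_round Q s : Q (tick (close_round s)) -> wp CRound Q s.
Proof. by move=> h; eexists; split; [constructor|]. Qed.

Lemma wp_seq c1 c2 Q s : wp c1 (wp c2 Q) s -> wp (CSeq c1 c2) Q s.
Proof.
by move=> [s1 [e1 [s2 [e2 q]]]]; exists s2; split => //; apply: ExSeq e1 e2.
Qed.

Lemma wp_if b c1 c2 Q s :
  (if beval s b then wp c1 Q (tick s) else wp c2 Q (tick s)) ->
  wp (CIf b c1 c2) Q s.
Proof.
move=> h; have [s' [e q]] : wp (if beval s b then c1 else c2) Q (tick s).
  by case: ifP h.
by exists s'; split => //; constructor.
Qed.

(** The invariant is indexed by the number of iterations done; the bound [N] on this index is the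
    termination argument. *)
Lemma wp_while N (I : nat -> state R -> Prop) b c Q s :
  I 0 s -> (forall k s', I k s' -> (k <= N)%N) ->
  (forall k s', I k s' -> beval s' b -> wp c (I k.+1) (tick s')) ->
  (forall k s', I k s' -> ~~ beval s' b -> Q (tick s')) ->
  wp (CWhile b c) Q s.
Proof.
move=> I0 bound step final.
suff gen m k s' : (N - k < m)%N -> I k s' -> wp (CWhile b c) Q s'.
  exact: gen (ltnSn (N - 0)) I0.
elim: m k s' {I0} => // m IH k {}s hm Ik.
have kN := bound _ _ Ik.
have [sb|/negP nsb] := boolP (beval s b); last first.
  exists (tick s); split; first by constructor; apply/negP.
  by apply: final Ik _; apply/negP.
have [s1 [e1 I1]] := step _ _ Ik sb.
have kN1 := bound _ _ I1.
have [|s2 [e2 q]] := IH _ _ _ I1; first by lia.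
by exists s2; split => //; apply: ExWhileStep sb e1 e2.
Qed.

(** Frame condition and resource account in one relation, so that both compose by [effect_trans].
    Rounds and queries are exact, work is an upper bound, and the queue of open queries ends as it
    began. *)
Definition effect (Ns As : seq nat) (r q w : nat) s s' :=
  [/\ forall v, v \notin Ns -> nmem s' v = nmem s v,
      forall A, A \notin As -> rmem s' A = rmem s A,
      pending s' = pending s,
      rounds s' = (rounds s + r)%N /\ queries s' = (queries s + q)%N &
      (work s' <= work s + w)%N].

Lemma effect_refl Ns As w s : effect Ns As 0 0 w s s.
Proof. by split; rewrite ?addn0 ?leq_addr. Qed.

Lemma effect_trans Ns As r1 q1 w1 r2 q2 w2 s1 s2 s3 :
  effect Ns As r1 q1 w1 s1 s2 -> effect Ns As r2 q2 w2 s2 s3 ->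
  effect Ns As (r1 + r2) (q1 + q2) (w1 + w2) s1 s3.
Proof.
case=> n1 a1 p1 [e1 u1] h1; case=> n2 a2 p2 [e2 u2] h2; split.
- by move=> v hv; rewrite n2 // n1.
- by move=> A hA; rewrite a2 // a1.
- by rewrite p2.
- by rewrite e2 u2 e1 u1 !addnA.
- by lia.
Qed.

Lemma effect_weaken Ns As Ns' As' r q w w' s s' :
  effect Ns As r q w s s' -> {subset Ns <= Ns'} -> {subset As <= As'} ->
  (w <= w')%N -> effect Ns' As' r q w' s s'.
Proof.
case=> n1 a1 p1 e1 h1 hN hA hw; split => // [v hv|A hv|].
- by apply: n1; apply: contra hv; exact: hN.
- by apply: a1; apply: contra hv; exact: hA.
- by lia.
Qed.

Lemma effect_tick Ns As r q w s s' :
  effect Ns As r q w s s' -> effect Ns As r q w.+1 s (tick s').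
Proof. by case=> n1 a1 p1 e1 h1; split => //=; lia. Qed.

Lemma effect_set_nat Ns As r q w s s' x v : x \in Ns ->
  effect Ns As r q w s s' -> effect Ns As r q w s (set_nat s' x v).
Proof.
move=> xN [n1 a1 p1 e1 h1]; split => //= y yN; rewrite /upd.
by case: eqP => [yx|_]; [rewrite yx xN in yN|exact: n1].
Qed.

Lemma effect_set_cell Ns As r q w s s' A i v : A \in As ->
  effect Ns As r q w s s' -> effect Ns As r q w s (set_cell s' A i v).
Proof.
move=> xN [n1 a1 p1 e1 h1]; split => //= y yN; rewrite /upd_cell {1}/upd.
by case: eqP => [yx|_]; [rewrite yx xN in yN|exact: a1].
Qed.

Lemma effect_assign Ns As r q w w' s s' x v : x \in Ns -> (w < w')%N ->
  effect Ns As r q w s s' -> effect Ns As r q w' s (tick (set_nat s' x v)).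
Proof.
move=> xN ww e.
exact: effect_weaken (effect_tick (effect_set_nat v xN e)) (fun _ h => h) (fun _ h => h) ww.
Qed.

Lemma effect_store Ns As r q w w' s s' A i v : A \in As -> (w < w')%N ->
  effect Ns As r q w s s' -> effect Ns As r q w' s (tick (set_cell s' A i v)).
Proof.
move=> xN ww e.
exact: effect_weaken (effect_tick (effect_set_cell i v xN e)) (fun _ h => h) (fun _ h => h) ww.
Qed.

(** For bodies without queries. Each iteration adds two units to the body, for the loop test and the
    counter; the final two are the initial assignment and the failing test. *)
Lemma wp_for Ns As w (I : nat -> state R -> Prop) body s :
  nmem s nv_n = n -> nv_j \in Ns -> nv_n \notin Ns ->
  I 0%N s ->
  (forall k v s', I k s' -> I k (tick (set_nat s' nv_j v))) ->
  (forall k s', I k s' -> I k (tick s')) ->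
  (forall k (s' : state R), (k < n)%N -> effect Ns As 0 0 ((w + 2) * k + 1) s s' ->
     nmem s' nv_j = k -> I k s' ->
     wp body (fun s2 => [/\ effect Ns As 0 0 w s' s2, nmem s2 nv_j = k & I k.+1 s2])
        (tick s')) ->
  wp (CFor body)
    (fun s' => effect Ns As 0 0 ((w + 2) * n + 2) s s' /\ I n s') s.
Proof.
move=> sn jN nN I0 Ij It step; apply: wp_seq; apply: wp_set_nat.
apply: (@wp_while n (fun k s' => [/\ effect Ns As 0 0 ((w + 2) * k + 1) s s',
    nmem s' nv_j = k, (k <= n)%N & I k s'])).
- split => //; last exact: Ij.
  rewrite muln0; apply: effect_tick; apply: effect_set_nat => //.
  exact: effect_refl.
- by move=> k s' [].
- move=> k s' [e sj kn Ik] /=; rewrite sj.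
  have -> : nmem s' nv_n = n by case: e => -> //.
  rewrite -ltnNge => lt_kn; apply: wp_seq; apply: wp_mono (step _ _ lt_kn e sj Ik).
  move=> s2 [e2 sj2 I2]; apply: wp_set_nat => /=; rewrite sj2 addn1; split => //.
    apply: effect_tick; apply: effect_set_nat => //.
    have := effect_trans e e2; rewrite !addn0 => h; apply: effect_weaken h _ _ _ => //.
    by lia.
    by rewrite /upd eqxx addn1.
  by apply: Ij.
- move=> k s' [e sj kn Ik] /=; rewrite negbK sj.
  have -> : nmem s' nv_n = n by case: e => -> //.
  move=> nk; have kn' : k = n by apply/eqP; rewrite eqn_leq kn nk.
  rewrite kn' in e Ik; split; last exact: It.
  by apply: effect_weaken (effect_tick e) _ _ _ => //; lia.
Qed.

End Hoare.

Lemma upd_cellE (T : Type) (m : nat -> nat -> T) A i v A' i' :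
  upd_cell m A i v A' i' = if (A' == A) && (i' == i) then v else m A' i'.
Proof. by rewrite /upd_cell /upd; case: eqP => [->|]. Qed.

Lemma foldl_answers (T : Type) (m : nat -> nat -> T) (B k : nat) (v : nat -> T) :
  foldl (fun m q => upd_cell m q.1.1 q.1.2 q.2) m [seq (B, i, v i) | i <- iota 0 k]
  = fun A i => if (A == B) && (i < k)%N then v i else m A i.
Proof.
apply/funext => A; apply/funext => i; elim: k => [|k IH].
  by rewrite andbF.
rewrite -addn1 iotaD map_cat foldl_cat /= upd_cellE IH add0n addn1 ltnS.
case: (A == B) => //=; rewrite [in RHS]leq_eqVlt.
by case: eqP => // ->; rewrite ltnn.
Qed.

(** * Capping, gradient and clearing routines *)

Section Macros.
Context {R : realType} {n : nat}.
Variables (f : {set 'I_n} -> R) (a : 'rV[R]_n).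
Implicit Types (s : state R).

Notation wp := (wp f).

Lemma vec_of_ext s s' A : rmem s' A = rmem s A -> vec_of n s' A = vec_of n s A.
Proof. by move=> h; apply/rowP => j; rewrite !mxE h. Qed.

Lemma cap_spec s : nmem s nv_n = n ->
  wp cap_cmd (fun s' => effect [:: nv_j] [:: ar_cap] 0 0 (5 * n + 2) s s' /\
    vec_of n s' ar_cap = cap (vec_of n s ar_x)) s.
Proof.
move=> sn.
apply: wp_mono (@wp_for _ _ _ [:: nv_j] [:: ar_cap] 3 (fun k s' => forall i, (i < k)%N ->
  rmem s' ar_cap i = Num.min 1 (rmem s ar_x i)) _ _ sn _ _ _ _ _ _) => //.
  move=> s' [e h]; split => //.
  by apply/rowP => j; rewrite !mxE h.
move=> k s1 kn [_ a1 _ _ _] s1j h.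
have x1 : rmem s1 ar_x = rmem s ar_x by apply: a1.
apply: wp_if => /=; rewrite s1j x1.
case: ifP => [x1k|/negbT]; last rewrite -ltNge => x1k; apply: wp_set_cell => /=;
  rewrite s1j ?x1; (split; [
    by apply: effect_tick; apply: effect_set_cell => //; do 2!apply: effect_tick; exact: effect_refl
   |by []
   |move=> i; rewrite ltnS leq_eqVlt upd_cellE /=;
    case: eqP => [-> _|_ /= /h //]]).
- by rewrite min_l.
- by rewrite min_r // ltW.
Qed.

(** [wp_for] requires the queue of open queries to be preserved, so this loop has its own invariant:
    after k iterations the queue holds the first k answers. A single [CRound] then delivers all n
    coordinates, at depth 1. *)
Lemma grad_spec s : nmem s nv_n = n -> pending s = [::] ->
  nonneg_vec (vec_of n s ar_x) ->
  wp grad_cmd (fun s' =>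
    effect [:: nv_j] [:: ar_cap; ar_grad] 1 n (10 * n + 10) s s' /\
    forall j : 'I_n, rmem s' ar_grad j = slope f (vec_of n s ar_x) j) s.
Proof.
move=> sn sp x0; apply: wp_seq; apply: wp_mono (cap_spec sn) => s1 [e1 c1].
have [n1 a1 p1 [r1 q1] w1] := e1.
have s1n : nmem s1 nv_n = n by rewrite n1.
pose val (i : nat) : R :=
  if insub i is Some j then slope f (vec_of n s ar_x) (j : 'I_n) else 0.
pose answers k : seq (nat * nat * R) := [seq (ar_grad, i, val i) | i <- iota 0 k].
apply: wp_seq; apply: wp_seq; apply: wp_set_nat.
apply: (@wp_while _ _ _ n (fun k s' => [/\
    forall v, v \notin [:: nv_j] -> nmem s' v = nmem s1 v, rmem s' = rmem s1,
    pending s' = answers k /\ nmem s' nv_j = k,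
    rounds s' = rounds s1 /\ queries s' = (queries s1 + k)%N &
    (k <= n)%N /\ (work s' <= work s1 + 3 * k + 1)%N])).
- split => //=.
  + by move=> v; rewrite inE /upd => /negPf ->.
  + by rewrite p1 sp.
  + by rewrite addn0.
  + by rewrite muln0 addn0 addn1.
- by move=> k s' [_ _ _ _ []].
- move=> k s2 [n2 m2 [p2 s2j] [r2 q2] [kn w2]] /=; rewrite s2j n2 // s1n -ltnNge => lt_kn.
  apply: wp_seq; eexists; split.
    apply: (@ExQueryGrad _ _ _ _ _ _ _ _ (Ordinal lt_kn)); first by rewrite /= s2j.
    by rewrite (@vec_of_ext s1) /= ?m2 // c1; exact: unit_cube_cap.
  apply: wp_set_nat => /=; rewrite s2j; split => //=.
  + by move=> v; rewrite inE /upd => hv; rewrite (negPf hv) n2 // inE.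
  + split; last by rewrite /upd eqxx addn1.
    rewrite p2 /answers -[k.+1]addn1 iotaD map_cat /= cats1 add0n /val insubT /=.
    congr (rcons _ (_, _, _)).
    rewrite mlgradE /slope -c1; congr pdiff.
    by apply: vec_of_ext; rewrite /= m2.
  + by rewrite r2 q2 addnS.
  + by split => //; lia.
- move=> k s2 [n2 m2 [p2 s2j] [r2 q2] [kn w2]] /=; rewrite s2j n2 // s1n negbK => nk.
  have kn' : k = n by apply/eqP; rewrite eqn_leq kn nk.
  rewrite {}kn' in p2 q2 w2; apply: wp_round; split => [|j] /=; last first.
    by rewrite p2 foldl_answers eqxx ltn_ord /val /= valK.
  split => /=.
  + by move=> v hv; rewrite n2 // n1.
  + move=> A; rewrite p2 foldl_answers !inE negb_or m2 => /andP[A3 A4].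
    apply/funext => i; rewrite (negPf A4) /= a1 //; by rewrite inE.
  + by rewrite sp.
  + by rewrite r2 q2 r1 q1 !addn0 addn1.
  + by lia.
Qed.

Lemma zero_spec s : nmem s nv_n = n ->
  wp zero_cmd (fun s' => effect [:: nv_j] [:: ar_x] 0 0 (4 * n + 2) s s' /\
    vec_of n s' ar_x = 0) s.
Proof.
move=> sn.
apply: wp_mono (@wp_for _ _ _ [:: nv_j] [:: ar_x] 2 (fun k s' => forall i, (i < k)%N ->
  rmem s' ar_x i = 0) _ _ sn _ _ _ _ _ _) => //.
  by move=> s' [e h]; split => //; apply/rowP => j; rewrite !mxE h.
move=> k s1 kn e s1j h; apply: wp_set_cell => /=; rewrite s1j; split => //.
  by apply: effect_tick; apply: effect_set_cell => //; apply: effect_tick; exact: effect_refl.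
by move=> i; rewrite ltnS leq_eqVlt /= upd_cellE /=; case: eqP => [_ _|_ /= /h].
Qed.

End Macros.

(** * Scanning for active items and spreading over them *)

Section Scan.
Context {R : realType} {n : nat}.
Variables (f : {set 'I_n} -> R) (a : 'rV[R]_n).
Implicit Types (s : state R).

Notation wp := (wp f).

Definition small_items (thr : R) : {set 'I_n} := [set j | a 0 j < thr].

Definition small_active (lam thr : R) (x : 'rV[R]_n) : {set 'I_n} :=
  active f a lam x :&: small_items thr.

Definition large_active (lam thr : R) (x : 'rV[R]_n) : {set 'I_n} :=
  active f a lam x :\: small_items thr.

Definition lam_of s : R := rmem s ar_lam 0%N.
Definition thr_of s : R := rmem s ar_thr 0%N.
Definition eta_of s : R := rmem s ar_eta 0%N.

Definition costs_loaded s := forall j : 'I_n, rmem s ar_cost j = a 0 j.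

Definition grad_loaded s :=
  forall j : 'I_n, rmem s ar_grad j = slope f (vec_of n s ar_x) j.

(** [s1] may differ from [s] in [ar_x] away from index [k], because the spread updates that array in
    place while it still has items to test. *)
Lemma is_activeE s s1 (k : 'I_n) : costs_loaded s -> grad_loaded s ->
  nmem s1 nv_j = k -> rmem s1 ar_x k = rmem s ar_x k ->
  (forall A, A \notin [:: ar_x] -> rmem s1 A = rmem s A) ->
  beval s1 is_active = (k \in active f a (lam_of s) (vec_of n s ar_x)).
Proof.
move=> hc hg s1j x1 h; rewrite /= s1j x1 !h // inE mxE -ltNge /lam_of.
by rewrite hc hg.
Qed.

Lemma is_largeE s s1 (k : 'I_n) : costs_loaded s -> nmem s1 nv_j = k ->
  (forall A, A \notin [:: ar_x] -> rmem s1 A = rmem s A) ->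
  beval s1 is_large = (k \notin small_items (thr_of s)).
Proof. by move=> hc s1j h; rewrite /= s1j !h // hc inE -leNgt. Qed.

Lemma card_below (S : {set 'I_n}) (k : 'I_n) :
  #|S :&: [set j : 'I_n | (j < k.+1)%N]| =
  (#|S :&: [set j : 'I_n | (j < k)%N]| + (k \in S))%N.
Proof.
case kS: (k \in S).
  have := cardsU1 k (S :&: [set j : 'I_n | (j < k)%N]).
  rewrite [k \in _ :&: _](_ : _ = false) => [h|]; last by rewrite !inE ltnn andbF.
  rewrite addnC -h.
  apply: eq_card => j; rewrite !inE ltnS leq_eqVlt.
  by have [->|jk] := eqVneq j k; rewrite ?eqxx ?kS //= (negPf (jk : j != k :> nat)).
rewrite addn0; apply: eq_card => j; rewrite !inE ltnS leq_eqVlt.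
by have [->|jk] := eqVneq j k; rewrite ?kS //= (negPf (jk : j != k :> nat)).
Qed.

(** [nv_big = n] is the sentinel for the absence of large active items. The loop keeps the last one
    it meets, but any member of [T] serves. *)
Lemma scan_spec s : nmem s nv_n = n -> costs_loaded s -> grad_loaded s ->
  let S := small_active (lam_of s) (thr_of s) (vec_of n s ar_x) in
  let T := large_active (lam_of s) (thr_of s) (vec_of n s ar_x) in
  wp scan_cmd (fun s' =>
    [/\ effect [:: nv_j; nv_count; nv_big] [::] 0 0 (6 * n + 4) s s',
      nmem s' nv_count = #|S| &
      (nmem s' nv_big = n /\ T = finset.set0) \/
      (exists2 j : 'I_n, j \in T & nmem s' nv_big = j)]) s.
Proof.
move=> sn hc hg S T.
apply: wp_seq; apply: wp_set_nat; apply: wp_seq; apply: wp_set_nat.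
set s0 := tick _.
have e0 : effect [:: nv_j; nv_count; nv_big] [::] 0 0 2 s s0.
  do 2!(apply: effect_tick; apply: effect_set_nat => //); exact: effect_refl.
have m0 : rmem s0 = rmem s by [].
apply: wp_mono (@wp_for _ _ _ [:: nv_j; nv_count; nv_big] [::] 4
  (fun k s' => nmem s' nv_count = #|S :&: [set j : 'I_n | (j < k)%N]| /\
    ((nmem s' nv_big = n /\ forall j : 'I_n, (j < k)%N -> j \notin T) \/
     (exists2 j : 'I_n, j \in T & nmem s' nv_big = j))) _ s0 _ _ _ _ _ _ _) => //.
- move=> s' [e [c b]]; split.
  + have := effect_trans e0 e; rewrite !addn0 => h.
    by apply: effect_weaken h _ _ _ => //; lia.
  + rewrite c (_ : [set j : 'I_n | (j < n)%N] = [set: 'I_n]) ?finset.setIT //.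
    by apply/setP => j; rewrite !inE ltn_ord.
  + case: b => [[b h]|]; [left|by right]; split => //.
    by apply/setP => j; rewrite !inE -[RHS]/false -(negPf (h j (ltn_ord j))) !inE.
- split.
    rewrite /s0 /= /upd /=; apply/esym/eqP; rewrite cards_eq0.
    by apply/eqP/setP => j; rewrite !inE andbF.
  by left; split => //; rewrite /s0 /= /upd /= sn.
move=> k s1 kn [_ a1 _ _ _] s1j [c b]; pose K := Ordinal kn.
have h1 A : A \notin [:: ar_x] -> rmem s1 A = rmem s A by move=> _; rewrite a1.
have x1 : rmem s1 ar_x K = rmem s ar_x K by rewrite a1.
have kS : (K \in S) = (K \in active f a (lam_of s) (vec_of n s ar_x)) &&
  (K \in small_items (thr_of s)) by rewrite inE.
have kT : (K \in T) = (K \notin small_items (thr_of s)) &&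
  (K \in active f a (lam_of s) (vec_of n s ar_x)) by rewrite inE.
have below (j : 'I_n) : (j < k.+1)%N -> K \notin T ->
    (forall j : 'I_n, (j < k)%N -> j \notin T) -> j \notin T.
  rewrite ltnS leq_eqVlt => /orP[/eqP jk KT _|jk _]; last exact.
  by have -> : j = K by exact: val_inj.
apply: wp_if.
rewrite (@is_activeE s (tick s1) K) //.
case: ifP => kA; rewrite kA ?andbT ?andbF /= in kS kT; last first.
  apply: wp_skip; split => //.
    by do 3!apply: effect_tick; exact: effect_refl.
  split; first by rewrite (card_below S K) kS addn0.
  case: b => [[b h]|]; [left|by right]; split => // j jk.
  by apply: below => //; rewrite kT.
apply: wp_if; rewrite (@is_largeE s (tick (tick s1)) K) //.
case: ifP => kL; rewrite kL in kT; first rewrite (negPf kL) in kS.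
  apply: wp_set_nat => /=; split => //.
    by apply: effect_tick; apply: effect_set_nat => //;
      do 3!apply: effect_tick; exact: effect_refl.
  split; first by rewrite /= /upd /= (card_below S K) kS addn0.
  by right; exists K => //; rewrite /upd /= s1j.
move/negbFE: kL => kL; rewrite kL in kS.
apply: wp_set_nat => /=; split => //.
  by apply: effect_tick; apply: effect_set_nat => //;
    do 3!apply: effect_tick; exact: effect_refl.
split; first by rewrite /= /upd /= (card_below S K) kS c.
case: b => [[b h]|]; [left|by right]; split => // j jk.
by apply: below => //; rewrite kT.
Qed.

Lemma spread_spec s : nmem s nv_n = n -> costs_loaded s -> grad_loaded s ->
  let S := small_active (lam_of s) (thr_of s) (vec_of n s ar_x) in
  nmem s nv_count = #|S| ->
  wp spread_cmd (fun s' =>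
    effect [:: nv_j] [:: ar_x] 0 0 (5 * n + 2) s s' /\
    vec_of n s' ar_x = spread a (eta_of s) S (vec_of n s ar_x)) s.
Proof.
move=> sn hc hg S sS; pose y := spread a (eta_of s) S (vec_of n s ar_x).
apply: wp_mono (@wp_for _ _ _ [:: nv_j] [:: ar_x] 3
  (fun k s' => forall i : 'I_n,
     rmem s' ar_x i = if (i < k)%N then y 0 i else rmem s ar_x i) _ s _ _ _ _ _ _ _) => //.
  by move=> s' [e h]; split => //; apply/rowP => j; rewrite mxE h ltn_ord.
move=> k s1 kn [n1 a1 _ _ _] s1j h; pose K := Ordinal kn.
have x1 : rmem s1 ar_x K = rmem s ar_x K by rewrite h ltnn.
apply: wp_if.
have -> : beval (tick s1) (BAnd is_active (BNot is_large)) = (K \in S).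
  rewrite inE -(@is_activeE s (tick s1) K) //.
  by rewrite -[K \in small_items _]negbK -(@is_largeE s (tick s1) K).
have next (i : 'I_n) : (i < k.+1)%N = (i == K) || (i < k)%N.
  by rewrite ltnS leq_eqVlt.
case: ifP => kS; last first.
  apply: wp_skip; split => //.
    by do 3!apply: effect_tick; exact: effect_refl.
  move=> i; rewrite h next; case: (eqVneq i K) => [->|//] /=.
  by rewrite ltnn !mxE kS addr0.
apply: wp_set_cell => /=; rewrite s1j; split => //.
  by apply: effect_tick; apply: effect_set_cell => //; do 2!apply: effect_tick; exact: effect_refl.
move=> i; rewrite upd_cellE /= next -[k]/(nat_of_ord K) -val_eqE.
case: eqP => [/val_inj->|_] /=; last exact: h.
by rewrite !mxE kS x1 !a1 // n1 // sS (hc K).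
Qed.

End Scan.

(** * Estimating the optimum *)

Section LnFacts.
Context {R : realType}.
Implicit Types x y : R.

Lemma ln_le_sub1 x : 0 < x -> ln x <= x - 1.
Proof.
move=> x0; have := expR_ge1Dx (ln x).
by rewrite lnK ?posrE // lerBrDl.
Qed.

Lemma ln2_ge : 2^-1 <= ln (2 : R).
Proof.
have := @ln_le_sub1 2^-1; rewrite lnV ?posrE // invr_gt0 ltr0n => /(_ isT).
by lra.
Qed.

Lemma ln_nat_ge0 m : 0 <= ln (m%:R : R).
Proof.
case: m => [|m]; first by rewrite ln0.
by rewrite ln_ge0 // ler1n.
Qed.

Lemma ln_nat_mono m k : (m <= k)%N -> ln (m%:R : R) <= ln k%:R.
Proof.
case: m => [|m] mk; first by rewrite ln0 // ln_nat_ge0.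
by rewrite ler_ln ?posrE ?ltr0n ?ler_nat //; lia.
Qed.

(* [ln z <= z - 1] at [z = B t / s]. *)
Lemma ratio_ge_ln (s t : nat) (B : R) : (0 < s)%N -> (0 < t)%N -> 0 < B ->
  B^-1 * (1 + ln B + ln t%:R - ln s%:R) <= t%:R / s%:R.
Proof.
move=> s0 t0 B0.
have sp : 0 < s%:R :> R by rewrite ltr0n.
have tp : 0 < t%:R :> R by rewrite ltr0n.
rewrite mulrC ler_pdivrMr //; have := @ln_le_sub1 (t%:R / s%:R * B).
rewrite lnM ?posrE ?divr_gt0 // ln_div ?posrE // !mulr_gt0 ?invr_gt0 // => /(_ isT).
by lra.
Qed.

(** A bound for the harmonic number. The jump by 1 between [s = 1] and [s = 0] pays for the step in
    which the last active item disappears and no gain is guaranteed. *)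
Definition count_pot (s : nat) : R := if s == 0 then 0 else 1 + ln s%:R.

Lemma count_pot_ge0 s : 0 <= count_pot s.
Proof. by rewrite /count_pot; case: eqP => // _; have := ln_nat_ge0 s; lra. Qed.

Lemma count_pot_mono s t : (t <= s)%N -> count_pot t <= count_pot s.
Proof.
case: t => [_|t ts]; first exact: count_pot_ge0.
rewrite /count_pot /= (_ : (s == 0) = false); last by lia.
by have := ln_nat_mono ts; lra.
Qed.

(** The relative loss [1 - t/s] of a step is paid by the drop of the potential; for [t > 0] this is
    [ratio_ge_ln] with [B = 1]. *)
Lemma count_pot_drop s t : (0 < s)%N -> (t <= s)%N ->
  count_pot t - count_pot s <= t%:R / s%:R - 1.
Proof.
move=> s0 ts; rewrite /count_pot (_ : (s == 0) = false); last by lia.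
case: t ts => [|t] ts /=.
  by have := ln_nat_ge0 s; rewrite mul0r; lra.
have := ratio_ge_ln s0 (ltn0Sn t) ltr01; rewrite ln1 invr1.
by lra.
Qed.

End LnFacts.

(** * Steps at one fixed threshold *)

Definition estimate_cmd : cmd :=
  CSeq zero_cmd (CSeq grad_cmd (CSeq scan_cmd (CSeq (CSetNat nv_t (NConst 0))
    (CWhile (BAnd (BNatLe (NConst 1) (NVar nv_count))
                  (BNatLe (NAdd (NVar nv_t) (NConst 1)) (NVar nv_steps)))
      (CSeq spread_cmd (CSeq grad_cmd (CSeq scan_cmd
        (CSetNat nv_t (NAdd (NVar nv_t) (NConst 1)))))))))).

Section Estimate.
Context {R : realType} {n : nat}.
Variables (f : {set 'I_n} -> R) (a : 'rV[R]_n).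
Hypothesis fnorm : normalized_setfun f.
Hypothesis mono : monotone_setfun f.
Hypothesis subm : submodular_setfun f.
Hypothesis cost : forall j, 0 < a 0 j <= 1.
Implicit Types (s : state R).

Notation wp := (wp f).

Lemma small_active_anti lam thr (x y : 'rV[R]_n) : nonneg_vec x -> (forall i, x 0 i <= y 0 i) ->
  small_active f a lam thr y \subset small_active f a lam thr x.
Proof. by move=> hx xy; apply: finset.setSI; apply: active_anti. Qed.

Lemma small_active_spread eta lam thr (x : 'rV[R]_n) :
  nonneg_vec x -> 0 <= eta ->
  let S := small_active f a lam thr x in
  S :&: active f a lam (spread a eta S x) =
  small_active f a lam thr (spread a eta S x).
Proof.
move=> hx eta0 S; apply/setP => j; rewrite !inE.
have /fintype.subsetP/(_ j) := active_anti a subm lam hx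
  (fun i => spread_ge cost S x i eta0).
rewrite !inE; case: (_ && _) => [->//|_]; last by rewrite andbF.
by rewrite andbT.
Qed.

(** A step that takes the count from s to t gains at least [lam eta t/s], which [ratio_ge_ln] bounds
    below by a constant plus a difference of logarithms; over the steps these telescope. The free
    parameter [B] trades a factor [1/B] in the gain for fewer steps. The extra round is the gradient
    at 0. *)
Lemma estimate_spec (B : R) s :
  nmem s nv_n = n -> pending s = [::] -> costs_loaded a s ->
  0 < B -> 0 <= lam_of s -> 0 <= eta_of s ->
  let lam := lam_of s in let thr := thr_of s in let eta := eta_of s in
  wp estimate_cmd (fun s' => exists t : nat, let x := vec_of n s' ar_x in
    [/\ effect [:: nv_j; nv_count; nv_big; nv_t] [:: ar_x; ar_cap; ar_grad]
          t.+1 (n * t.+1) (40 * (n.+1 * t.+1)) s s',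
        nonneg_vec x /\ dotv a x = t%:R * eta,
        nmem s' nv_count = #|small_active f a lam thr x|,
        (t <= nmem s nv_steps)%N /\
          (nmem s' nv_count = 0%N \/ t = nmem s nv_steps) &
        (0 < nmem s' nv_count)%N ->
        lam * eta * (B^-1 * (t%:R * (1 + ln B) - ln n%:R)) <= mlext f x]) s.
Proof.
move=> sn sp sc B0 lam0 eta0 lam thr eta.
apply: wp_seq; apply: wp_mono (zero_spec f sn) => s1 [e1 x1].
have [n1 a1 p1 _ _] := e1.
apply: wp_seq; apply: wp_mono (@grad_spec _ _ f s1 _ _ _);
  rewrite ?n1 ?p1 ?x1 //; last exact: nonneg0.
move=> s2 [e2 g2].
have [n2 a2 p2 _ _] := e2.
have x2 : vec_of n s2 ar_x = 0 by rewrite -x1; apply: vec_of_ext; exact: a2.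
apply: wp_seq; apply: wp_mono (@scan_spec _ _ f a s2 _ _ _);
  [|by rewrite n2 // n1|by move=> j; rewrite a2 // a1|by rewrite /grad_loaded x2].
rewrite /lam_of /thr_of !a2 // !a1 // -/(lam_of s) -/(thr_of s) -/lam -/thr x2.
move=> s3 [e3 c3 _].
have [n3 a3 p3 _ _] := e3.
apply: wp_seq; apply: wp_set_nat => /=.
have S2 : {subset [:: nv_j; nv_count; nv_big] <= [:: nv_j; nv_count; nv_big; nv_t]}.
  by move=> v; rewrite !inE => /or3P[] ->; rewrite ?orbT.
have S1 : {subset [:: nv_j] <= [:: nv_j; nv_count; nv_big; nv_t]}.
  by move=> v; rewrite !inE => ->.
have A0 : {subset [::] <= [:: ar_x; ar_cap; ar_grad]} by [].
have A1 : {subset [:: ar_x] <= [:: ar_x; ar_cap; ar_grad]}.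
  by move=> v; rewrite !inE => ->.
have A2 : {subset [:: ar_cap; ar_grad] <= [:: ar_x; ar_cap; ar_grad]}.
  by move=> v; rewrite !inE => ->; rewrite orbT.
have comp w s1' s2' s3' s4' :
    effect [:: nv_j] [:: ar_x] 0 0 w s1' s2' -> (w <= 5 * n + 2)%N ->
    effect [:: nv_j] [:: ar_cap; ar_grad] 1 n (10 * n + 10) s2' s3' ->
    effect [:: nv_j; nv_count; nv_big] [::] 0 0 (6 * n + 4) s3' s4' ->
    effect [:: nv_j; nv_count; nv_big; nv_t] [:: ar_x; ar_cap; ar_grad] 1 n
      (21 * n + 16) s1' s4'.
  move=> h1 hw h2 h3.
  have := effect_trans (effect_trans (effect_weaken h1 S1 A1 hw)
    (effect_weaken h2 S1 A2 (leqnn _))) (effect_weaken h3 S2 A0 (leqnn _)).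
  rewrite !addn0 !add0n => h; apply: effect_weaken h _ _ _ => //; lia.
have e30 := comp _ _ _ _ _ e1 (leq_add (leq_mul (isT : 4 <= 5)%N (leqnn n)) (leqnn 2)) e2 e3.
set s4 := tick _.
(* The invariant keeps the logarithm of the current count, so that the sum telescopes; it is
   discarded at the exit. *)
apply: (@wp_while _ _ _ (nmem s nv_steps) (fun t s' => let x := vec_of n s' ar_x in
   [/\ effect [:: nv_j; nv_count; nv_big; nv_t] [:: ar_x; ar_cap; ar_grad]
          t.+1 (n * t.+1) (39 * (n.+1 * t.+1)) s s' /\ nmem s' nv_t = t,
        nonneg_vec x /\ dotv a x = t%:R * eta,
        nmem s' nv_count = #|small_active f a lam thr x| /\ grad_loaded f s',
        (t <= nmem s nv_steps)%N &
        (0 < nmem s' nv_count)%N ->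
        lam * eta * (B^-1 * (t%:R * (1 + ln B) + ln (nmem s' nv_count)%:R - ln n%:R))
          <= mlext f x])).
- have x4 : vec_of n s4 ar_x = 0.
    by rewrite -x2; apply: vec_of_ext; rewrite /s4 /= a3.
  rewrite x4; split => //.
  + split => //; rewrite !muln1; apply: effect_assign e30 => //; lia.
  + by split; [exact: nonneg0|rewrite dotv0 mul0r].
  + split; first by rewrite /s4 /= /upd /= c3.
    by move=> j; rewrite x4 /s4 /= a3.
  + move=> c0; rewrite mlext0 // mul0r add0r.
    apply: mulr_ge0_le0; first exact: mulr_ge0.
    apply: mulr_ge0_le0; first by rewrite invr_ge0 ltW.
    rewrite subr_le0 ln_nat_mono // /s4 /= /upd /= c3.
    by rewrite -[leqRHS]card_ord max_card.
- by move=> k s' [].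
- move=> k s5 [[e5 t5] [x5 d5] [c5 g5] k5 b5] /=.
  have [n5 a5 p5 _ _] := e5.
  rewrite t5 addn1 (n5 nv_steps) // => /andP[c0 kN].
  set x := vec_of n s5 ar_x in x5 d5 c5 b5.
  have l5 : lam_of s5 = lam by rewrite /lam_of a5.
  have h5 : thr_of s5 = thr by rewrite /thr_of a5.
  have et5 : eta_of s5 = eta by rewrite /eta_of a5.
  apply: wp_seq; apply: wp_mono (@spread_spec _ _ f a (tick s5) _ _ _ _);
    [|by rewrite /= n5|by move=> j; rewrite /= a5|exact: g5|by rewrite [LHS]c5 -l5 -h5].
  rewrite [eta_of _]et5 [lam_of _]l5 [thr_of _]h5 [vec_of _ _ _](_ : _ = x) //.
  set S := small_active _ _ _ _ _; set y := spread _ _ _ _.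
  move=> s6 [e6 x6]; have [n6 a6 p6 _ _] := e6.
  have xy i : x 0 i <= y 0 i by exact: spread_ge.
  have y0 : nonneg_vec y by exact: nonneg_le x5 xy.
  apply: wp_seq; apply: wp_mono (@grad_spec _ _ f s6 _ _ _);
    rewrite ?(n6 nv_n) ?p6 ?x6 /= ?(n5 nv_n) ?p5 //.
  move=> s7 [e7 g7]; have [n7 a7 p7 _ _] := e7.
  have x7 : vec_of n s7 ar_x = y by rewrite -x6; apply: vec_of_ext; exact: a7.
  apply: wp_seq; apply: wp_mono (@scan_spec _ _ f a s7 _ _ _).
  + rewrite /lam_of /thr_of !a7 // !a6 //= [rmem s5 ar_lam _]l5 [rmem s5 ar_thr _]h5 x7.
    move=> s8 [e8 c8 _]; have [n8 a8 p8 _ _] := e8.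
    apply: wp_set_nat => /=.
    have x8 : vec_of n (tick (set_nat s8 nv_t (nmem s8 nv_t + 1))) ar_x = y.
      by rewrite -x7; apply: vec_of_ext; rewrite /= a8.
    have t8 : nmem s8 nv_t = k by rewrite n8 // n7 // n6.
    rewrite x8 {x8} t8 /= addn1; split => //.
    * split; last by rewrite /upd eqxx.
      have := effect_trans (effect_tick e5) (comp _ _ _ _ _ e6 (leqnn _) e7 e8).
      rewrite addn1 -mulnSr => h; apply: effect_assign h => //; lia.
    * split => //; rewrite dotv_spread // -?c5 //.
      by rewrite d5 -addn1 natrD mulrDl mul1r.
    * split; first by rewrite /upd /=.
      move=> j; rewrite (@vec_of_ext _ _ s7) ?x7; last by rewrite /= a8.
      by rewrite /= a8 // g7 x6.
    * rewrite /upd /= => c80.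
      have s0 : (0 < #|S|)%N by rewrite -c5.
      have := spread_gain mono subm cost lam x5 eta0 s0.
      rewrite -/y small_active_spread // -/S -/y -c8 -c5 -/eta => gain.
      have := ratio_ge_ln c0 c80 B0.
      have le0 : 0 <= lam * eta by exact: mulr_ge0.
      move/(ler_wpM2l le0) => ratio; have := b5 c0.
      rewrite -natr1.
      by lra.
  + by rewrite n7 // n6 //= n5.
  + by move=> j; rewrite a7 // a6 //= a5.
  + by move=> j; rewrite x7 g7 ?x6.
- move=> k s5 [[e5 t5] x5 [c5 g5] k5 b5] /=.
  have [n5 a5 p5 _ _] := e5.
  rewrite t5 addn1 (n5 nv_steps) // => nb; exists k; split => //.
  + apply: effect_weaken (effect_tick e5) _ _ _ => //; lia.
  + split => //; move: nb; rewrite negb_and -!leqNgt leqn0 => /orP[/eqP|]; first by left.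
    by move=> h; right; apply/eqP; rewrite eqn_leq k5.
  + move=> c0; apply: le_trans (b5 c0); apply: ler_wpM2l; first exact: mulr_ge0.
    apply: ler_wpM2l; first by rewrite invr_ge0 ltW.
    by have := @ln_nat_ge0 R (nmem s5 nv_count); lra.
Qed.

End Estimate.

(** * Bisection of the exponent *)

Definition query_cmd : cmd := CSeq (CQueryF ar_x ar_val (NConst 0)) CRound.

(** Integer expressions have no division, so the quotient of [hi - lo] by 3 is found by repeated
    subtraction; its cost is affordable since [L <= n]. *)
Definition third_cmd : cmd :=
  CSeq (CSetNat nv_pow (NSub (NVar nv_hi) (NVar nv_lo)))
    (CSeq (CSetNat nv_q (NConst 0))
      (CWhile (BNatLe (NConst 3) (NVar nv_pow))
        (CSeq (CSetNat nv_q (NAdd (NVar nv_q) (NConst 1)))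
          (CSetNat nv_pow (NSub (NVar nv_pow) (NConst 3)))))).

(** Quotient of [L] by [q], rounded up, so that [N] steps with [B = 2^q] satisfy
    [N ln B >= ln n]. *)
Definition steps_cmd : cmd :=
  CSeq (CSetNat nv_steps (NConst 0))
    (CSeq (CSetNat nv_t (NConst 0))
      (CWhile (BNatLe (NAdd (NVar nv_t) (NConst 1)) (NVar nv_log))
        (CSeq (CSetNat nv_t (NAdd (NVar nv_t) (NVar nv_q)))
          (CSetNat nv_steps (NAdd (NVar nv_steps) (NConst 1)))))).

(** The test sits at two thirds of the interval because a success certifies only [lam / 2^q]:
    success raises [lo] by [q], failure lowers [hi] by at least [q]. *)
Definition third_point : nexp :=
  NAdd (NVar nv_lo) (NAdd (NVar nv_q) (NVar nv_q)).

Definition bisect_body : cmd :=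
  CSeq third_cmd (CSeq steps_cmd
    (CSeq (CSetCell ar_lam (NConst 0) (RCell ar_pow third_point))
    (CSeq (CSetCell ar_eta (NConst 0) (RDiv (rconst 1) (RNat (NVar nv_steps))))
    (CSeq estimate_cmd
      (CIf (BNatLe (NConst 1) (NVar nv_count))
        (CSetNat nv_lo (NAdd (NVar nv_lo) (NVar nv_q)))
        (CSeq query_cmd (CSetNat nv_hi third_point))))))).

Definition bisect_cmd : cmd :=
  CWhile (BNatLe (NConst 3) (NSub (NVar nv_hi) (NVar nv_lo))) bisect_body.

Section Bisect.
Context {R : realType} {n : nat}.
Variables (f : {set 'I_n} -> R) (a : 'rV[R]_n).
Hypothesis fnorm : normalized_setfun f.
Hypothesis mono : monotone_setfun f.
Hypothesis subm : submodular_setfun f.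
Hypothesis cost : forall j, 0 < a 0 j <= 1.
Implicit Types (s : state R).

Notation wp := (wp f).
Notation opt := (knapsack_opt f a).

Lemma query_spec s : pending s = [::] -> nonneg_vec (vec_of n s ar_x) ->
  wp query_cmd (fun s' => effect [::] [:: ar_val] 1 1 2 s s' /\
    rmem s' ar_val 0%N = mlext f (vec_of n s ar_x)) s.
Proof.
move=> sp x0; apply: wp_seq; eexists; split; first by constructor.
apply: wp_round; split; last by rewrite /= sp /= upd_cellE.
split => //=.
- move=> A; rewrite inE => A9; apply/funext => i.
  by rewrite sp /= upd_cellE (negPf A9).
- by rewrite !addn1.
- by rewrite addn2.
Qed.

Lemma third_spec s : wp third_cmd (fun s' => exists q,
    [/\ effect [:: nv_q; nv_pow] [::] 0 0 (3 * q + 3) s s', nmem s' nv_q = q &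
      (3 * q <= nmem s nv_hi - nmem s nv_lo < 3 * q + 3)%N]) s.
Proof.
set r := (nmem s nv_hi - nmem s nv_lo)%N.
apply: wp_seq; apply: wp_set_nat; apply: wp_seq; apply: wp_set_nat.
apply: (@wp_while _ _ _ r (fun k s' =>
  [/\ effect [:: nv_q; nv_pow] [::] 0 0 (3 * k + 2) s s', nmem s' nv_q = k &
      (nmem s' nv_pow + 3 * k)%N = r])).
- split => //; last by rewrite /= /upd /= muln0 addn0.
  by rewrite muln0; do 2!apply: effect_assign (ltnSn _) _ => //; exact: effect_refl.
- by move=> k s' [_ _]; lia.
- move=> k s1 [e1 q1 h1] /= p3.
  apply: wp_seq; apply: wp_set_nat; apply: wp_set_nat; split.
  + rewrite (_ : (3 * k.+1 + 2 = (3 * k + 2).+3)%N); last by lia.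
    by do 2!apply: effect_assign (ltnSn _) _ => //; exact: effect_tick.
  + by rewrite /= /upd /= q1 addn1.
  + by rewrite /= /upd /=; lia.
- move=> k s1 [e1 q1 h1] /= p3; exists k; split => //; last by lia.
  by rewrite addnS; exact: effect_tick.
Qed.

Lemma steps_spec s : (0 < nmem s nv_q)%N -> wp steps_cmd (fun s' => exists N,
    [/\ effect [:: nv_t; nv_steps] [::] 0 0 (3 * N + 3) s s',
      nmem s' nv_steps = N, (nmem s nv_log <= N * nmem s nv_q)%N &
      (N * nmem s nv_q < nmem s nv_log + nmem s nv_q)%N]) s.
Proof.
set q := nmem s nv_q; set L := nmem s nv_log => q0.
apply: wp_seq; apply: wp_set_nat; apply: wp_seq; apply: wp_set_nat.
apply: (@wp_while _ _ _ L (fun k s' =>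
  [/\ effect [:: nv_t; nv_steps] [::] 0 0 (3 * k + 2) s s', nmem s' nv_steps = k,
      nmem s' nv_t = (k * q)%N & (k * q < L + q)%N])).
- split => //; last by rewrite mul0n; lia.
  by rewrite muln0; do 2!apply: effect_assign (ltnSn _) _ => //; exact: effect_refl.
- by move=> k s' [_ _ _]; nia.
- move=> k s1 [e1 N1 t1 h1] /=; have [n1 _ _ _ _] := e1.
  rewrite t1 n1 // -/L => kL.
  apply: wp_seq; apply: wp_set_nat; apply: wp_set_nat; split.
  + rewrite (_ : (3 * k.+1 + 2 = (3 * k + 2).+3)%N); last by lia.
    by do 2!apply: effect_assign (ltnSn _) _ => //; exact: effect_tick.
  + by rewrite /= /upd /= N1 addn1.
  + by rewrite /= /upd /= t1 n1 // -/q; lia.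
  + by lia.
- move=> k s1 [e1 N1 t1 h1] /=; have [n1 _ _ _ _] := e1.
  rewrite t1 n1 // -/L => kL; exists k; split => //; last by lia.
  by rewrite addnS; exact: effect_tick.
Qed.

Lemma ln_le_log (L : nat) : (n <= 2 ^ L)%N -> ln n%:R <= L%:R * ln (2 : R).
Proof.
move=> h; apply: le_trans (ln_nat_mono h) _.
by rewrite natrX lnXn // mulr_natl.
Qed.

(** A test at width [D] costs of order [L/D] rounds and leaves width at most [4D/5], so the
    invariant bounds the product of rounds and width. The old rounds contribute at most 96 L to the
    new product, the [N] steps 8 L and the two extra rounds 2 L. *)
Lemma round_budget (r D D' u N L m : nat) :
  (r * D <= 120 * L)%N -> (3 * u <= D < 3 * u + 3)%N -> (0 < u)%N ->
  (D' <= D - u)%N -> (N * u < L + u)%N -> (D <= L)%N -> (m <= N + 2)%N ->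
  ((r + m) * D' <= 120 * L)%N.
Proof.
move=> rD /andP[u1 u2] u0 D1 Nu uL mN.
have hD : (5 * D' <= 4 * D)%N by lia.
have h1 : (5 * (r * D') <= 480 * L)%N by nia.
have h2 : (N * D' <= 8 * L)%N by nia.
have h3 : (2 * D' <= 2 * L)%N by lia.
have h4 : (m * D' <= (N + 2) * D')%N by rewrite leq_mul2r mN orbT.
by rewrite mulnDl; rewrite mulnDl in h4; lia.
Qed.

Lemma quotient_le (u N L : nat) : (0 < u)%N -> (N * u < L + u)%N -> (N <= L)%N.
Proof. by nia. Qed.

Lemma quotient_gt0 (u N L : nat) : (0 < L)%N -> (L <= N * u)%N -> (0 < N)%N.
Proof. by case: N => // L0; rewrite mul0n; lia. Qed.

Lemma raise_lo (lo hi u k L : nat) : (3 * u <= hi - lo)%N -> (0 < u)%N ->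
  (hi - lo + k <= L)%N -> (hi <= L)%N ->
  [/\ (hi - (lo + u) + k.+1 <= L)%N, (lo + u < hi)%N & (hi <= L)%N].
Proof. by move=> *; split; lia. Qed.

Lemma lower_hi (lo hi u k L : nat) : (3 * u <= hi - lo)%N -> (0 < u)%N ->
  (hi - lo + k <= L)%N -> (hi <= L)%N ->
  [/\ (lo + (u + u) - lo + k.+1 <= L)%N, (lo < lo + (u + u))%N &
      (lo + (u + u) <= L)%N].
Proof. by move=> *; split; lia. Qed.

Lemma lower_hi_width (lo hi u : nat) :
  (3 * u <= hi - lo)%N -> (lo + (u + u) - lo <= hi - lo - u)%N.
Proof. by lia. Qed.

Lemma work_budget (w u N L r t m w' : nat) :
  (w <= 80 * (n.+1 * r))%N -> (3 * u <= L)%N -> (N <= L)%N -> (L <= n)%N ->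
  (t.+1 <= m)%N -> (w' <= 2 * n)%N ->
  ((w + 3 * u + 3 * N + 8).+2 + 40 * (n.+1 * t.+1) + w' <= 80 * (n.+1 * (r + m)))%N.
Proof.
move=> hw uL NL Ln tm hw'.
have h1 : (n.+1 * t.+1 <= n.+1 * m)%N by rewrite leq_mul2l tm orbT.
have h2 : (n.+1 <= n.+1 * t.+1)%N by rewrite leq_pmulr.
rewrite mulnDr.
move: (n.+1 * r)%N (n.+1 * t.+1)%N (n.+1 * m)%N hw h1 h2 => x y z.
by lia.
Qed.

(** [thr = 2] exceeds every cost, so no item is large during the tests. The stored value comes from
    the last failed test and is at most [opt]; at the end [2^hi <= 4 * 2^lo], whence the factor
    5. *)
Lemma bisect_spec s (M : R) : let L := nmem s nv_log in
  nmem s nv_n = n -> pending s = [::] -> costs_loaded a s -> thr_of s = 2 ->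
  (0 < L <= n)%N -> (n <= 2 ^ L)%N -> nmem s nv_lo = 0%N -> nmem s nv_hi = L ->
  (forall i, (i <= L)%N -> rmem s ar_pow i = M * 2 ^+ i) ->
  rmem s ar_val 0%N = 0 -> 0 < M -> M <= opt -> opt <= M * 2 ^+ L ->
  wp bisect_cmd (fun s' => exists r q w,
    [/\ effect [:: nv_j; nv_count; nv_big; nv_lo; nv_hi; nv_q; nv_steps; nv_t; nv_pow]
          [:: ar_x; ar_cap; ar_grad; ar_lam; ar_eta; ar_val] r q w s s',
        (r <= 120 * L)%N /\ (q <= n * r)%N, (w <= 90 * (n.+1 * r.+1))%N,
        (nmem s' nv_hi <= L)%N &
        let V := rmem s' ar_val 0%N + M * 2 ^+ nmem s' nv_hi in opt <= V <= 5 * opt]) s.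
Proof.
move=> L sn sp sc sthr /andP[L0 Ln] nL slo shi sP sW M0 Mopt optM.
set Ns := [:: nv_j; _; _; _; _; _; _; _; _]; set As := [:: ar_x; _; _; _; _; _].
apply: (@wp_while _ _ _ L (fun k s' => exists r q w,
  [/\ effect Ns As r q w s s',
      [/\ (r * (nmem s' nv_hi - nmem s' nv_lo) <= 120 * L)%N, (q <= n * r)%N &
          (w <= 80 * (n.+1 * r))%N],
      [/\ (nmem s' nv_hi - nmem s' nv_lo + k <= L)%N,
          (nmem s' nv_lo < nmem s' nv_hi)%N & (nmem s' nv_hi <= L)%N],
      M * 2 ^+ nmem s' nv_lo <= opt &
      0 <= rmem s' ar_val 0%N <= opt /\
      opt <= rmem s' ar_val 0%N + M * 2 ^+ nmem s' nv_hi])).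
- exists 0%N, 0%N, 0%N; rewrite slo shi sW; split => //; first exact: effect_refl.
  + by split; lia.
  + by rewrite expr0 mulr1.
  + by rewrite lexx add0r; split => //; exact: le_trans (ltW M0) Mopt.
- by move=> k s' [r [q [w [_ _ []]]]]; lia.
- move=> k s0 [r [q [w [e0 [rb qb wb] [kb lohi hiL] Mlo [W01 optW]]]]] /= guard.
  have [n0 a0 p0 _ _] := e0.
  set lo := nmem s0 nv_lo in rb kb lohi Mlo guard; set hi := nmem s0 nv_hi in rb kb lohi hiL optW guard.
  apply: wp_seq; apply: wp_mono (third_spec _) => s1 [u [e1 u1]] /= /andP[].
  rewrite -/lo -/hi => u3 u3'; have [n1 a1 p1 _ _] := e1.
  have u0 : (0 < u)%N by lia.
  apply: wp_seq; apply: wp_mono (@steps_spec s1 _); last by rewrite u1.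
  move=> s2 [N [e2 N2]]; have [n2 a2 p2 _ _] := e2.
  rewrite u1 n1 //= n0 // -/L => LN Nu.
  have N0 := quotient_gt0 L0 LN.
  apply: wp_seq; apply: wp_set_cell; apply: wp_seq; apply: wp_set_cell.
  set s3 := tick _.
  have e3 : effect Ns As r q (w + 3 * u + 3 * N + 8).+2 s s3.
    have S1 : {subset [:: nv_q; nv_pow] <= Ns} by move=> v; rewrite !inE => /orP[] /eqP ->.
    have S2 : {subset [:: nv_t; nv_steps] <= Ns} by move=> v; rewrite !inE => /orP[] /eqP ->.
    have S3 : {subset [::] <= As} by [].
    have h1 := effect_trans (effect_tick e0) (effect_weaken e1 S1 S3 (leqnn _)).
    have h2 := effect_trans h1 (effect_weaken e2 S2 S3 (leqnn _)).
    rewrite !addn0 in h2.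
    by do 2!apply: effect_store (ltnSn _) _ => //; apply: effect_weaken h2 _ _ _ => //; lia.
  have [n3 a3 p3 _ _] := e3.
  have s3n : nmem s3 nv_n = n by rewrite /s3 /= n2 // n1 //= n0.
  have lo3 : nmem s3 nv_lo = lo by rewrite /s3 /= n2 // n1.
  have hi3 : nmem s3 nv_hi = hi by rewrite /s3 /= n2 // n1.
  have u33 : nmem s3 nv_q = u by rewrite /s3 /= n2.
  have N3 : nmem s3 nv_steps = N by rewrite /s3 /=.
  have W3 : rmem s3 ar_val = rmem s0 ar_val.
    by apply/funext => i; rewrite /s3 /= !upd_cellE /= a2 // a1.
  have lam3 : lam_of s3 = M * 2 ^+ (lo + (u + u)).
    rewrite /lam_of /s3 /= !upd_cellE /= a2 // a1 //= a0 // sP.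
      by rewrite n2 // n1 //= -/lo n2 // u1.
    by rewrite n2 // n1 //= -/lo n2 // u1; lia.
  have eta3 : eta_of s3 = 1 / N%:R by rewrite /eta_of /s3 /= upd_cellE /= N2.
  have thr3 : thr_of s3 = 2 by rewrite /thr_of a3.
  have NR : 0 < N%:R :> R by rewrite ltr0n.
  have pow_gt0 m : 0 < 2 ^+ m :> R by rewrite exprn_gt0.
  have lam0 : 0 <= lam_of s3 by rewrite lam3 mulr_ge0 // ltW.
  have eta0 : 0 <= eta_of s3 by rewrite eta3 divr_ge0 // ltW.
  apply: wp_seq; apply: wp_mono
    (@estimate_spec _ _ f a fnorm mono subm cost (2 ^+ u) s3 s3n _ _ _ lam0 eta0) => //;
    [|by rewrite p3|by move=> j; rewrite a3].
  move=> s4 [t]; set x := vec_of n s4 ar_x; rewrite N3 lam3 eta3 thr3 => -[].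
  move=> e4 [x0 dx] c4 [tN stop] low; have [n4 a4 p4 _ _] := e4.
  have S4 : {subset [:: nv_j; nv_count; nv_big; nv_t] <= Ns}.
    by move=> v; rewrite !inE => /or4P[] /eqP ->.
  have A4 : {subset [:: ar_x; ar_cap; ar_grad] <= As}.
    by move=> v; rewrite !inE => /or3P[] /eqP ->.
  have e5 := effect_trans e3 (effect_weaken e4 S4 A4 (leqnn _)).
  have Fopt : mlext f x <= opt.
    apply: mlext_le_opt => //; rewrite dx mul1r ler_pdivrMr // mul1r ler_nat.
    exact: tN.
  have F0 : 0 <= mlext f x by exact: mlext_ge0.
  have lo4 : nmem s4 nv_lo = lo by rewrite n4.
  have hi4 : nmem s4 nv_hi = hi by rewrite n4.
  have u44 : nmem s4 nv_q = u by rewrite n4.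
  have W4 : rmem s4 ar_val = rmem s0 ar_val by rewrite a4.
  have NL := quotient_le u0 Nu.
  have DL : (hi - lo <= L)%N by exact: leq_trans (leq_addr _ _) kb.
  have uL : (3 * u <= L)%N by apply: leq_trans u3 (leq_trans (leq_addr _ _) kb).
  have n_ge3 : (3 <= n)%N.
    by apply: leq_trans Ln; apply: leq_trans uL; rewrite leq_pmulr.
  have work_ok m w' := @work_budget w u N L r t m w' wb uL NL Ln.
  apply: wp_if => /=; case: ifP => [cpos|/negbT]; last first.
    rewrite -eqn0Ngt => /eqP c0.
    have act0 : active f a (M * 2 ^+ (lo + (u + u))) x = finset.set0.
      move: c4; rewrite c0 => /esym/eqP; rewrite cards_eq0 => /eqP h.
      apply/setP => j; move/setP/(_ j): h; rewrite !inE.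
      have /andP[_ aj] := cost j; rewrite (_ : a 0 j < 2) ?andbT //.
      by apply: le_lt_trans aj _; rewrite ltr1n.
    have lamM : 0 <= M * 2 ^+ (lo + (u + u)) by rewrite -lam3.
    have upper := active0_opt_le mono subm cost x0 lamM act0.
    apply: wp_seq; apply: wp_mono (@query_spec (tick s4) _ _) => //=;
      last by rewrite p4 p3 sp.
    move=> s6 [e6 W6]; have [n6 a6 p6 _ _] := e6.
    have SV : {subset [:: ar_val] <= As} by move=> v; rewrite !inE => /eqP ->.
    have S0 : {subset [::] <= Ns} by [].
    have e7 := effect_trans (effect_tick e5) (effect_weaken e6 S0 SV (leqnn _)).
    apply: wp_set_nat.
    have val v : nmem (tick (set_nat s6 nv_hi v)) nv_lo = lo /\
                 nmem (tick (set_nat s6 nv_hi v)) nv_hi = v.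
      by split; rewrite /= /upd // n6.
    have [vlo vhi] := val (neval (nmem s6) third_point).
    have third : neval (nmem s6) third_point = (lo + (u + u))%N.
      by rewrite /= !n6 //= lo4 u44.
    rewrite vlo vhi third; eexists; eexists; eexists; split.
    + by apply: effect_assign (ltnSn _) e7.
    + split.
      * rewrite -addnA; apply: round_budget rb _ u0 (lower_hi_width u3) Nu DL _.
          by apply/andP.
        by rewrite addn1 addn2 !ltnS.
      * rewrite mulnDr muln1 mulnDr; apply: leq_add; last exact: leq_trans L0 Ln.
        exact: leq_add.
      * rewrite -(addnA r); apply: leq_trans (work_ok (t.+1 + 1)%N 4%N _ _).
        - by rewrite addn4 addn2.
        - by rewrite addn1.
        - by move: n_ge3; clear; lia.
    + exact: lower_hi u3 u0 kb hiL.
    + exact: Mlo.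
    + by rewrite /= W6; split => //; rewrite F0.
  have tN' : t = N by case: stop => // c0; rewrite c0 in cpos.
  apply: wp_set_nat; rewrite /= /upd /= lo4 u44 hi4; eexists; eexists; eexists; split.
  + apply: effect_assign (ltnSn _) (effect_tick e5) => //.
  + split.
    * apply: round_budget rb _ u0 _ Nu DL _; [by apply/andP|by rewrite subnDA|].
      by rewrite addn2 ltnS leqW.
    * by rewrite mulnDr; exact: leq_add.
    * apply: leq_trans (work_ok t.+1 2%N _ _) => //; first by rewrite addn2.
      by move: n_ge3; clear; lia.
  + exact: raise_lo u3 u0 kb hiL.
  (* Here [eta = 1/N] and [N ln B >= ln n], so the estimate is at least [lam / B], the threshold at
     exponent [lo + u]. *)
  + apply: le_trans Fopt; apply: le_trans (low cpos).
    rewrite !exprD tN'; set B : R := 2 ^+ u.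
    have B0 : 0 < B by exact: pow_gt0.
    have lnB : ln B = u%:R * ln 2 by rewrite /B lnXn // mulr_natl.
    have lnN : ln n%:R <= N%:R * ln B.
      apply: le_trans (ln_le_log nL) _; rewrite lnB mulrA -natrM.
      by apply: ler_wpM2r; [exact: le_trans (ltW _) (@ln2_ge R)|rewrite ler_nat].
    have -> : M * (2 ^+ lo * B) = M * (2 ^+ lo * (B * B)) * (1 / N%:R) * (B^-1 * N%:R).
      by field; rewrite (lt0r_neq0 B0) (lt0r_neq0 NR).
    apply: ler_wpM2l; first apply: mulr_ge0.
    - by rewrite ltW // !mulr_gt0.
    - by rewrite divr_ge0 // ltW.
    apply: ler_wpM2l; first by rewrite invr_ge0 ltW.
    by rewrite mulrDr mulr1; lra.
  + by rewrite W4.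
- move=> k s1 [r [q [w [e0 [rb qb wb] [kb lohi hiL] Mlo [W01 optW]]]]] /= guard.
  exists r, q, w.+1; split => //; first exact: effect_tick.
  (* The width is still positive at the exit, so the product bound yields [r <= 120 L]. *)
  + by split => //; nia.
  + by nia.
  + rewrite optW /=; have /andP[W0 W1] := W01.
    suff : M * 2 ^+ nmem s1 nv_hi <= 4 * (M * 2 ^+ nmem s1 nv_lo) by move: Mlo W1; lra.
    rewrite mulrCA ler_pM2l // (_ : 4 = 2 ^+ 2); last by rewrite -natrX.
    by rewrite -exprD ler_weXn2l ?ler1n //; lia.
Qed.

End Bisect.

(** * The greedy phase *)

Section MainInvariant.
Context {R : realType} {n : nat}.
Variables (f : {set 'I_n} -> R) (a : 'rV[R]_n).
Hypothesis fnorm : normalized_setfun f.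
Hypothesis mono : monotone_setfun f.
Hypothesis subm : submodular_setfun f.
Hypothesis cost : forall j, 0 < a 0 j <= 1.
Variables (eps eta top : R).
Notation opt := (knapsack_opt f a).
Hypothesis eps_gt0 : 0 < eps.
Hypothesis eps_lt : 16 * eps <= 1.
Hypothesis eta_gt0 : 0 < eta.
Hypothesis eta_pot : eta * count_pot n <= 2 * eps ^+ 2.
Hypothesis top_bounds : opt <= top <= 5 * opt.
Hypothesis opt_gt0 : 0 < opt.
Implicit Types (x : 'rV[R]_n) (b lam : R).

Let kappa : R := 1 - eps.

(* Bounds the losses still to come: at the current threshold, where [s] items
   are active, and, by a geometric series, at all lower thresholds. *)
Definition loss_pot lam (s : nat) : R :=
  eta * lam * count_pot s + eta * count_pot n * lam * (kappa / eps).

(** Equal to [loss_pot top n], since [1 + kappa / eps = 1 / eps]: the whole allowance at the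
    start. *)
Definition loss_cap : R := eta * count_pot n * top / eps.

(** The bound on [kappa * (opt - mlext f x)] says that budget invested at density [lam] closes the
    gap at relative rate at least [kappa]. The last bound is the resulting exponential decay, with
    the losses still to come on the left and the whole allowance on the right. *)
Definition greedy_inv x b lam : Prop :=
  [/\ nonneg_vec x /\ dotv a x = b, b <= 1, 0 < lam <= top,
      forall j, j \notin small_items a eta -> x 0 j = 0 \/ x 0 j = 1 &
      kappa * (opt - mlext f x) <= lam /\
      opt - mlext f x + loss_pot lam #|small_active f a lam eta x|
        <= opt * expR (- (kappa * b)) + loss_cap].

Lemma kappa_ge0 : 0 <= kappa.
Proof. by have e16 := eps_lt; rewrite /kappa; lra. Qed.

Lemma loss_pot_le lam (s : nat) : 0 <= lam <= top -> (s <= n)%N ->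
  loss_pot lam s <= loss_cap.
Proof.
move=> /andP[l0 lt] sn; rewrite /loss_pot /loss_cap /kappa.
have hs := @count_pot_mono R n s sn; have hn := @count_pot_ge0 R n.
have e0 := ltW eta_gt0.
apply: (@le_trans _ _ (eta * count_pot n * lam * (1 + (1 - eps) / eps))).
  by have := ler_wpM2l (mulr_ge0 e0 l0) hs; rewrite mulrDr mulr1 lerD2r; lra.
have -> : 1 + (1 - eps) / eps = eps^-1 by field; rewrite lt0r_neq0.
apply: ler_wpM2r; first by rewrite invr_ge0 ltW.
by apply: ler_wpM2l => //; exact: mulr_ge0.
Qed.

Lemma loss_pot_ge0 lam (s : nat) : 0 <= lam -> 0 <= loss_pot lam s.
Proof.
have e16 := eps_lt; have ep0 := eps_gt0; have o0 := opt_gt0.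
move=> l0; have h m := @count_pot_ge0 R m; have e0 := ltW eta_gt0.
have k0 : 0 <= kappa / eps.
  by apply: divr_ge0; [rewrite /kappa; lra|exact: ltW].
by apply: addr_ge0; apply: mulr_ge0 => //; rewrite !mulr_ge0.
Qed.

Lemma loss_cap_le : loss_cap <= 10 * eps * opt.
Proof.
have e16 := eps_lt; have ep0 := eps_gt0; have o0 := opt_gt0.
have /andP[_ t5] := top_bounds; have /andP[t0 _] := top_bounds.
rewrite /loss_cap ler_pdivrMr //.
apply: (@le_trans _ _ (2 * eps ^+ 2 * top)).
  by rewrite ler_wpM2r // (le_trans (ltW opt_gt0)).
have := ler_wpM2l (ltW (mulr_gt0 eps_gt0 eps_gt0)) t5.
by rewrite expr2; lra.
Qed.

(** This and [large_arith] isolate the linear core of a step, with exponentials and potentials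
    replaced by free variables. *)
Lemma spread_arith (o F F' lam e q h h' P C E : R) :
  lam * e * q <= F' - F -> e * lam * (h' - h) <= e * lam * (q - 1) ->
  o - F - lam * e <= E + (C - (e * lam * h + P)) ->
  o - F' + (e * lam * h' + P) <= E + C.
Proof. by move=> h1 h2 h3; lra. Qed.

Lemma large_arith (o F F' sl la E C p p' : R) :
  F' = F + sl -> la <= sl -> p' <= p -> o - F - la <= E + (C - p) ->
  o - F' + p' <= E + C.
Proof. by move=> -> h1 h2 h3; lra. Qed.

Lemma loss_pot_mono lam (s t : nat) : 0 <= lam -> (s <= t)%N ->
  loss_pot lam s <= loss_pot lam t.
Proof.
move=> l0 st; rewrite /loss_pot lerD2r ler_wpM2l ?count_pot_mono //.
by rewrite mulr_ge0 // ltW.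
Qed.

(** The gap is multiplied by at most [1 - kappa delta <= e^(-kappa delta)]. The bound on [delta]
    keeps this factor nonnegative, and the allowance [Q] is carried over unshrunk. *)
Lemma decay (D Q b delta lam : R) : 0 <= delta <= 1 -> 0 <= Q ->
  kappa * D <= lam -> D <= opt * expR (- (kappa * b)) + Q ->
  D - lam * delta <= opt * expR (- (kappa * (b + delta))) + Q.
Proof.
have e16 := eps_lt; have ep0 := eps_gt0; have o0 := opt_gt0.
move=> /andP[d0 d1] Q0 hD le_D; have kp : 0 <= kappa <= 1 by rewrite /kappa; lra.
have /andP[k0 k1] := kp.
have kd0 : 0 <= kappa * delta by rewrite mulr_ge0.
have kd1 : kappa * delta <= 1 by rewrite mulr_ile1.
have h1 := ler_wpM2r d0 hD.
apply: (@le_trans _ _ ((1 - kappa * delta) * D)); first by lra.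
apply: (@le_trans _ _ ((1 - kappa * delta) * (opt * expR (- (kappa * b)) + Q))).
  by rewrite ler_wpM2l // subr_ge0.
have kdQ : (1 - kappa * delta) * Q <= Q by rewrite ler_piMl //; lra.
rewrite mulrDr [kappa * (b + delta)]mulrDr opprD expRD.
have oE : 0 <= opt * expR (- (kappa * b)) by rewrite mulr_ge0 ?expR_ge0 // ltW.
have h2 : 1 - kappa * delta <= expR (- (kappa * delta)).
  by have := @expR_ge1Dx R (- (kappa * delta)); lra.
by have := ler_wpM2r oE h2; lra.
Qed.

Lemma card_le_n (S : {set 'I_n}) : (#|S| <= n)%N.
Proof. by rewrite -[leqRHS]card_ord max_card. Qed.

Lemma greedy_inv0 : greedy_inv 0 0 top.
Proof.
have e16 := eps_lt; have ep0 := eps_gt0; have o0 := opt_gt0.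
have /andP[t1 t5] := top_bounds; have t0 : 0 < top by exact: lt_le_trans opt_gt0 t1.
split.
- by split; [exact: nonneg0|exact: dotv0].
- by [].
- by rewrite t0 lexx.
- by move=> j _; left; rewrite mxE.
- rewrite mlext0 // subr0 mulr0 oppr0 expR0 mulr1; split.
    by apply: le_trans t1; rewrite ler_piMl ?(ltW opt_gt0) // /kappa; lra.
  by rewrite lerD2l; apply: loss_pot_le; rewrite ?(ltW t0) ?lexx ?card_le_n.
Qed.

(* In each step the drop of the loss potential pays for the items that stop
   being active during the step. *)
Lemma greedy_inv_spread x b lam :
  let S := small_active f a lam eta x in
  greedy_inv x b lam -> (0 < #|S|)%N -> b + eta <= 1 ->
  greedy_inv (spread a eta S x) (b + eta) lam.
Proof.
have e16 := eps_lt; have ep0 := eps_gt0; have o0 := opt_gt0.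
move=> S [[x0 dx] b1 lb xl [hD hpot]] S0 be1.
have /andP[l0 lt] := lb; have e0 := ltW eta_gt0.
have b0 : 0 <= b.
  rewrite -dx; apply: sumr_ge0 => j _; apply: mulr_ge0 => //.
  by case/andP: (cost j) => /ltW.
have eta1 : eta <= 1 by lra.
have hD' : opt - mlext f x <=
    opt * expR (- (kappa * b)) + (loss_cap - loss_pot lam #|S|).
  by lra.
have xy i : x 0 i <= spread a eta S x 0 i by exact: spread_ge.
have gain := spread_gain mono subm cost lam x0 e0 S0.
rewrite small_active_spread // in gain.
set y := spread a eta S x in xy gain *.
set S' := small_active f a lam eta y in gain *.
have S'S : (#|S'| <= #|S|)%N.
  by apply: subset_leq_card; exact: small_active_anti.
have drop := @count_pot_drop R _ _ S0 S'S.
have le0 : 0 <= eta * lam by rewrite mulr_ge0 // ltW.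
have drop' := ler_wpM2l le0 drop.
split.
- by split; [exact: nonneg_le xy|rewrite dotv_spread // dx].
- by [].
- by [].
- move=> j jl; have := xl j jl; rewrite [y 0 j]mxE ifF ?addr0 //.
  by rewrite inE (negPf jl) andbF.
- have F_mono := mlext_le mono x0 xy.
  have k0 := kappa_ge0.
  have Q0 : 0 <= loss_cap - loss_pot lam #|S|.
    by rewrite subr_ge0; apply: loss_pot_le; rewrite ?card_le_n // (ltW l0).
  split; first by apply: le_trans hD; rewrite ler_wpM2l // lerB.
  apply: spread_arith gain drop' (decay _ Q0 hD hD').
  by rewrite e0 eta1.
Qed.

(** A large active item has coordinate 0, so it is added whole and gains exactly its slope, at least
    [lam a_j]. Such a step loses nothing; the potential only has to be nonincreasing. *)
Lemma greedy_inv_large x b lam j :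
  j \in large_active f a lam eta x -> greedy_inv x b lam -> b + a 0 j <= 1 ->
  greedy_inv (set_coord x j 1) (b + a 0 j) lam.
Proof.
have e16 := eps_lt; have ep0 := eps_gt0; have o0 := opt_gt0.
move=> jT [[x0 dx] b1 lb xl [hD hpot]] ba1.
have /andP[l0 lt] := lb; have e0 := ltW eta_gt0; have /andP[aj0 aj1] := cost j.
move: jT; rewrite !inE => /andP[jl /andP[xj1 hj]].
have xj : x 0 j = 0.
  case: (xl j) => // [|xj]; first by rewrite inE.
  by rewrite xj ltxx in xj1.
have yE : set_coord x j 1 = x + delta_mx 0 j.
  apply/rowP => i; rewrite !mxE eqxx /=; case: eqP => [->|_]; last by rewrite addr0.
  by rewrite xj add0r.
have xy i : x 0 i <= set_coord x j 1 0 i.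
  by rewrite yE mxE lerDl nonneg_unit.
have gain : mlext f (set_coord x j 1) = mlext f x + slope f x j.
  by rewrite yE mlext_add_unit.
set y := set_coord x j 1 in yE xy gain *.
have sS : (#|small_active f a lam eta y| <= #|small_active f a lam eta x|)%N.
  by apply: subset_leq_card; exact: small_active_anti.
split.
- by split; [exact: nonneg_le xy|rewrite yE dotvD dotv_unit dx].
- by [].
- by [].
- move=> i il; rewrite /y; have [->|ij] := eqVneq i j.
    by right; rewrite set_coordE.
  by rewrite set_coord_neq //; exact: xl.
- have F_mono := mlext_le mono x0 xy.
  have k0 := kappa_ge0.
  split; first by apply: le_trans hD; rewrite ler_wpM2l // lerB.
  set s := #|_| in hpot sS *; set s' := #|_| in sS *.
  have Q0 : 0 <= loss_cap - loss_pot lam s.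
    by rewrite subr_ge0; apply: loss_pot_le; rewrite ?card_le_n // (ltW l0).
  have hD' : opt - mlext f x <=
      opt * expR (- (kappa * b)) + (loss_cap - loss_pot lam s).
    by lra.
  have pm := loss_pot_mono (ltW l0) sS.
  have dj : 0 <= a 0 j <= 1 by rewrite aj1 ltW.
  exact: large_arith gain hj pm (decay dj Q0 hD hD').
Qed.

Lemma active_split lam x : active f a lam x =
  small_active f a lam eta x :|: large_active f a lam eta x.
Proof. by rewrite /small_active /large_active finset.setID. Qed.

(** With no active item left the gap is at most [lam], so [kappa lam] is still a valid threshold. In
    the potential, [kappa / eps = kappa + kappa^2 / eps] splits the allowance of the new phase off
    the tail of the series. *)
Lemma greedy_inv_phase x b lam :
  small_active f a lam eta x = finset.set0 ->
  large_active f a lam eta x = finset.set0 ->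
  greedy_inv x b lam -> greedy_inv x b (kappa * lam).
Proof.
have e16 := eps_lt; have ep0 := eps_gt0; have o0 := opt_gt0.
move=> S0 T0 [[x0 dx] b1 /andP[l0 lt] xl [hD hpot]].
have kp : 0 < kappa by rewrite /kappa; lra.
have act : active f a lam x = finset.set0 by rewrite active_split S0 T0 finset.setU0.
have up := active0_opt_le mono subm cost x0 (ltW l0) act.
split => //.
- rewrite mulr_gt0 //=; apply: le_trans lt; rewrite ler_piMl ?ltW //.
  by rewrite /kappa; lra.
- split; first by rewrite ler_pM2l //; lra.
  apply: le_trans hpot; rewrite lerD2l S0 finset.cards0.
  rewrite /loss_pot (_ : count_pot 0 = 0 :> R) // mulr0 add0r.
  set s := #|_|.
  have hs : count_pot s <= count_pot n :> R by apply: count_pot_mono; exact: card_le_n.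
  have el : 0 <= eta * (kappa * lam) by rewrite !mulr_ge0 // ltW.
  have := ler_wpM2l el hs.
  have -> : eta * count_pot n * lam * (kappa / eps) =
      eta * (kappa * lam) * count_pot n + eta * count_pot n * (kappa * lam) * (kappa / eps).
    by rewrite /kappa; field; rewrite lt0r_neq0.
  by lra.
Qed.

Lemma expR_le1D (y : R) : 0 <= y <= 2^-1 -> expR y <= 1 + 2 * y.
Proof.
move=> /andP[y0 y1]; have h := @expR_ge1Dx R (- y).
have e0 := expR_gt0 y; rewrite expRN in h.
have : (1 - y) * expR y <= 1 by rewrite -ler_pdivlMr // div1r.
by nra.
Qed.

(** Turns the factor [kappa] in the exponent into an additive error of order [eps]. *)
Lemma expR_shift (y z : R) : 0 <= y -> y - z <= 2^-1 -> z <= y ->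
  expR (- z) <= expR (- y) + 2 * (y - z).
Proof.
move=> y0 yz zy; have -> : - z = - y + (y - z) by ring.
have h : expR (y - z) <= 1 + 2 * (y - z) by apply: expR_le1D; rewrite subr_ge0 zy.
rewrite expRD; have e1 : expR (- y) <= 1 by rewrite -[leRHS]expR0 ler_expR oppr_le0.
apply: le_trans (ler_wpM2l (expR_ge0 _) h) _.
have h2 : 0 <= 2 * (y - z) by rewrite mulr_ge0 // subr_ge0.
by have := ler_wpM2r h2 e1; lra.
Qed.

Lemma greedy_gap x b lam : greedy_inv x b lam ->
  opt - mlext f x <= opt * expR (- (kappa * b)) + 10 * eps * opt.
Proof.
move=> [_ _ /andP[l0 _] _ [_ h]].
have := loss_pot_ge0 #|small_active f a lam eta x| (ltW l0).
by have := loss_cap_le; lra.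
Qed.

Lemma expRN1_ge : 4^-1 <= expR (-1) :> R.
Proof.
have -> : -1 = - 2^-1 - 2^-1 :> R by lra.
rewrite expRD; have := @expR_ge1Dx R (- 2^-1).
by nra.
Qed.

Lemma expRN1_le : expR (-1) <= 2^-1 :> R.
Proof.
have h := @expR_ge1Dx R 1; have e0 := @expR_gt0 R 1.
by rewrite expRN invf_ple ?posrE //; lra.
Qed.

(** From [b > 1 - eps] follows [kappa b >= 1 - 2 eps], so the gap is at most [opt (1/e + 14 eps)].
    As [1 - 1/e >= 1/2], a relative error of 32 eps covers the excess. *)
Lemma greedy_full x b lam : greedy_inv x b lam -> eta <= eps -> 1 < b + eta ->
  (1 - 32 * eps) * (1 - expR (-1)) * opt <= mlext f x.
Proof.
have e16 := eps_lt; have ep0 := eps_gt0; have o0 := opt_gt0.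
move=> inv ee be; have gap := greedy_gap inv.
have [[_ _] b1 _ _ _] := inv.
have kb : kappa * b >= 1 - 2 * eps.
  have h : 1 - eps <= b by lra.
  by rewrite /kappa; nra.
have kb1 : kappa * b <= 1 by rewrite /kappa; nra.
have h := @expR_shift 1 (kappa * b).
have {}h : expR (- (kappa * b)) <= expR (-1) + 4 * eps.
  have := h ler01; rewrite kb1 => h1.
  have /h1/(_ isT) : 1 - kappa * b <= 2^-1 by lra.
  by lra.
have := ler_wpM2l (ltW opt_gt0) h.
have e1 := expRN1_ge; have e2 := expRN1_le.
have := mulr_ge0 (ltW eps_gt0) (ltW opt_gt0).
set E := expR (-1) in e1 e2 *; set G := expR _ in gap *.
move=> eo h3.
have h4 : 0 <= eps * opt * (1 - 2 * E) by rewrite mulr_ge0 // subr_ge0; lra.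
by nra.
Qed.

(** Here [lam <= top/32 <= 5 opt/32] and [kappa >= 15/16], so the gap is at most [opt/6]. *)
Lemma greedy_low x b lam : greedy_inv x b lam -> 32 * lam <= top ->
  3 / 4 * opt <= mlext f x.
Proof.
have e16 := eps_lt; have ep0 := eps_gt0; have o0 := opt_gt0.
move=> [_ _ _ _ [h _]] lt; have /andP[_ t5] := top_bounds.
rewrite /kappa in h.
have [D0|D0] := leP (opt - mlext f x) 0; first by lra.
have : (15 / 16) * (opt - mlext f x) <= (1 - eps) * (opt - mlext f x).
  by apply: ler_wpM2r; [exact: ltW|lra].
by lra.
Qed.

(** * Runs stopped by a large item that does not fit *)

Section Overflow.
Variables (x : 'rV[R]_n) (b lam : R) (j : 'I_n).
Hypothesis inv : greedy_inv x b lam.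
Hypothesis jlarge : j \in large_active f a lam eta x.
Hypothesis over : 1 < b + a 0 j.

Lemma overflow_slope : lam * a 0 j <= slope f x j.
Proof. by move: jlarge; rewrite !inE => /andP[_ /andP[_ ->]]. Qed.

Lemma overflow_zero : x 0 j = 0.
Proof.
have [_ _ _ xl _] := inv.
move: jlarge; rewrite !inE => /andP[jl /andP[xj1 _]].
case: (xl j) => // [|xj]; first by rewrite inE.
by rewrite xj ltxx in xj1.
Qed.

(** Adding [e_j] behaves like one more step, which carries the decay to a spending above 1 even
    though the budget is exceeded. *)
Lemma overflow_add :
  (1 - 32 * eps) * (1 - expR (-1)) * opt <= mlext f (x + delta_mx 0 j).
Proof.
have e16 := eps_lt; have ep0 := eps_gt0; have o0 := opt_gt0.
have [[x0 _] _ /andP[l0 lt] _ [hD hpot]] := inv.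
have /andP[aj0 aj1] := cost j; have ov := over.
rewrite mlext_add_unit ?overflow_zero //.
have dj : 0 <= a 0 j <= 1 by rewrite aj1 ltW.
have Q0 : 0 <= 10 * eps * opt by rewrite !mulr_ge0 // ltW.
have step := decay dj Q0 hD (greedy_gap inv).
have k0 := kappa_ge0; have o1 := ltW opt_gt0.
have mono_exp : expR (- (kappa * (b + a 0 j))) <= expR (- kappa).
  by rewrite ler_expR lerN2 -{1}[kappa]mulr1 ler_wpM2l // ltW.
have shift : expR (- kappa) <= expR (-1) + 2 * eps.
  have -> : eps = 1 - kappa by rewrite /kappa; lra.
  by apply: expR_shift; rewrite /kappa; lra.
have slp := overflow_slope.
have bound := ler_wpM2l o1 (le_trans mono_exp shift).
have e2 := expRN1_le.
have h4 := mulr_ge0 (mulr_ge0 (ltW ep0) o1) (_ : 0 <= 1 - 2 * expR (-1)).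
have {}h4 : 0 <= eps * opt * (1 - 2 * expR (-1)) by apply: h4; lra.
move: (expR (-1)) (expR (- (kappa * (b + a 0 j)))) bound e2 h4 step slp => E G.
move: (mlext f x) (slope f x j) (lam * a 0 j) opt o0 => F sl la o o0.
move=> h1 h2 h3 h4 h5.
have h6 : 0 <= eps * o by rewrite mulr_ge0 ?(ltW ep0) ?(ltW o0).
by lra.
Qed.

(** [b > 1/16] gives [1 - e^(-b) >= 1/32], so the additive error of 12 eps opt is covered by a
    relative error of 512 eps. *)
Lemma overflow_mid : 16^-1 < b ->
  (1 - 512 * eps) * (1 - expR (- b)) * opt <= mlext f x.
Proof.
have e16 := eps_lt; have ep0 := eps_gt0; have o0 := opt_gt0.
have [[x0 _] b1 _ _ _] := inv.
move=> b16; have gap := greedy_gap inv; have o1 := ltW opt_gt0.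
have b0 : 0 <= b by lra.
have kb : b - kappa * b = eps * b by rewrite /kappa; ring.
have eb : eps * b <= eps by rewrite ler_piMr // ltW.
have eb0 : 0 <= eps * b by rewrite mulr_ge0 // ltW.
have shift : expR (- (kappa * b)) <= expR (- b) + 2 * (eps * b).
  by rewrite -kb; apply: expR_shift => //; lra.
have inv_b : expR (- b) * (1 + b) <= 1.
  have := ler_wpM2l (expR_ge0 (- b)) (expR_ge1Dx b).
  by rewrite -expRD addNr expR0.
have e0 := expR_ge0 (- b).
have small : expR (- b) <= 31 / 32 by nra.
have bound := ler_wpM2l o1 shift.
have h4 : 0 <= eps * opt * (31 / 32 - expR (- b)).
  by rewrite mulr_ge0 ?mulr_ge0 ?subr_ge0 // ltW.
have h5 := ler_wpM2l o1 eb.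
move: (expR (- b)) (expR (- (kappa * b))) bound h4 gap => E G.
move: (mlext f x) opt o0 o1 h5 => F o o0 o1 h5 h1 h2 h3.
have h6 : 0 <= eps * o by rewrite mulr_ge0 // ltW.
by lra.
Qed.

(** The item costs at least 15/16, so its slope is at least [(15/16)^2] times the gap; if
    [F(x) < opt/8] this exceeds [3/4 opt]. Otherwise a slope of at least [6 F(x)] is at least
    [6/8 opt], which explains the factor 6 in the final test. *)
Lemma overflow_small : b <= 16^-1 -> 3 / 4 * opt <= slope f x j \/
  slope f x j < 6 * mlext f x /\ opt / 8 <= mlext f x.
Proof.
have e16 := eps_lt; have ep0 := eps_gt0; have o0 := opt_gt0; have ov := over.
have [_ _ /andP[l0 _] _ [hD _]] := inv.
move=> b16; have slp := overflow_slope.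
have aj : 15 / 16 <= a 0 j by lra.
have h1 := ler_wpM2l (ltW l0) aj.
have h2 : mlext f x < opt / 8 -> 3 / 4 * opt <= slope f x j.
  move=> F8; have D0 : 0 <= opt - mlext f x by lra.
  have h3 : 15 / 16 * (opt - mlext f x) <= kappa * (opt - mlext f x).
    by apply: ler_wpM2r => //; rewrite /kappa; lra.
  by lra.
have [F8|F8] := ltP (mlext f x) (opt / 8); first by left; exact: h2.
have [s6|s6] := ltP (slope f x j) (6 * mlext f x); first by right.
by left; lra.
Qed.

End Overflow.

End MainInvariant.

(** * Correctness and cost of the greedy loop *)

Definition big_cost : rexp := RCell ar_cost (NVar nv_big).

Definition add_large_cmd : cmd :=
  CSeq (CSetCell ar_x (NVar nv_big) (rconst 1))
    (CSeq (CSetCell ar_spent (NConst 0) (RAdd (cell0 ar_spent) big_cost)) grad_cmd).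

Definition add_small_cmd : cmd :=
  CSeq spread_cmd
    (CSeq (CSetCell ar_spent (NConst 0) (RAdd (cell0 ar_spent) (cell0 ar_eta)))
      grad_cmd).

Definition phase_cmd : cmd :=
  CSetCell ar_lam (NConst 0)
    (RMul (RSub (rconst 1) (cell0 ar_eps)) (cell0 ar_lam)).

Definition greedy_body : cmd :=
  CSeq scan_cmd
    (CIf (BNot (BNatLe (NVar nv_n) (NVar nv_big)))
      (CIf (BRealLe (RAdd (cell0 ar_spent) big_cost) (rconst 1))
        add_large_cmd (CSetNat nv_done (NConst 1)))
      (CIf (BNatLe (NConst 1) (NVar nv_count)) add_small_cmd phase_cmd)).

Definition greedy_cmd : cmd :=
  CWhile (BAnd (BNatLe (NVar nv_done) (NConst 0))
    (BAnd (BRealLe (RAdd (cell0 ar_spent) (cell0 ar_eta)) (rconst 1))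
      (BNot (BRealLe (RMul (rconst 32) (cell0 ar_lam)) (cell0 ar_top)))))
    greedy_body.

Section Greedy.
Context {R : realType} {n : nat}.
Variables (f : {set 'I_n} -> R) (a : 'rV[R]_n).
Hypothesis fnorm : normalized_setfun f.
Hypothesis mono : monotone_setfun f.
Hypothesis subm : submodular_setfun f.
Hypothesis cost : forall j, 0 < a 0 j <= 1.
Variables (eps eta top : R).
Notation opt := (knapsack_opt f a).
Hypothesis eps_gt0 : 0 < eps.
Hypothesis eps_lt : 16 * eps <= 1.
Hypothesis eta_gt0 : 0 < eta.
Hypothesis eta_pot : eta * count_pot n <= 2 * eps ^+ 2.
Hypothesis top_bounds : opt <= top <= 5 * opt.
Hypothesis opt_gt0 : 0 < opt.
Implicit Types (s : state R).

Notation wp := (wp f).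
Notation inv := (greedy_inv f a eps eta top).
Notation Ns := [:: nv_j; nv_count; nv_big].
Notation Nd := [:: nv_j; nv_count; nv_big; nv_done].
Notation As := [:: ar_x; ar_cap; ar_grad; ar_lam; ar_spent].

Definition greedy_consts s :=
  [/\ nmem s nv_n = n, pending s = [::], costs_loaded a s &
      [/\ eta_of s = eta, thr_of s = eta, rmem s ar_eps 0%N = eps &
          rmem s ar_top 0%N = top]].

Definition greedy_state s := [/\ greedy_consts s, grad_loaded f s &
  inv (vec_of n s ar_x) (rmem s ar_spent 0%N) (lam_of s)].

Lemma effect_consts s s' r q w : effect Nd As r q w s s' ->
  greedy_consts s -> greedy_consts s'.
Proof.
move=> [h1 h2 h3 _ _] [c1 c2 c3 [c4 c5 c6 c7]]; split.
- by rewrite h1.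
- by rewrite h3.
- by move=> j; rewrite h2.
- by rewrite /eta_of /thr_of !h2.
Qed.

Lemma sub_done : {subset Ns <= Nd}.
Proof. by move=> v; rewrite !inE => /or3P[] ->; rewrite ?orbT. Qed.

Lemma effect_done s s' r q w : effect Ns As r q w s s' -> effect Nd As r q w s s'.
Proof. by move=> e; exact: effect_weaken e sub_done (fun _ h => h) (leqnn _). Qed.

Lemma sub_j : {subset [:: nv_j] <= Ns}.
Proof. by move=> v; rewrite !inE => /eqP ->. Qed.

Lemma sub_x : {subset [:: ar_x] <= As}.
Proof. by move=> v; rewrite !inE => /eqP ->. Qed.

Lemma sub_grad : {subset [:: ar_cap; ar_grad] <= As}.
Proof. by move=> v; rewrite !inE => /orP[] /eqP ->. Qed.

Lemma sub_nil : {subset [::] <= As}.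
Proof. by []. Qed.

Lemma greedy_grad_spec s x b : greedy_consts s ->
  vec_of n s ar_x = x -> rmem s ar_spent 0%N = b -> inv x b (lam_of s) ->
  wp grad_cmd (fun s' => [/\ effect Ns As 1 n (10 * n + 10) s s', greedy_state s',
    rmem s' ar_spent 0%N = b & lam_of s' = lam_of s]) s.
Proof.
move=> hc xE bE hinv; have [c1 c2 c3 c4] := hc.
have x0 : nonneg_vec x by have [[]] := hinv.
apply: wp_mono (@grad_spec _ _ f s c1 c2 _); last by rewrite xE.
move=> s' [e g]; have [n1 a1 p1 _ _] := e.
have e' := effect_weaken e sub_j sub_grad (leqnn _).
have x' : vec_of n s' ar_x = x by rewrite -xE; apply: vec_of_ext; rewrite a1.
have lam' : lam_of s' = lam_of s by rewrite /lam_of a1.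
have b' : rmem s' ar_spent 0%N = b by rewrite a1.
split => //; split; first exact: effect_consts (effect_done e') hc.
  by move=> j; rewrite x' g xE.
by rewrite x' lam' b'.
Qed.

(** A large item costs at least [eta], so this round advances the spending no less than a spread
    step does. *)
Lemma add_large_spec s (j : 'I_n) : greedy_state s -> nmem s nv_big = j ->
  j \in large_active f a (lam_of s) eta (vec_of n s ar_x) ->
  rmem s ar_spent 0%N + a 0 j <= 1 ->
  wp add_large_cmd (fun s' => [/\ effect Ns As 1 n (10 * n + 12) s s',
    greedy_state s', rmem s ar_spent 0%N + eta <= rmem s' ar_spent 0%N &
    lam_of s' = lam_of s]) s.
Proof.
move=> [hc hg hinv] sj jT fits; have [c1 c2 c3 c4] := hc.
apply: wp_seq; apply: wp_set_cell; apply: wp_seq; apply: wp_set_cell.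
set s1 := tick _; have e1 : effect Ns As 0 0 2 s s1.
  do 2!apply: effect_store (ltnSn _) _ => //; exact: effect_refl.
have x1 : vec_of n s1 ar_x = set_coord (vec_of n s ar_x) j 1.
  apply/rowP => i; rewrite !mxE /s1 /= !upd_cellE /= sj.
  by rewrite -val_eqE; case: eqP.
have b1 : rmem s1 ar_spent 0%N = rmem s ar_spent 0%N + a 0 j.
  by rewrite /s1 /= !upd_cellE /= sj c3.
have l1 : lam_of s1 = lam_of s by [].
apply: wp_mono (@greedy_grad_spec s1 _ _ (effect_consts (effect_done e1) hc) x1 b1 _).
  move=> s2 [e2 hs2 b2 l2]; split => //.
  - by have := effect_trans e1 e2; rewrite !add0n addnC -addnA.
  - rewrite b2 lerD2l; move: jT; rewrite !inE => /andP[jl _].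
    by rewrite leNgt.
by rewrite l1; apply: greedy_inv_large.
Qed.

Lemma add_small_spec s : greedy_state s ->
  let S := small_active f a (lam_of s) eta (vec_of n s ar_x) in
  nmem s nv_count = #|S| -> (0 < #|S|)%N -> rmem s ar_spent 0%N + eta <= 1 ->
  wp add_small_cmd (fun s' => [/\ effect Ns As 1 n (15 * n + 13) s s',
    greedy_state s', rmem s ar_spent 0%N + eta <= rmem s' ar_spent 0%N &
    lam_of s' = lam_of s]) s.
Proof.
move=> [hc hg hinv] S sS S0 fits; have [c1 c2 c3 [c4 c5 c6 c7]] := hc.
apply: wp_seq; apply: wp_mono (@spread_spec _ _ f a s c1 c3 hg _); last by rewrite c5.
rewrite c4 c5 -/S => s1 [e1 x1]; have [n1 a1 p1 _ _] := e1.
apply: wp_seq; apply: wp_set_cell.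
set s2 := tick _; have e2 : effect Ns As 0 0 (5 * n + 3) s s2.
  by apply: effect_store (effect_weaken e1 sub_j sub_x (leqnn _)) => //; rewrite ltn_add2l.
have x2 : vec_of n s2 ar_x = spread a eta S (vec_of n s ar_x) by rewrite -x1.
have b2 : rmem s2 ar_spent 0%N = rmem s ar_spent 0%N + eta.
  by rewrite /s2 /= upd_cellE /= !a1 // -c4.
have l2 : lam_of s2 = lam_of s by rewrite /lam_of /s2 /= upd_cellE /= a1.
apply: wp_mono (@greedy_grad_spec s2 _ _ (effect_consts (effect_done e2) hc) x2 b2 _).
  move=> s3 [e3 hs3 b3 l3]; split => //.
  - have := effect_trans e2 e3; rewrite !add0n.
    by rewrite addnACA -mulnDl.
  - by rewrite b3.
  - by rewrite l3 l2.
by rewrite l2; exact: greedy_inv_spread.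
Qed.

(** The point does not move, so the stored gradient stays valid and lowering the threshold costs no
    round. *)
Lemma phase_spec s : greedy_state s ->
  let x := vec_of n s ar_x in
  small_active f a (lam_of s) eta x = finset.set0 ->
  large_active f a (lam_of s) eta x = finset.set0 ->
  wp phase_cmd (fun s' => [/\ effect Ns As 0 0 1 s s',
    greedy_state s', rmem s' ar_spent 0%N = rmem s ar_spent 0%N &
    lam_of s' = (1 - eps) * lam_of s]) s.
Proof.
move=> [hc hg hinv] x S0 T0; have [c1 c2 c3 [c4 c5 c6 c7]] := hc.
apply: wp_set_cell; set s1 := tick _.
have e1 : effect Ns As 0 0 1 s s1.
  by apply: effect_store (ltnSn _) _ => //; exact: effect_refl.
have l1 : lam_of s1 = (1 - eps) * lam_of s by rewrite /lam_of /s1 /= upd_cellE /= c6.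
have x1 : vec_of n s1 ar_x = x by [].
have b1 : rmem s1 ar_spent 0%N = rmem s ar_spent 0%N by [].
split => //; split => //.
by rewrite l1 x1 b1; exact: greedy_inv_phase.
Qed.

Definition greedy_outcome s :=
  (nmem s nv_done = 0%N /\ (1 < rmem s ar_spent 0%N + eta \/ 32 * lam_of s <= top)) \/
  (nmem s nv_done = 1%N /\ exists j : 'I_n,
    [/\ nmem s nv_big = j,
        j \in large_active f a (lam_of s) eta (vec_of n s ar_x) &
        1 < rmem s ar_spent 0%N + a 0 j]).

(** [k1] counts additions, each using one round and at least [eta] of budget. [k2] counts threshold
    drops, each lowering [lam] by more than [eps top / 32] because the loop runs only while
    [32 lam > top]. [nv_done] accounts for the stopping iteration. *)
Definition greedy_progress s0 k s := exists k1 k2 : nat,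
  [/\ k = (k1 + k2 + nmem s nv_done)%N, (nmem s nv_done <= 1)%N,
      effect Nd As k1 (n * k1) (40 * (n.+1 * k)) s0 s /\ greedy_state s,
      k1%:R * eta <= rmem s ar_spent 0%N /\
        k2%:R * (eps * top) <= 32 * (top - lam_of s) &
      nmem s nv_done = 1%N -> greedy_outcome s].

Lemma phase_count (k : nat) (e t l : R) : 0 <= e -> t < 32 * l ->
  k%:R * (e * t) <= 32 * (t - l) -> k.+1%:R * (e * t) <= 32 * (t - (1 - e) * l).
Proof. by move=> e0 tl h; rewrite -natr1; have := ler_wpM2l e0 (ltW tl); lra. Qed.

Lemma iter_work (k w : nat) : (w <= 21 * n + 25)%N ->
  (40 * (n.+1 * k) + w <= 40 * (n.+1 * k.+1))%N.
Proof. by move=> h; rewrite mulnS; move: (n.+1 * k)%N => m; lia. Qed.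

Lemma greedy_step s0 k s : greedy_progress s0 k s ->
  nmem s nv_done = 0%N -> rmem s ar_spent 0%N + eta <= 1 -> top < 32 * lam_of s ->
  wp greedy_body (greedy_progress s0 k.+1) (tick s).
Proof.
move=> [k1 [k2 [kE _ [e0 hs] [spent phases] _]]] d0 fits big.
rewrite d0 addn0 in kE.
have [hc hg hinv] := hs; have [c1 c2 c3 [c4 c5 c6 c7]] := hc.
set b := rmem s ar_spent 0%N in spent fits; set lam := lam_of s in phases big.
set x := vec_of n s ar_x.
apply: wp_seq; apply: wp_mono (@scan_spec _ _ f a (tick s) c1 c3 hg).
rewrite (_ : lam_of (tick s) = lam) // (_ : thr_of (tick s) = eta) //.
rewrite (_ : vec_of n (tick s) ar_x = x) //.
move=> s1 [e1 cnt br]; have [n1 a1 p1 _ _] := e1.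
have e1' := effect_weaken e1 (fun _ h => h) sub_nil (leqnn _).
have e01 := effect_trans (effect_tick e0) (effect_done e1').
rewrite !addn0 in e01.
have hc1 : greedy_consts s1 by exact: effect_consts (effect_done e1') _.
have x1 : vec_of n s1 ar_x = x by apply: vec_of_ext; rewrite a1.
have l1 : lam_of s1 = lam by rewrite /lam_of a1.
have b1 : rmem s1 ar_spent 0%N = b by rewrite a1.
have hs1 : greedy_state s1.
  split => //; last by rewrite x1 l1 b1.
  by move=> j; rewrite x1 a1 //; exact: hg.
have s1n : nmem s1 nv_n = n by case: hc1.
have d1 : nmem s1 nv_done = 0%N by rewrite n1.
set s2 := tick (tick s1).
have e02 : effect Nd As k1 (n * k1) (40 * (n.+1 * k) + (6 * n + 7)) s0 s2.
  by apply: effect_weaken (effect_tick (effect_tick e01)) _ _ _ => //; rewrite addSn !addnS.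
have advance s3 : effect Ns As 1 n (15 * n + 13) s2 s3 /\ greedy_state s3 ->
    b + eta <= rmem s3 ar_spent 0%N -> lam_of s3 = lam ->
    greedy_progress s0 k.+1 s3.
  move=> [e3 hs3] b3 l3; have [n3 _ _ _ _] := e3.
  have d3 : nmem s3 nv_done = 0%N by rewrite n3.
  exists k1.+1, k2; rewrite d3 addn0; split => //; first by rewrite kE.
    split => //; have := effect_trans e02 (effect_done e3).
    rewrite addn1 -mulnSr -addnA => h; apply: effect_weaken h _ _ _ => //.
    by apply: iter_work; clear; lia.
  split; last by rewrite l3.
  by rewrite -natr1 mulrDl mul1r; apply: le_trans b3; rewrite lerD2r.
apply: wp_if => /=; rewrite s1n -ltnNge.
case: br => [[bn T0]|[j jT bj]]; last first.
  have [_ _ cs1 _] := hc1.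
  rewrite bj ltn_ord; apply: wp_if => /=; rewrite bj b1 cs1.
  case: ifP => [fj|/negbT nfj].
    apply: wp_mono (@add_large_spec s2 j hs1 bj _ _); last first.
    - by rewrite [rmem _ _ _]b1.
    - by rewrite [lam_of _]l1 [vec_of _ _ _]x1.
    move=> s3 [e3 hs3 b3 l3]; apply: advance.
    - by split => //; apply: effect_weaken e3 _ _ _ => //; clear; lia.
    - by rewrite -b1.
    - by rewrite l3.
  apply: wp_set_nat; exists k1, k2; rewrite /= /upd /= addn1; split => //.
  - by rewrite kE.
  - split; last by [].
    apply: effect_assign e02 => //.
    by rewrite -addnS; apply: iter_work; clear; lia.
  - split; first by rewrite b1.
    by rewrite -[rmem s1 ar_lam 0%N]/(lam_of s1) l1.
  - move=> _; right; split => //; exists j; split => //.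
    - by rewrite [lam_of _]l1 [vec_of _ _ _]x1.
    - by rewrite [rmem _ _ _]b1 ltNge.
rewrite bn ltnn; apply: wp_if => /=; case: ifP => [c0|/negbT c0].
  apply: wp_mono (@add_small_spec s2 hs1 _ _ _); rewrite ?[lam_of _]l1 ?[vec_of _ _ _]x1 -?cnt //;
    last by rewrite [rmem _ _ _]b1.
  move=> s3 [e3 hs3 b3 l3]; apply: advance => //.
  - by rewrite -b1.
apply: wp_mono (@phase_spec s2 hs1 _ _); last 2 first.
- rewrite [lam_of _]l1 [vec_of _ _ _]x1; apply/eqP.
  by rewrite -cards_eq0 -cnt -leqn0 leqNgt.
- by rewrite [lam_of _]l1 [vec_of _ _ _]x1.
move=> s3 [e3 hs3 b3 l3]; have [n3 _ _ _ _] := e3.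
have d3 : nmem s3 nv_done = 0%N by rewrite n3.
exists k1, k2.+1; rewrite d3 addn0; split => //; first by rewrite kE addnS.
- split => //; have := effect_trans e02 (effect_done e3).
  rewrite !addn0 -addnA => h; apply: effect_weaken h _ _ _ => //.
  by apply: iter_work; clear; lia.
- split; first by rewrite b3 [rmem _ _ _]b1.
  by rewrite l3 [lam_of s2]l1; apply: phase_count => //; exact: ltW.
Qed.

Lemma greedy_spec s : greedy_state s -> nmem s nv_done = 0%N ->
  rmem s ar_spent 0%N = 0 -> lam_of s = top ->
  wp greedy_cmd (fun s' => exists k1 k2 : nat,
    [/\ effect Nd As k1 (n * k1) (40 * (n.+1 * (k1 + k2 + 2))) s s',
        greedy_state s', k1%:R * eta <= 1, k2%:R * eps <= 32 & greedy_outcome s']) s.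
Proof.
move=> hs d0 b0 l0.
have o0 := opt_gt0; have /andP[t1 _] := top_bounds.
have tp : 0 < top by exact: lt_le_trans t1.
have bounds k s' : greedy_progress s k s' -> exists k1 k2 : nat,
    [/\ (k <= k1 + k2 + 1)%N, k1%:R * eta <= 1, k2%:R * eps <= 32,
        effect Nd As k1 (n * k1) (40 * (n.+1 * k)) s s' & greedy_state s'].
  move=> [k1 [k2 [kE d1 [e hs'] [spent phases] _]]]; exists k1, k2.
  have [_ _ [_ b1 /andP[lp lt] _ _]] := hs'.
  split => //; first by rewrite kE leq_add2l.
    exact: le_trans b1.
  rewrite -(ler_pM2r tp) -mulrA; apply: le_trans phases _.
  by rewrite ler_wpM2l // gerBl ltW.
(* At most [1/eta] additions, [32/eps] threshold drops and one stop. *)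
have [N hN] : exists N : nat, eta^-1 + 32 / eps + 1 < N%:R.
  exists (Num.bound (eta^-1 + 32 / eps + 1)).
  apply: le_lt_trans (archi_boundP _); first exact: lexx.
  by rewrite !addr_ge0 // ?invr_ge0 ?divr_ge0 // ltW.
apply: (@wp_while _ _ _ N (greedy_progress s)).
- exists 0%N, 0%N; rewrite d0; split => //.
  + by split => //; rewrite muln0; exact: effect_refl.
  + by rewrite b0 l0 subrr !mul0r mulr0.
- move=> k s' /bounds[k1 [k2 [kk h1 h2 _ _]]].
  have b1 : k1%:R <= eta^-1 by rewrite -[leRHS]mul1r ler_pdivlMr.
  have b2 : k2%:R <= 32 / eps by rewrite ler_pdivlMr.
  apply: leq_trans kk _; rewrite -(ler_nat R) !natrD; apply: ltW.
  by apply: le_lt_trans hN; apply: lerD => //; apply: lerD.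
- move=> k s' hk; have [k1 [k2 [kE d1 [e hs'] [spent phases] _]]] := hk.
  rewrite /= leqn0 -ltNge => /andP[/eqP ds' /andP[fits big]].
  have [[_ _ _ [c4 c5 c6 c7]] _ _] := hs'.
  apply: greedy_step hk ds' _ _; first by rewrite -c4.
  by rewrite -c7.
- move=> k s' hk; have [k1 [k2 [kk h1 h2 e hs']]] := bounds _ _ hk.
  have [_ [_ [_ d1 _ _ out]]] := hk.
  have [[_ _ _ [c4 c5 c6 c7]] _ _] := hs'.
  rewrite /= leqn0 => stop; exists k1, k2; split => //.
    apply: effect_weaken (effect_tick e) _ _ _ => //.
    have le1 : (1 <= 21 * n + 25)%N by rewrite addn_gt0 orbT.
    rewrite -addn1; apply: leq_trans (iter_work k le1) _.
    by rewrite leq_pmul2l // leq_pmul2l // addn2 ltnS -addn1.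
  have [ds'|ds'] := eqVneq (nmem s' nv_done) 0%N; last first.
    apply: out; apply/eqP; rewrite eqn_leq d1 lt0n.
    exact: ds'.
  left; split => //; move: stop; rewrite ds' /= negb_and negbK.
  rewrite [rmem s' ar_eta 0%N]c4 [rmem s' ar_top 0%N]c7 -ltNge.
  by move=> /orP[->|->]; [left|right].
Qed.

End Greedy.

(** * The complete program *)

Definition log_cmd : cmd :=
  CSeq (CSetNat nv_log (NConst 0)) (CSeq (CSetNat nv_pow (NConst 1))
    (CWhile (BNatLe (NAdd (NVar nv_pow) (NConst 1)) (NVar nv_n))
      (CSeq (CSetNat nv_pow (NAdd (NVar nv_pow) (NVar nv_pow)))
        (CSetNat nv_log (NAdd (NVar nv_log) (NConst 1)))))).

Definition max_cmd : cmd :=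
  CSeq (CSetCell ar_pow (NConst 0) (rconst 0))
    (CFor (CIf (BRealLe (cell0 ar_pow) (at_j ar_grad))
      (CSetCell ar_pow (NConst 0) (at_j ar_grad)) CSkip)).

Definition next_t : nexp := NAdd (NVar nv_t) (NConst 1).

Definition powers_cmd : cmd :=
  CSeq (CSetNat nv_t (NConst 0))
    (CWhile (BNatLe next_t (NVar nv_log))
      (CSeq (CSetCell ar_pow next_t
              (RAdd (RCell ar_pow (NVar nv_t)) (RCell ar_pow (NVar nv_t))))
        (CSetNat nv_t next_t))).

Section Setup.
Context {R : realType} {n : nat}.
Variable (f : {set 'I_n} -> R).
Implicit Types (s : state R).

Notation wp := (wp f).

Lemma exp_log_lt (k : nat) : (k == 0)%N || (2 ^ k.-1 < n)%N -> (k <= n)%N.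
Proof.
case: k => [//|k] /= h; apply: leq_ltn_trans h.
by rewrite ltnW // ltn_expl.
Qed.

(** The minimality [2^(L-1) < n] is what later turns [O(L)] into [O(ln n)]. *)
Lemma log_spec s : nmem s nv_n = n -> (1 < n)%N ->
  wp log_cmd (fun s' => exists L,
    [/\ effect [:: nv_log; nv_pow] [::] 0 0 (3 * L + 3) s s', nmem s' nv_log = L,
        (0 < L <= n)%N, (n <= 2 ^ L)%N & (2 ^ L.-1 < n)%N]) s.
Proof.
move=> sn n1; apply: wp_seq; apply: wp_set_nat; apply: wp_seq; apply: wp_set_nat.
apply: (@wp_while _ _ _ n (fun k s' =>
  [/\ effect [:: nv_log; nv_pow] [::] 0 0 (3 * k + 2) s s', nmem s' nv_log = k,
      nmem s' nv_pow = (2 ^ k)%N & (k == 0)%N || (2 ^ k.-1 < n)%N])).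
- split => //; do 2!apply: effect_assign (ltnSn _) _ => //; exact: effect_refl.
- by move=> k s' [_ _ _]; exact: exp_log_lt.
- move=> k s' [e l p h] /=; have [n' _ _ _ _] := e.
  rewrite p addn1 n' // sn => pn; apply: wp_seq; apply: wp_set_nat; apply: wp_set_nat.
  split => //.
  + rewrite (_ : (3 * k.+1 + 2 = (3 * k + 2).+3)%N); last by lia.
    by do 2!apply: effect_assign (ltnSn _) _ => //; exact: effect_tick.
  + by rewrite /= /upd /= l addn1.
  + by rewrite /= /upd /= p addnn -mul2n expnS.
- move=> k s' [e l p h] /=; have [n' _ _ _ _] := e.
  rewrite p addn1 n' // sn -leqNgt => pn; exists k; split => //.
  + by rewrite addnS; exact: effect_tick.
  + rewrite exp_log_lt // andbT lt0n; apply: contraL n1 => /eqP k0.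
    by rewrite -leqNgt; rewrite k0 in pn.
  + case/orP: h => // /eqP k0; by rewrite k0 /= expn0 in pn *; exact: n1.
Qed.

(** Applied to the gradient at 0, whose entries are the singleton values; the result is left in cell
    0 of [ar_pow], the base of the table of thresholds. *)
Lemma max_spec s : nmem s nv_n = n ->
  wp max_cmd (fun s' => [/\ effect [:: nv_j] [:: ar_pow] 0 0 (5 * n + 3) s s',
    forall j : 'I_n, rmem s ar_grad j <= rmem s' ar_pow 0%N &
    0 <= rmem s' ar_pow 0%N /\ (rmem s' ar_pow 0%N = 0 \/
      exists j : 'I_n, rmem s' ar_pow 0%N = rmem s ar_grad j)]) s.
Proof.
move=> sn; apply: wp_seq; apply: wp_set_cell; set s0 := tick _.
have e0 : effect [:: nv_j] [:: ar_pow] 0 0 1 s s0.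
  by apply: effect_store (ltnSn _) _ => //; exact: effect_refl.
have g0 : rmem s0 ar_grad = rmem s ar_grad by case: e0 => _ ->.
apply: wp_mono (@wp_for _ _ _ [:: nv_j] [:: ar_pow] 3 (fun k s' =>
  (forall j : 'I_n, (j < k)%N -> rmem s ar_grad j <= rmem s' ar_pow 0%N) /\
  (0 <= rmem s' ar_pow 0%N /\ (rmem s' ar_pow 0%N = 0 \/
      exists j : 'I_n, rmem s' ar_pow 0%N = rmem s ar_grad j))) _ s0 _ _ _ _ _ _ _) => //.
- move=> s' [e [h1 h2]]; split => //.
  + have := effect_trans e0 e; rewrite !addn0 => h.
    by apply: effect_weaken h _ _ _ => //; rewrite addnC -addnA.
  + by move=> j; apply: h1.
- by rewrite /s0 /= upd_cellE /=; split => //; split => //; left.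
move=> k s1 kn [_ a1 _ _ _] s1j [h1 [h2 h3]]; pose K := Ordinal kn.
have g1 : rmem s1 ar_grad = rmem s ar_grad by rewrite a1.
have le_next (j : 'I_n) v : (forall j : 'I_n, (j < k)%N -> rmem s ar_grad j <= v) ->
    rmem s ar_grad K <= v -> (j < k.+1)%N -> rmem s ar_grad j <= v.
  move=> lv Kv; rewrite ltnS leq_eqVlt => /orP[/eqP jk|]; last exact: lv.
  by have -> : j = K by exact: val_inj.
apply: wp_if => /=; rewrite s1j g1; case: ifP => [lek|/negbT].
  apply: wp_set_cell => /=; rewrite s1j g1; split => //.
    apply: effect_store (ltnSn _) _ => //; do 2!apply: effect_tick.
    exact: effect_refl.
  rewrite /= upd_cellE /=; split.
    by move=> j; apply: le_next => // i ik; apply: le_trans lek; exact: h1.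
  by split; [exact: le_trans lek|right; exists K].
rewrite -ltNge => /ltW lek; apply: wp_skip; split => //.
  by do 3!apply: effect_tick; exact: effect_refl.
by split => //= j; apply: le_next.
Qed.

Lemma powers_spec s : let L := nmem s nv_log in let M := rmem s ar_pow 0%N in
  wp powers_cmd (fun s' => effect [:: nv_t] [:: ar_pow] 0 0 (3 * L + 2) s s' /\
    forall i, (i <= L)%N -> rmem s' ar_pow i = M * 2 ^+ i) s.
Proof.
move=> L M; apply: wp_seq; apply: wp_set_nat.
apply: (@wp_while _ _ _ L (fun k s' =>
  [/\ effect [:: nv_t] [:: ar_pow] 0 0 (3 * k + 1) s s', nmem s' nv_t = k,
      (k <= L)%N & forall i, (i <= k)%N -> rmem s' ar_pow i = M * 2 ^+ i])).
- split => //; last by move=> i; rewrite leqn0 => /eqP -> /=; rewrite expr0 mulr1.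
  by apply: effect_assign (ltnSn _) _ => //; exact: effect_refl.
- by move=> k s' [].
- move=> k s' [e t kL h] /=; have [n' _ _ _ _] := e.
  rewrite t addn1 n' // => lt_kL; apply: wp_seq; apply: wp_set_cell; apply: wp_set_nat.
  split => //=.
  + rewrite (_ : (3 * k.+1 + 1 = (3 * k + 1).+3)%N); last by lia.
    apply: effect_assign (ltnSn _) _ => //; apply: effect_store (ltnSn _) _ => //.
    exact: effect_tick.
  + by rewrite /upd /= t addn1.
  + move=> i; rewrite leq_eqVlt upd_cellE /= t addn1 h //.
    case: eqP => [-> _|_ /= ik]; last exact: h.
    by rewrite exprS; ring.
- move=> k s' [e t kL h] /=; have [n' _ _ _ _] := e.
  rewrite t addn1 n' // -leqNgt => Lk; have kE : k = L by apply/eqP; rewrite eqn_leq kL.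
  rewrite kE in e h; split; last by move=> i iL; exact: h.
  by rewrite addnS; exact: effect_tick.
Qed.

End Setup.

(** * Approximation guarantees of the output *)

Definition final_cmd : cmd :=
  CIf (BNatLe (NConst 1) (NVar nv_done))
    (CSeq query_cmd
      (CIf (BAnd (BRealLe (RMul (rconst 16) (cell0 ar_spent)) (rconst 1))
                 (BRealLe (RMul (rconst 6) (cell0 ar_val)) (RCell ar_grad (NVar nv_big))))
        (CSeq zero_cmd (CSetCell ar_x (NVar nv_big) (rconst 1)))
        CSkip))
    CSkip.

Section Guarantee.
Context {R : realType} {n : nat}.
Variables (f : {set 'I_n} -> R) (a : 'rV[R]_n).
Hypothesis fnorm : normalized_setfun f.
Hypothesis mono : monotone_setfun f.
Hypothesis subm : submodular_setfun f.
Hypothesis cost : forall j, 0 < a 0 j <= 1.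
Notation opt := (knapsack_opt f a).
Implicit Types (x : 'rV[R]_n) (c C eps : R) (s : state R).

Notation wp := (wp f).

(** [C] is a parameter because the branches of the program reach different constants, unified at the
    end by [guarantee_mono]. *)
Definition guarantee c C eps x : Prop :=
  nonneg_vec x /\
  dotv a x <= 1 /\
  (1 - C * eps) * (1 - expR (- (1 - sup_norm a))) * opt <= mlext f x /\
  (mlext f x < (1 - C * eps) * (1 - expR (-1)) * opt ->
     exists j : 'I_n,
       (1 - C * eps) * (1 - expR (-1)) * opt <= mlext f (x + delta_mx 0 j)) /\
  (forall j : 'I_n, c * eps ^+ 2 / ln n%:R <= a 0 j -> x 0 j = 0 \/ x 0 j = 1).

Lemma sup_norm_ge0 : 0 <= sup_norm a.
Proof.
rewrite /sup_norm; elim/big_ind: _ => // y z y0 z0.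
by rewrite le_max y0.
Qed.

Lemma sup_norm_le1 : sup_norm a <= 1.
Proof.
rewrite /sup_norm; elim/big_ind: _ => // [y z y1 z1|j _].
  by rewrite ge_max y1.
by have /andP[aj aj1] := cost j; rewrite gtr0_norm.
Qed.

Lemma le_sup_norm j : a 0 j <= sup_norm a.
Proof.
rewrite /sup_norm (bigD1 j) //= le_max; apply/orP; left.
exact: ler_norm.
Qed.

(** If [z > 1] the new left side is at most 0; otherwise it shrinks as [z] grows and as [g]
    shrinks. *)
Lemma approx_mono (z z' g g' o F : R) : 0 <= o -> 0 <= F -> z <= z' ->
  0 <= g' <= g -> (1 - z) * g * o <= F -> (1 - z') * g' * o <= F.
Proof.
move=> o0 F0 zz /andP[g0 gg] h.
have go0 : 0 <= g' * o by exact: mulr_ge0.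
have [z1|z1] := leP z 1; last first.
  by apply: le_trans F0; rewrite -mulrA mulr_le0_ge0 // subr_le0; lra.
apply: le_trans h; apply: (@le_trans _ _ ((1 - z) * g' * o)).
  by rewrite -!mulrA ler_wpM2r // lerB.
by rewrite -!mulrA ler_wpM2l ?subr_ge0 // ler_wpM2r.
Qed.

Lemma approx_factor_le (b : R) : 0 <= b <= 1 -> 0 <= 1 - expR (- b) <= 1 - expR (-1).
Proof.
move=> /andP[b0 b1]; rewrite subr_ge0 -[leRHS]expR0 ler_expR oppr_le0 b0 /=.
by rewrite lerB // ler_expR lerN2.
Qed.

Lemma residual_budget : 0 <= 1 - sup_norm a <= 1.
Proof. by rewrite subr_ge0 sup_norm_le1 lerBlDr lerDl sup_norm_ge0. Qed.

(** A bound with [1 - 1/e] implies (b), whose factor is no larger, and makes the premise of (c)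
    false. *)
Lemma guarantee_intro c C C' eps x : 0 <= eps -> C <= C' ->
  nonneg_vec x -> dotv a x <= 1 ->
  (forall j : 'I_n, c * eps ^+ 2 / ln n%:R <= a 0 j -> x 0 j = 0 \/ x 0 j = 1) ->
  (1 - C * eps) * (1 - expR (-1)) * opt <= mlext f x -> guarantee c C' eps x.
Proof.
move=> e0 CC x0 dx xl h.
have F0 : 0 <= mlext f x by exact: mlext_ge0.
have o0 : 0 <= opt by exact: opt_ge0.
have zz : C * eps <= C' * eps by exact: ler_wpM2r.
have e1 : 0 <= 1 - expR (-1 : R) <= 1 - expR (-1) by apply: approx_factor_le; rewrite ler01 lexx.
do 2!split => //; split.
  exact: approx_mono o0 F0 zz (approx_factor_le residual_budget) h.
split => // lt; have : (1 - C' * eps) * (1 - expR (-1)) * opt <= mlext f x.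
  exact: approx_mono o0 F0 zz e1 h.
by rewrite leNgt lt.
Qed.

Lemma guarantee_large_eps c C eps x : 0 <= eps -> 1 <= C * eps ->
  nonneg_vec x -> dotv a x <= 1 ->
  (forall j : 'I_n, c * eps ^+ 2 / ln n%:R <= a 0 j -> x 0 j = 0 \/ x 0 j = 1) ->
  guarantee c C eps x.
Proof.
move=> e0 Ce x0 dx xl; apply: (@guarantee_intro c C) => //.
apply: le_trans (mlext_ge0 fnorm mono x0).
rewrite -mulrA; apply: mulr_le0_ge0; first by rewrite subr_le0.
apply: mulr_ge0; last exact: opt_ge0.
have h1 : 0 <= (1 : R) <= 1 by rewrite ler01 lexx.
by have /andP[] := approx_factor_le h1.
Qed.

Variables (c eps eta top : R).
Hypothesis eps_gt0 : 0 < eps.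
Hypothesis eps_lt : 16 * eps <= 1.
Hypothesis eta_gt0 : 0 < eta.
Hypothesis eta_le : eta <= eps.
Hypothesis eta_pot : eta * count_pot n <= 2 * eps ^+ 2.
Hypothesis eta_large : forall j, c * eps ^+ 2 / ln n%:R <= a 0 j -> eta <= a 0 j.
Hypothesis top_bounds : opt <= top <= 5 * opt.
Hypothesis opt_gt0 : 0 < opt.

Notation inv := (greedy_inv f a eps eta top).

Lemma inv_integral x b lam : inv x b lam ->
  forall j : 'I_n, c * eps ^+ 2 / ln n%:R <= a 0 j -> x 0 j = 0 \/ x 0 j = 1.
Proof. by move=> [_ _ _ xl _] j /eta_large ej; apply: xl; rewrite inE -leNgt. Qed.

Lemma three_quarters_ge : (1 - 0 * eps) * (1 - expR (-1)) * opt <= 3 / 4 * opt.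
Proof.
have o0 := opt_gt0; have := @expRN1_ge R => h.
by rewrite mul0r subr0 mul1r ler_wpM2r ?(ltW o0) //; lra.
Qed.

Lemma stop_guarantee x b lam : inv x b lam -> 1 < b + eta \/ 32 * lam <= top ->
  guarantee c 512 eps x.
Proof.
move=> hinv stop; have [[x0 dx] b1 _ _ _] := hinv.
have xl := inv_integral hinv; rewrite -dx in b1.
case: stop => stop.
  apply: (guarantee_intro (ltW eps_gt0) (_ : 32 <= 512) x0 b1 xl).
    by rewrite ler_nat.
  by apply: greedy_full hinv eta_le stop.
apply: (guarantee_intro (ltW eps_gt0) (ler0n _ _) x0 b1 xl).
apply: le_trans three_quarters_ge _; by apply: greedy_low hinv stop.
Qed.

Lemma unit_guarantee (j : 'I_n) : 3 / 4 * opt <= slope f 0 j ->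
  guarantee c 512 eps (delta_mx 0 j).
Proof.
move=> h; apply: (guarantee_intro (ltW eps_gt0) (ler0n _ _)).
- exact: nonneg_unit.
- by rewrite dotv_unit; case/andP: (cost j).
- by move=> i _; rewrite mxE eqxx /=; case: (i == j); [right|left].
- by rewrite mlext_unit //; exact: le_trans three_quarters_ge h.
Qed.

(** The item that did not fit is the witness for (c). For (b), [b > 1 - a_j >= 1 - sup_norm a], so a
    bound with [b] in the exponent is stronger than the required one. *)
Lemma overflow_guarantee x b lam (j : 'I_n) : inv x b lam ->
  j \in large_active f a lam eta x -> 1 < b + a 0 j ->
  16^-1 < b \/ opt / 8 <= mlext f x -> guarantee c 512 eps x.
Proof.
move=> hinv jT over hb; have [[x0 dx] b1 _ _ _] := hinv.
have xl := inv_integral hinv.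
have F0 : 0 <= mlext f x by exact: mlext_ge0.
have o0 := ltW opt_gt0; have e0 := ltW eps_gt0.
have aj := le_sup_norm j; have ab : 1 - sup_norm a <= b by lra.
have /andP[r0 r1] := residual_budget.
do 2!split => //; first by rewrite dx.
split; last first.
  split => // _; exists j.
  apply: approx_mono o0 _ _ _
    (overflow_add cost eps_gt0 eps_lt eta_gt0 eta_pot top_bounds opt_gt0 hinv jT over).
  - by apply: mlext_ge0 => // i; rewrite mxE addr_ge0 // nonneg_unit.
  - by rewrite ler_wpM2r // ler_nat.
  - by apply: approx_factor_le; rewrite ler01 lexx.
have [b16|b16] := ltP 16^-1 b.
  apply: approx_mono o0 F0 (lexx _) _
    (overflow_mid eps_gt0 eps_lt eta_gt0 eta_pot top_bounds opt_gt0 hinv b16).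
  have /andP[-> _] := approx_factor_le residual_budget.
  by rewrite lerB // ler_expR lerN2.
case: hb => [|F8]; first by rewrite ltNge b16.
(* With [b <= 1/16] the factor in (b) is at most [1 - sup_norm a <= 1/16], so [opt / 8] is more than
   enough. *)
apply: le_trans F8; have h := @expR_ge1Dx R (- (1 - sup_norm a)).
have /andP[g0 _] := approx_factor_le residual_budget.
have z0 : 0 <= 512 * eps by exact: mulr_ge0 (ler0n _ _) e0.
apply: (@le_trans _ _ ((1 - expR (- (1 - sup_norm a))) * opt)).
  apply: ler_wpM2r; first exact: o0.
  by apply: ler_piMl; [exact: g0|rewrite gerBl; exact: z0].
rewrite mulrC; apply: ler_wpM2l; first exact: o0.
by lra.
Qed.

Notation Nall := (iota 1 11).
Notation Aall := (iota 2 10).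

Lemma final_spec s : (0 < n)%N -> greedy_state f a eps eta top s ->
  greedy_outcome f a eta top s ->
  wp final_cmd (fun s' => exists r,
    [/\ effect Nall Aall r r (4 * n + 9) s s', (r <= 1)%N &
        guarantee c 512 eps (vec_of n s' ar_x)]) s.
Proof.
move=> n0 [hc hg hinv] out; have [c1 c2 c3 [c4 c5 c6 c7]] := hc.
set x := vec_of n s ar_x in hinv.
have x0 : nonneg_vec x by have [[]] := hinv.
apply: wp_if => /=; case: out => [[d stop]|[d [j [bj jT over]]]]; rewrite d /=.
  apply: wp_skip; exists 0%N; split => //.
    apply: effect_weaken (effect_tick (effect_tick (effect_refl Nall Aall 0 s))) _ _ _ => //.
    by clear; lia.
  exact: stop_guarantee hinv stop.
apply: wp_seq; apply: wp_mono (@query_spec _ _ f (tick s) _ _) => //.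
move=> s1 [e1 val1]; have [n1 a1 p1 _ _] := e1.
rewrite (_ : vec_of n (tick s) ar_x = x) // in val1.
have N0 : {subset [::] <= Nall} by [].
have A0 : {subset [:: ar_val] <= Aall} by move=> v; rewrite inE => /eqP ->.
have e2 : effect Nall Aall 1 1 4 s (tick s1).
  apply: effect_tick; have h : effect Nall Aall 0 0 1 s (tick s).
    by apply: effect_tick; exact: effect_refl.
  exact: effect_trans h (effect_weaken e1 N0 A0 (leqnn _)).
have b1 : rmem s1 ar_spent 0%N = rmem s ar_spent 0%N by rewrite a1.
have bj1 : nmem s1 nv_big = j by rewrite n1.
have g1 : rmem s1 ar_grad j = slope f x j by rewrite a1 //; exact: hg.
have x1 : vec_of n s1 ar_x = x by apply: vec_of_ext; rewrite a1.
apply: wp_if => /=; rewrite bj1 val1 b1 g1.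
have small := overflow_small eps_gt0 eps_lt opt_gt0 hinv jT over.
case: ifP => [/andP[b16 s6]|/negbT]; last first.
  rewrite negb_and -!ltNge => hb; apply: wp_skip; exists 1%N; split => //.
    by apply: effect_weaken (effect_tick e2) _ _ _ => //; clear; lia.
  rewrite (_ : vec_of n _ ar_x = x) //; apply: overflow_guarantee hinv jT over _.
  have [b16|b16] := ltP 16^-1 (rmem s ar_spent 0%N); [by left|right].
  case: (small b16) => [h|[]//]; case/orP: hb => hb; first by lra.
  have := opt_gt0; lra.
have {}b16 : rmem s ar_spent 0%N <= 16^-1 by lra.
apply: wp_seq; apply: wp_mono (@zero_spec _ _ f (tick s1) _); last by rewrite /= n1.
move=> s2 [e3 z3]; have [n3 a3 p3 _ _] := e3.
have N3 : {subset [:: nv_j] <= Nall} by move=> v; rewrite inE => /eqP ->.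
have A3 : {subset [:: ar_x] <= Aall} by move=> v; rewrite inE => /eqP ->.
apply: wp_set_cell; exists 1%N; split => //.
  apply: effect_store (effect_trans e2 (effect_weaken e3 N3 A3 (leqnn _))) => //.
  by clear; lia.
have -> : vec_of n (tick (set_cell s2 ar_x (neval (nmem s2) (NVar nv_big))
    (reval s2 (rconst 1)))) ar_x = delta_mx 0 j.
  apply/rowP => i; have := congr1 (fun v : 'rV[R]_n => v 0 i) z3.
  rewrite !mxE /= upd_cellE /= n3 //= bj1 ?eqxx -val_eqE => ->.
  by case: eqP.
(* By concavity the slope at [x] is at most the slope at 0, which is the value of [e_j] alone. *)
apply: unit_guarantee; apply: (@le_trans _ _ (slope f x j)).
  case: (small b16) => [//|[]]; first by lra.
apply: slope_anti => // i; first exact: nonneg0.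
by rewrite mxE.
Qed.

End Guarantee.

(** * Choice of the step size and assembly of the core *)

Definition eta_exp (m : nat) : rexp :=
  RDiv (RMul (cell0 ar_eps) (cell0 ar_eps)) (RMul (rconst m) (RNat (NVar nv_log))).

Definition start_cmd (m : nat) : cmd :=
  CSeq (CSetCell ar_top (NConst 0) (RAdd (cell0 ar_val) (RCell ar_pow (NVar nv_hi))))
  (CSeq (CSetCell ar_lam (NConst 0) (cell0 ar_top))
  (CSeq (CSetCell ar_eta (NConst 0) (eta_exp m))
  (CSeq (CSetCell ar_thr (NConst 0) (cell0 ar_eta))
  (CSeq zero_cmd grad_cmd)))).

Definition core_cmd (m : nat) : cmd :=
  CSeq powers_cmd (CSeq (CSetNat nv_hi (NVar nv_log))
  (CSeq (CSetCell ar_thr (NConst 0) (rconst 2)) (CSeq bisect_cmd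
  (CSeq (start_cmd m) (CSeq greedy_cmd final_cmd))))).

Definition knapsack_cmd (m : nat) : cmd :=
  CIf (BNatLe (NVar nv_n) (NConst 1))
    (CSetCell ar_x (NConst 0) (rconst 1))
    (CIf (BRealLe (rconst 1) (RMul (rconst 16) (cell0 ar_eps)))
      CSkip
      (CSeq log_cmd (CSeq grad_cmd (CSeq max_cmd
        (CIf (BRealLe (cell0 ar_pow) (rconst 0)) CSkip (core_cmd m)))))).

Section Core.
Context {R : realType} {n : nat}.
Variables (f : {set 'I_n} -> R) (a : 'rV[R]_n).
Hypothesis fnorm : normalized_setfun f.
Hypothesis mono : monotone_setfun f.
Hypothesis subm : submodular_setfun f.
Hypothesis cost : forall j, 0 < a 0 j <= 1.
Notation opt := (knapsack_opt f a).
Implicit Types (s : state R).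

Notation wp := (wp f).
Notation Nall := (iota 1 11).
Notation Aall := (iota 2 10).

Definition step_size (eps : R) (m L : nat) : R := eps * eps / (m%:R * L%:R).

Lemma sub_Nall (l : seq nat) : all (fun v => 0 < v < 12)%N l -> {subset l <= Nall}.
Proof. by move=> /allP h v /h; rewrite mem_iota. Qed.

Lemma sub_Aall (l : seq nat) : all (fun v => 1 < v < 12)%N l -> {subset l <= Aall}.
Proof. by move=> /allP h v /h; rewrite mem_iota. Qed.

Lemma effect_all l l' r q w s s' : effect l l' r q w s s' ->
  all (fun v => 0 < v < 12)%N l -> all (fun v => 1 < v < 12)%N l' ->
  effect Nall Aall r q w s s'.
Proof.
by move=> e hl hl'; exact: effect_weaken e (sub_Nall hl) (sub_Aall hl') (leqnn _).
Qed.

Lemma start_spec (eps : R) (m L : nat) (M : R) s :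
  nmem s nv_n = n -> pending s = [::] -> costs_loaded a s ->
  rmem s ar_eps 0%N = eps -> nmem s nv_log = L ->
  rmem s ar_spent 0%N = 0 -> nmem s nv_done = 0%N ->
  let top := rmem s ar_val 0%N + rmem s ar_pow (nmem s nv_hi) in
  let eta := step_size eps m L in
  greedy_inv f a eps eta top 0 0 top ->
  wp (start_cmd m) (fun s' => [/\ effect Nall Aall 1 n (14 * n + 16) s s',
    greedy_state f a eps eta top s', nmem s' nv_done = 0%N,
    rmem s' ar_spent 0%N = 0 & lam_of s' = top]) s.
Proof.
move=> sn sp sc se sL s0 sd top eta hinv.
do 4!(apply: wp_seq; apply: wp_set_cell).
set s1 := tick _; have e1 : effect Nall Aall 0 0 4 s s1.
  do 4!apply: effect_store (ltnSn _) _ => //; exact: effect_refl.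
have [n1 a1 p1 _ _] := e1.
have s1n : nmem s1 nv_n = n by [].
apply: wp_seq; apply: wp_mono (zero_spec f s1n) => s2 [e2 z2].
have [n2 a2 p2 _ _] := e2.
apply: wp_mono (@grad_spec _ _ f s2 _ _ _); last first.
- by rewrite z2; exact: nonneg0.
- by rewrite p2.
- by rewrite n2.
move=> s3 [e3 g3]; have [n3 a3 p3 _ _] := e3.
have x3 : vec_of n s3 ar_x = 0 by rewrite -z2; apply: vec_of_ext; rewrite a3.
have top3 : rmem s3 ar_top 0%N = top.
  by rewrite a3 // a2 // /s1 /= !upd_cellE.
have lam3 : lam_of s3 = top by rewrite /lam_of a3 // a2 // /s1 /= !upd_cellE.
have etaE : eps * eps / (m%:R * L%:R) = eta by [].
have eta3 : eta_of s3 = eta.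
  by rewrite /eta_of a3 // a2 // /s1 /= !upd_cellE /= se sL.
have thr3 : thr_of s3 = eta.
  by rewrite /thr_of a3 // a2 // /s1 /= !upd_cellE /= se sL.
have b3 : rmem s3 ar_spent 0%N = 0 by rewrite a3 // a2 // /s1 /= !upd_cellE.
have e3' := effect_trans (effect_trans e1 (effect_all e2 isT isT)) (effect_all e3 isT isT).
rewrite !addn0 !add0n in e3'.
have [n4 a4 p4 _ _] := e3'.
split => //; last by rewrite n3 // n2.
  by apply: effect_weaken e3' _ _ _ => //; clear; lia.
split; last by rewrite x3 b3 lam3.
- split; [by rewrite n3 // n2|by rewrite p3 p2|by move=> j; rewrite a4|split => //].
  by rewrite a4.
- by move=> j; rewrite g3 z2 x3.
Qed.

Lemma ln_le_L (L : nat) : (n <= 2 ^ L)%N -> ln n%:R <= L%:R :> R.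
Proof.
move=> nL; apply: le_trans (ln_le_log nL) _.
have h := @ln_le_sub1 R 2 (ltr0n _ 2).
by rewrite ler_piMr //; lra.
Qed.

Lemma step_size_gt0 (eps : R) (m L : nat) : 0 < eps -> (0 < m)%N -> (0 < L)%N ->
  0 < step_size eps m L.
Proof. by move=> e0 m0 L0; rewrite divr_gt0 ?mulr_gt0 ?ltr0n. Qed.

Lemma step_size_le (eps : R) (m L : nat) : 0 < eps -> 16 * eps <= 1 ->
  (0 < m)%N -> (0 < L)%N -> step_size eps m L <= eps.
Proof.
move=> e0 e16 m0 L0; rewrite ler_pdivrMr ?mulr_gt0 ?ltr0n //.
rewrite ler_pM2l //; apply: (@le_trans _ _ 1); first by lra.
by rewrite -natrM ler1n muln_gt0 m0.
Qed.

(** [count_pot n <= 1 + ln n <= 2 L], and the factor [L] cancels against the step size. *)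
Lemma step_size_pot (eps : R) (m L : nat) : 0 < eps -> (0 < m)%N -> (0 < L)%N ->
  (n <= 2 ^ L)%N -> step_size eps m L * count_pot n <= 2 * eps ^+ 2.
Proof.
move=> e0 m0 L0 nL; have lnL := ln_le_L nL.
have mR : 1 <= m%:R :> R by rewrite ler1n.
have LR : 1 <= L%:R :> R by rewrite ler1n.
have cL : count_pot n <= 2 * L%:R :> R.
  by rewrite /count_pot; case: eqP => _; lra.
have ep : 0 <= eps * eps by rewrite mulr_ge0 // ltW.
apply: le_trans (ler_wpM2l (ltW (step_size_gt0 e0 m0 L0)) cL) _.
rewrite /step_size mulrAC ler_pdivrMr ?mulr_gt0 ?ltr0n // expr2.
have h1 : 0 <= L%:R * (m%:R - 1) :> R by rewrite mulr_ge0 // subr_ge0.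
have := mulr_ge0 ep h1.
by lra.
Qed.

(** [m > 1/c] and [L >= ln n] put the step size below the cost threshold of (d), so the items
    concerned are all treated as large. *)
Lemma step_size_large (c eps : R) (m L : nat) (j : 'I_n) : 0 < c -> c^-1 < m%:R ->
  0 < eps -> (1 < n)%N -> (n <= 2 ^ L)%N -> (0 < m)%N -> (0 < L)%N ->
  c * eps ^+ 2 / ln n%:R <= a 0 j -> step_size eps m L <= a 0 j.
Proof.
move=> c0 cm e0 n1 nL m0 L0; apply: le_trans; have lnL := ln_le_L nL.
have ln0 : 0 < ln n%:R :> R.
  apply: lt_le_trans (ln_nat_mono n1); apply: lt_le_trans (@ln2_ge R).
  by rewrite invr_gt0 ltr0n.
have mc : 1 <= c * m%:R by rewrite mulrC -ler_pdivrMr // div1r ltW.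
rewrite ler_pdivlMr // /step_size mulrAC ler_pdivrMr ?mulr_gt0 ?ltr0n // -expr2.
apply: (@le_trans _ _ (eps ^+ 2 * L%:R)).
  by rewrite ler_wpM2l // exprn_ge0 // ltW.
have -> : c * eps ^+ 2 * (m%:R * L%:R) = c * m%:R * (eps ^+ 2 * L%:R) by ring.
by rewrite ler_peMl // mulr_ge0 // exprn_ge0 // ltW.
Qed.

Lemma core_work (L w1 r1 k1 k2 : nat) : (L <= n)%N -> (w1 <= 90 * (n.+1 * r1.+1))%N ->
  (3 * L + 2 + 2 + w1 + (14 * n + 16) + 40 * (n.+1 * (k1 + k2 + 2)) + (4 * n + 9)
    <= 250 * (n.+1 * (r1 + k1 + k2).+1))%N.
Proof.
move=> Ln hw.
have h1 : (n.+1 * r1.+1 <= n.+1 * (r1 + k1 + k2).+1)%N.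
  by rewrite leq_mul2l ltnS -addnA leq_addr orbT.
have h2 : (n.+1 * (k1 + k2 + 2) <= n.+1 * ((r1 + k1 + k2).+1 * 2))%N.
  by rewrite leq_mul2l /=; lia.
have h3 : (n.+1 <= n.+1 * (r1 + k1 + k2).+1)%N by rewrite leq_pmulr.
rewrite mulnA in h2; move: (n.+1 * r1.+1)%N (n.+1 * (k1 + k2 + 2))%N
  (n.+1 * (r1 + k1 + k2).+1)%N hw h1 h2 h3 => x y z.
by lia.
Qed.

(** [nv_lo], [nv_done], [ar_val] and [ar_spent] still hold the zeros of the initial memory. The two
    rounds beyond [r1 + k1] are the gradient after the reset to 0 and the final value query. *)
Lemma core_spec (c eps : R) (m L : nat) s :
  let M := rmem s ar_pow 0%N in
  0 < eps -> 16 * eps <= 1 -> 0 < c -> c^-1 < m%:R -> (0 < m)%N -> (1 < n)%N ->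
  nmem s nv_n = n -> pending s = [::] -> costs_loaded a s ->
  rmem s ar_eps 0%N = eps -> nmem s nv_log = L -> (0 < L <= n)%N -> (n <= 2 ^ L)%N ->
  nmem s nv_lo = 0%N -> nmem s nv_done = 0%N ->
  rmem s ar_val 0%N = 0 -> rmem s ar_spent 0%N = 0 ->
  0 < M -> M <= opt -> opt <= M * 2 ^+ L ->
  wp (core_cmd m) (fun s' => exists r1 k1 k2 : nat, exists r q w : nat,
    [/\ effect Nall Aall r q w s s',
        [/\ (r <= r1 + k1 + 2)%N, (q <= n * r)%N &
            (w <= 250 * (n.+1 * (r1 + k1 + k2).+1))%N],
        (r1 <= 120 * L)%N,
        k1%:R * step_size eps m L <= 1 /\ k2%:R * eps <= 32 &
        guarantee f a c 512 eps (vec_of n s' ar_x)]) s.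
Proof.
move=> M e0 e16 c0 cm m0 n1 sn sp sc se sL /andP[L0 Ln] nL slo sd sval s0 M0 Mopt optM.
apply: wp_seq; apply: wp_mono (powers_spec f s) => s1 [e1].
rewrite sL -/M => pow1; have [n1' a1 p1 _ _] := e1.
apply: wp_seq; apply: wp_set_nat; apply: wp_seq; apply: wp_set_cell.
set s2 := tick _; have e2 : effect Nall Aall 0 0 (3 * L + 2 + 2) s s2.
  rewrite addn2; apply: effect_store (ltnSn _) _ => //.
  apply: effect_assign (ltnSn _) _ => //; rewrite -[in (3 * L)%N]sL.
  exact: effect_all e1 isT isT.
have [n2 a2 p2 _ _] := e2.
have log2 : nmem s2 nv_log = L by rewrite /s2 /= /upd /= n1'.
have hi2 : nmem s2 nv_hi = L by rewrite /s2 /= /upd /= n1'.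
have lo2 : nmem s2 nv_lo = 0%N by rewrite /s2 /= /upd /= n1'.
have n22 : nmem s2 nv_n = n by rewrite n2.
have d2 : nmem s2 nv_done = 0%N by rewrite /s2 /= /upd /= n1'.
have thr2 : thr_of s2 = 2 by rewrite /thr_of /s2 /= upd_cellE.
have pow2 i : (i <= nmem s2 nv_log)%N -> rmem s2 ar_pow i = M * 2 ^+ i.
  by rewrite log2 => iL; rewrite /s2 /= upd_cellE /= pow1.
have val2 : rmem s2 ar_val 0%N = 0 by rewrite /s2 /= upd_cellE /= a1.
have sp2 : rmem s2 ar_spent 0%N = 0 by rewrite /s2 /= upd_cellE /= a1.
have c2 : costs_loaded a s2 by move=> j; rewrite a2.
have ep2 : rmem s2 ar_eps 0%N = eps by rewrite a2.
have pd2 : pending s2 = [::] by rewrite p2.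
apply: wp_seq; apply: wp_mono
  (@bisect_spec _ _ f a fnorm mono subm cost s2 M n22 pd2 c2 thr2 _ _ lo2 _ pow2 val2 M0 Mopt _);
  rewrite ?log2 ?hi2 ?L0 //.
move=> s3 [r1 [q1 [w1 [e3 [r1L q1n] w1n hi3 topb]]]].
have [n3 a3 p3 _ _] := e3.
set top := _ + _ in topb; set eta := step_size eps m L.
have pow3 : rmem s3 ar_pow (nmem s3 nv_hi) = M * 2 ^+ nmem s3 nv_hi.
  by rewrite a3 // pow2 ?log2.
have o0 : 0 < opt by exact: lt_le_trans M0 Mopt.
have eta0 : 0 < eta by exact: step_size_gt0.
have etae : eta <= eps by exact: step_size_le.
have etap : eta * count_pot n <= 2 * eps ^+ 2 by exact: step_size_pot.
have hinv : greedy_inv f a eps eta top 0 0 top by exact: greedy_inv0.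
apply: wp_seq; apply: wp_mono (@start_spec eps m L M s3 _ _ _ _ _ _ _ _).
- rewrite pow3 -/top -/eta => s4 [e4 hs4 d4 b4 l4].
  apply: wp_seq; apply: wp_mono
    (@greedy_spec _ _ f a mono subm cost eps eta top e0 e16 eta0 etap topb o0 s4 hs4 d4 b4 l4).
  move=> s5 [k1 [k2 [e5 hs5 k1b k2b out]]].
  have large j := @step_size_large c eps m L j c0 cm e0 n1 nL m0 L0.
  apply: wp_mono (@final_spec _ _ f a fnorm mono subm cost c eps eta top e0 e16 eta0
    etae etap large topb o0 s5 _ hs5 out); last exact: ltnW.
  move=> s6 [r6 [e6 r61 good]].
  have h1 := effect_trans e2 (effect_all e3 isT isT).
  have h2 := effect_trans h1 e4.
  have h3 := effect_trans h2 (effect_all e5 isT isT).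
  have h4 := effect_trans h3 e6.
  exists r1, k1, k2; eexists; eexists; eexists; split; first exact: h4.
  + split.
    * by move: r61; clear; lia.
    * rewrite !add0n !mulnDr muln1; apply: leq_add; last by rewrite leq_pmull // ltnW.
      by apply: leq_add => //; apply: leq_add.
    * by apply: core_work.
  + exact: r1L.
  + by split.
  + exact: good.
- by rewrite n3.
- by rewrite p3.
- by move=> j; rewrite a3.
- by rewrite a3.
- by rewrite n3.
- by rewrite a3.
- by rewrite n3.
- by rewrite pow3.
Qed.

End Core.

(** Everything is measured in [u = L / eps^2]: bisection rounds, additions and threshold drops are
    each [O(u)], the drops because [1/eps <= 1/eps^2]. *)
Lemma count_bounds (R : realType) (eps C : R) (n m L r1 k1 k2 rr qq ww : nat) :
  0 < eps -> eps <= 1 -> (0 < m)%N -> (0 < L)%N -> (1 < n)%N -> (2 ^ L.-1 < n)%N ->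
  (r1 <= 120 * L)%N -> k1%:R * step_size eps m L <= 1 -> k2%:R * eps <= 32 ->
  (rr <= r1 + k1 + 3)%N -> (qq <= n * rr)%N ->
  (ww <= 300 * (n.+1 * (r1 + k1 + k2).+1))%N -> 2400 * (m%:R + 200) <= C ->
  [/\ rr%:R <= C * (ln n%:R / eps ^+ 2),
      qq%:R <= C * (n%:R * ln n%:R / eps ^+ 2) &
      ww%:R <= C * (1 + n%:R / eps ^+ 2 * ln (2 + n%:R / eps ^+ 2) ^+ 1)].
Proof.
move=> e0 e1 m0 L0 n1 Ln r1L k1b k2b rrb qqb wwb hC.
have mR : 1 <= m%:R :> R by rewrite ler1n.
have LR : 1 <= L%:R :> R by rewrite ler1n.
have nR : 2 <= n%:R :> R by rewrite ler_nat.
pose E := (eps ^+ 2)^-1; have ep2 : 0 < eps ^+ 2 by rewrite exprn_gt0.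
have E1 : 1 <= E by rewrite invf_ge1 // expr_le1 // ltW.
have E0 : 0 <= E by rewrite invr_ge0 ltW.
have l2 : 2^-1 <= ln n%:R :> R by apply: le_trans (@ln2_ge R) (ln_nat_mono n1).
(* [2^(L-1) < n] gives [L <= 1 + 2 ln n], and [1 <= 2 ln n] because [n >= 2]. *)
have L4 : L%:R <= 4 * ln n%:R :> R.
  have h : (L.-1)%:R * ln 2 <= ln n%:R :> R.
    apply: le_trans (ln_nat_mono (ltnW Ln)).
    by rewrite natrX lnXn // mulr_natl.
  have h2 : (L.-1)%:R * 2^-1 <= (L.-1)%:R * ln 2 :> R by rewrite ler_wpM2l // ln2_ge.
  by have -> : L%:R = (L.-1)%:R + 1 :> R; [rewrite natr1 prednK|lra].
pose u := L%:R * E; have u1 : 1 <= u by rewrite /u; nra.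
have r1u : r1%:R <= 120 * u.
  apply: (@le_trans _ _ (120 * L%:R)); first by rewrite -natrM ler_nat.
  by rewrite ler_pM2l // ler_peMr //; lra.
have k1u : k1%:R <= m%:R * u.
  move: k1b; rewrite /step_size mulrA ler_pdivrMr ?mulr_gt0 ?ltr0n // mul1r -expr2.
  by rewrite -ler_pdivlMr // mulrA.
have k2u : k2%:R <= 32 * u.
  have h : k2%:R <= 32 * eps^-1 by rewrite ler_pdivlMr.
  apply: le_trans h _; rewrite ler_pM2l //; apply: (@le_trans _ _ E).
    by rewrite /E lef_pV2 ?posrE // expr2 ler_piMl // ltW.
  by rewrite /u ler_peMl.
have u4 : u <= 4 * (ln n%:R * E) by rewrite /u mulrA ler_wpM2r.
pose y := ln n%:R * E; have y0 : 0 <= y by rewrite mulr_ge0 //; lra.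
rewrite -/y in u4.
have rrR : rr%:R <= (m%:R + 123) * u.
  apply: (@le_trans _ _ (r1 + k1 + 3)%:R); first by rewrite ler_nat.
  by rewrite !natrD; lra.
have rry : rr%:R <= C * y.
  apply: le_trans rrR _; apply: (@le_trans _ _ ((m%:R + 123) * (4 * y))).
    by apply: ler_wpM2l => //; lra.
  by rewrite mulrA; apply: ler_wpM2r => //; lra.
(* 2400 is 300 times 2, from [n + 1 <= 2 n], times 4, from [L <= 4 ln n]. *)
have wwR : ww%:R <= C * (n%:R * y).
  apply: (@le_trans _ _ (300 * ((2 * n%:R) * ((m%:R + 153) * u)))).
    apply: (@le_trans _ _ (300 * (n.+1 * (r1 + k1 + k2).+1))%:R); first by rewrite ler_nat.
    rewrite !natrM; apply: ler_wpM2l; first exact: ler0n.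
    apply: ler_pM; rewrite ?ler0n //; first by rewrite -natr1; lra.
    by rewrite -natr1 !natrD; lra.
  have h : (m%:R + 153) * u <= (m%:R + 153) * (4 * y) by apply: ler_wpM2l => //; lra.
  have n0 : 0 <= n%:R :> R by lra.
  have h2 := ler_wpM2l n0 h.
  have ny : 0 <= n%:R * y by exact: mulr_ge0.
  have h3 := ler_wpM2r ny hC.
  have h4 : 0 <= m%:R * (n%:R * y) by rewrite mulr_ge0.
  by lra.
split.
- exact: rry.
- apply: (@le_trans _ _ (n%:R * rr%:R)); first by rewrite -natrM ler_nat.
  have n0 : 0 <= n%:R :> R by lra.
  by have := ler_wpM2l n0 rry; rewrite /y -/E; lra.
- apply: le_trans wwR _; have C0 : 0 <= C by lra.
  apply: ler_wpM2l => //; rewrite expr1 -/E /y.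
  have nE : n%:R <= n%:R * E by rewrite ler_peMr //; lra.
  have lnn : ln n%:R <= ln (2 + n%:R * E) :> R.
    by rewrite ler_ln ?posrE; lra.
  have nE0 : 0 <= n%:R * E by lra.
  by have := ler_wpM2l nE0 lnn; lra.
Qed.

(** * The full program: trivial regimes and main branch *)

Section Program.
Context {R : realType} {n : nat}.
Variables (f : {set 'I_n} -> R) (a : 'rV[R]_n).
Hypothesis fnorm : normalized_setfun f.
Hypothesis mono : monotone_setfun f.
Hypothesis subm : submodular_setfun f.
Hypothesis cost : forall j, 0 < a 0 j <= 1.
Notation opt := (knapsack_opt f a).
Notation wp := (wp f).

(** In (c) a larger constant weakens the conclusion and strengthens the premise, so the implication
    passes over. *)
Lemma guarantee_mono (c C C' eps : R) x : 0 <= eps -> C <= C' ->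
  guarantee f a c C eps x -> guarantee f a c C' eps x.
Proof.
move=> e0 CC [x0 [dx [hb [hc hd]]]].
have o0 : 0 <= opt by exact: opt_ge0.
have zz : C * eps <= C' * eps by exact: ler_wpM2r.
have h1 : 0 <= 1 - expR (-1 : R) by have := @expRN1_le R; lra.
have e1 : 0 <= 1 - expR (-1 : R) <= 1 - expR (-1) by rewrite h1 lexx.
have g0 : 0 <= 1 - expR (- (1 - sup_norm a)) <= 1 - expR (- (1 - sup_norm a)).
  by rewrite lexx; have /andP[-> _] := approx_factor_le (residual_budget cost).
do 2!split => //; split; first exact: approx_mono o0 (mlext_ge0 fnorm mono x0) zz g0 hb.
split => // lt; case: hc => [|j hj].
  apply: lt_le_trans lt _; rewrite -!mulrA; apply: ler_wpM2r; first exact: mulr_ge0.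
  by rewrite lerD2l lerN2.
exists j; apply: approx_mono o0 _ zz e1 hj.
by apply: mlext_ge0 => // i; rewrite mxE addr_ge0 // nonneg_unit.
Qed.

Lemma init_costs (eps : R) : costs_loaded a (init_state a eps).
Proof. by move=> j; rewrite /= valK. Qed.

Lemma init_point (eps : R) : vec_of n (init_state a eps) ar_x = 0.
Proof. by apply/rowP => j; rewrite !mxE. Qed.

(** Here [ln n = 0], so the bounds permit no round and no query. The all-ones vector is feasible,
    since a single item costs at most 1, and optimal by monotonicity. For [n = 0] the written cell
    lies outside the vector. *)
Lemma tiny_spec (c eps : R) m : (n <= 1)%N -> 0 <= eps ->
  wp (knapsack_cmd m) (fun s => guarantee f a c 0 eps (output n s) /\
    [/\ rounds s = 0%N, queries s = 0%N & work s = 2%N]) (init_state a eps).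
Proof.
move=> n1 e0; apply: wp_if; rewrite /= n1; apply: wp_set_cell; split => //.
set x := output _ _; have x1 j : x 0 j = 1.
  rewrite mxE /= upd_cellE /=; case: eqP => //.
  by case: j => [[|j] jn] //=; move: (leq_trans jn n1).
have x0 : nonneg_vec x by move=> j; rewrite x1.
apply: guarantee_intro (lexx 0) x0 _ _ _ => //.
- rewrite /dotv (eq_bigr (fun j => a 0 j)) => [|j _]; last by rewrite x1 mulr1.
  apply: (@le_trans _ _ (\sum_(j < n) 1)).
    by apply: ler_sum => j _; case/andP: (cost j).
  by rewrite sumr_const card_ord lern1.
- by move=> j _; right.
have oF : opt <= mlext f x.
  apply: opt_le_ub => y hy _; apply: mlext_le => //; first exact: unit_cube_nonneg.
  by move=> j; rewrite x1; case/andP: (hy j).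
by apply: le_trans oF; rewrite mul0r subr0 mul1r ler_piMl ?opt_ge0 //.
Qed.

(** The factor [1 - 16 eps] is not positive, so the zero vector of the initial memory will do. *)
Lemma coarse_spec (c eps : R) m : (1 < n)%N -> 0 <= eps -> 1 <= 16 * eps ->
  wp (knapsack_cmd m) (fun s => guarantee f a c 16 eps (output n s) /\
    [/\ rounds s = 0%N, queries s = 0%N & work s = 3%N]) (init_state a eps).
Proof.
move=> n1 e0 e16; apply: wp_if; rewrite /= leqNgt n1 /=.
apply: wp_if; rewrite /= e16; apply: wp_skip; split => //.
rewrite (_ : output n _ = 0); last exact: init_point.
apply: guarantee_large_eps => //.
- exact: nonneg0.
- by rewrite dotv0.
- by move=> j _; left; rewrite mxE.
Qed.

Lemma setup_work (L r1 k1 k2 w : nat) : (L <= n)%N ->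
  (w <= 250 * (n.+1 * (r1 + k1 + k2).+1))%N ->
  (2 + (3 * L + 3) + (10 * n + 10) + (5 * n + 3) + 2 + w
     <= 300 * (n.+1 * (r1 + k1 + k2).+1))%N.
Proof.
move=> Ln hw; have h3 : (n.+1 <= n.+1 * (r1 + k1 + k2).+1)%N by rewrite leq_pmulr.
by move: (n.+1 * (r1 + k1 + k2).+1)%N hw h3 => z; lia.
Qed.

Lemma program_spec (c eps : R) m : (1 < n)%N -> 0 < eps -> 16 * eps < 1 ->
  0 < c -> c^-1 < m%:R -> (0 < m)%N ->
  wp (knapsack_cmd m) (fun s => exists L r1 k1 k2 : nat,
    [/\ guarantee f a c 512 eps (output n s),
        (0 < L)%N /\ (2 ^ L.-1 < n)%N,
        [/\ (r1 <= 120 * L)%N, k1%:R * step_size eps m L <= 1 & k2%:R * eps <= 32],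
        (rounds s <= r1 + k1 + 3)%N /\ (queries s <= n * rounds s)%N &
        (work s <= 300 * (n.+1 * (r1 + k1 + k2).+1))%N]) (init_state a eps).
Proof.
move=> n1 e0 e16 c0 cm m0; set s0 := init_state a eps.
apply: wp_if; rewrite /= leqNgt n1 /=.
apply: wp_if; rewrite /= leNgt e16 /=.
have e1 : effect [:: nv_log; nv_pow] [::] 0 0 2 s0 (tick (tick s0)).
  by do 2!apply: effect_tick; exact: effect_refl.
have n0 : nmem (tick (tick s0)) nv_n = n by [].
apply: wp_seq; apply: wp_mono (log_spec f n0 n1) => s1 [L [e2 l1 /andP[L0 Ln] nL Ln']].
have e12 := effect_trans e1 e2; have [n1' a1 p1 _ _] := e12.
have x1 : vec_of n s1 ar_x = 0.
  by rewrite -(init_point eps); apply: vec_of_ext; rewrite a1.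
apply: wp_seq; apply: wp_mono (@grad_spec _ _ f s1 _ _ _); last first.
- by rewrite x1; exact: nonneg0.
- by rewrite p1.
- by rewrite n1'.
rewrite x1 => s2 [e3 g2]; have [n2 a2 p2 _ _] := e3.
have n22 : nmem s2 nv_n = n by rewrite n2 // n1'.
apply: wp_seq; apply: wp_mono (max_spec f n22) => s3 [e4 M1 [M0 M2]].
have [n3 a3 p3 _ _] := e4.
set M := rmem s3 ar_pow 0%N in M1 M0 M2.
have slopeM j : slope f 0 j <= M by rewrite -g2.
have Mopt : M <= opt.
  by case: M2 => [->|[j ->]]; rewrite ?opt_ge0 // g2 slope0_le_opt.
(* [opt] is at most the sum of the n singleton values, hence at most [n M]. *)
have optM : opt <= M * 2 ^+ L.
  have sum_le : opt <= \sum_j slope f 0 j by apply: opt_le_sum_slope0.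
  apply: le_trans sum_le _.
  apply: (@le_trans _ _ (\sum_(j < n) M)); first exact: ler_sum.
  rewrite sumr_const card_ord -[_ *+ _]mulr_natr ler_wpM2l // -natrX.
  by rewrite ler_nat.
have x3 : vec_of n s3 ar_x = 0 by rewrite -x1; apply: vec_of_ext; rewrite a3 // a2.
have e14 := effect_trans (effect_trans (effect_all e12 isT isT) (effect_all e3 isT isT))
  (effect_all e4 isT isT).
apply: wp_if => /=; rewrite -/M; case: ifP => [Mle|/negbT].
  (* [M <= 0] forces [opt = 0], so the zero vector is optimal. *)
  apply: wp_skip; exists L, 0%N, 0%N, 0%N.
  have [_ _ _ [r4 q4] w4] := effect_tick (effect_tick e14).
  split => //.
  - rewrite (_ : output n _ = 0) //.
    have M00 : M = 0 by apply/le_anti; rewrite Mle M0.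
    rewrite M00 mul0r in optM.
    apply: guarantee_intro (ltW e0) (ler0n _ 512) _ _ _ _ => //.
    + exact: nonneg0.
    + by rewrite dotv0.
    + by move=> j _; left; rewrite mxE.
    + rewrite mlext0 //; apply: mulr_ge0_le0 => //.
      rewrite mul0r subr0 mul1r subr_ge0.
      by have := @expRN1_le R; lra.
  - by rewrite !mul0r.
  - by rewrite r4 q4 /= !add0n !addn0 muln1.
  - apply: leq_trans w4 _; apply: leq_trans (@setup_work L 0 0 0 0 Ln (leq0n _)).
    by rewrite /= add0n; clear; lia.
rewrite -ltNge => Mpos.
have ep3 : rmem (tick s3) ar_eps 0%N = eps by rewrite /= a3 // a2 // a1.
have c3 : costs_loaded a (tick s3).
  by move=> j; rewrite /= a3 // a2 // a1 //; exact: init_costs.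
have L3 : nmem (tick s3) nv_log = L by rewrite /= n3 // n2.
apply: wp_mono (@core_spec _ _ f a fnorm mono subm cost c eps m L (tick s3) e0 (ltW e16)
  c0 cm m0 n1 _ _ c3 ep3 L3 _ nL _ _ _ _ Mpos Mopt optM).
- move=> s4 [r1 [k1 [k2 [r [q [w [e5 [rb qb wb] r1b [k1b k2b] good]]]]]]].
  have [_ _ _ [r4 q4] w4] := effect_trans (effect_tick e14) e5.
  exists L, r1, k1, k2; split => //.
  + rewrite r4 q4 /= !add0n !addn0; split; first by move: rb; clear; lia.
    by rewrite mulnDr muln1 leq_add2l.
  + apply: leq_trans w4 _; apply: leq_trans (setup_work Ln wb).
    by rewrite /= add0n; clear; lia.
- by rewrite /= n3.
- by rewrite /= p3 p2 p1.
- by rewrite L0.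
- by rewrite /= n3 // n2 // n1'.
- by rewrite /= n3 // n2 // n1'.
- by rewrite /= a3 // a2 // a1.
- by rewrite /= a3 // a2 // a1.
Qed.

End Program.

Unset Implicit Arguments.

Theorem theoremB4 (R : realType) (c : R) (hc : 0 < c) :
  exists (p : cmd) (C : R) (k : nat), 0 < C /\
  forall (n : nat) (f : {set 'I_n} -> R) (a : 'rV[R]_n) (eps : R),
    (forall S, 0 <= f S) -> normalized_setfun f -> monotone_setfun f ->
    submodular_setfun f ->
    (forall j, 0 < a 0 j <= 1) -> 0 < eps ->
    let opt := knapsack_opt f a in
    let g := n%:R / eps ^+ 2 in
    exists s : state R,
      exec f p (init_state a eps) s /\
      let x := output n s in
      nonneg_vec x /\
      (* (a) *) dotv a x <= 1 /\
      (* (b) *) (1 - C * eps) * (1 - expR (- (1 - sup_norm a))) * opt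
                  <= mlext f x /\
      (* (c) *) (mlext f x < (1 - C * eps) * (1 - expR (-1)) * opt ->
                 exists j : 'I_n,
                   (1 - C * eps) * (1 - expR (-1)) * opt
                     <= mlext f (x + delta_mx 0 j)) /\
      (* (d) *) (forall j : 'I_n, c * eps ^+ 2 / ln n%:R <= a 0 j ->
                   x 0 j = 0 \/ x 0 j = 1) /\
      (rounds s)%:R <= C * (ln n%:R / eps ^+ 2) /\
      (queries s)%:R <= C * (n%:R * ln n%:R / eps ^+ 2) /\
      (work s)%:R <= C * (1 + g * ln (2 + g) ^+ k).
Proof.
(* Only this integer carries [c] into the program, whose expressions admit no real constants other
   than integers. *)
pose m := Num.bound c^-1.
have cm : c^-1 < m%:R by apply: archi_boundP; rewrite invr_ge0 ltW.
have m0 : (0 < m)%N by rewrite -(ltr_nat R); apply: lt_trans cm; rewrite invr_gt0.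
have [C hC] : exists C : R, 2400 * (m%:R + 200) <= C by exists (2400 * (m%:R + 200)).
have mR : 0 <= m%:R :> R by exact: ler0n.
have C3 : 3 <= C by lra.
have C16 : 16 <= C by lra.
have C512 : 512 <= C by lra.
have C0 : 0 < C by lra.
exists (knapsack_cmd m), C, 1%N; split => // n f a eps _ fnorm mono subm cost e0 opt g.
have ep2 : 0 <= eps ^+ 2 by rewrite exprn_ge0 // ltW.
have ln0 : 0 <= ln n%:R :> R by exact: ln_nat_ge0.
have g0 : 0 <= g by rewrite divr_ge0.
(* For the branches without queries; the summand 1 in the work bound absorbs their constant work. *)
have idle w : w%:R <= 3 :> R -> [/\ (0%N)%:R <= C * (ln n%:R / eps ^+ 2),
    (0%N)%:R <= C * (n%:R * ln n%:R / eps ^+ 2) &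
    w%:R <= C * (1 + g * ln (2 + g) ^+ 1)].
  move=> w3; split.
  - by apply: mulr_ge0; [exact: ltW|exact: divr_ge0].
  - by apply: mulr_ge0; [exact: ltW|apply: divr_ge0 => //; exact: mulr_ge0].
  - apply: (le_trans w3); apply: (le_trans C3); rewrite -[leLHS]mulr1.
    apply: ler_wpM2l; first exact: ltW.
    by rewrite lerDl expr1 mulr_ge0 // ln_ge0 //; lra.
have [n1|n1] := leqP n 1.
  have [s [es [good [r0 q0 w0]]]] := tiny_spec fnorm mono cost c m n1 (ltW e0).
  have [h1 [h2 [h3 [h4 h5]]]] := guarantee_mono fnorm mono cost (ltW e0) (ltW C0) good.
  have w23 : 2%:R <= 3 :> R by rewrite ler_nat.
  have [b1 b2 b3] := idle 2%N w23.
  by exists s; rewrite r0 q0 w0; do 8?split.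
have [e16|e16] := leP 1 (16 * eps).
  have [s [es [good [r0 q0 w0]]]] := coarse_spec fnorm mono cost c m n1 (ltW e0) e16.
  have [h1 [h2 [h3 [h4 h5]]]] := guarantee_mono fnorm mono cost (ltW e0) C16 good.
  have [b1 b2 b3] := idle 3%N (lexx _).
  by exists s; rewrite r0 q0 w0; do 8?split.
have [s [es [L [r1 [k1 [k2 [good [L0 Ln] [r1b k1b k2b] [rb qb] wb]]]]]]] :=
  program_spec fnorm mono subm cost n1 e0 e16 hc cm m0.
have [h1 [h2 [h3 [h4 h5]]]] := guarantee_mono fnorm mono cost (ltW e0) C512 good.
have e1 : eps <= 1 by lra.
have [b1 b2 b3] := count_bounds e0 e1 m0 L0 n1 Ln r1b k1b k2b rb qb wb hC.
by exists s; do 8?split.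
Qed.
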